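(* Let $a$ be a positive rational number for which there exists an initial condition $(x_0,x_1)$ with $x_0,x_1$ positive rational numbers such that the sequence generated by the Lyness recurrence $x_{n+2}=(a+x_{n+1})/x_n$ is $9$-periodic. Then there exist infinitely many different rational initial conditions giving rise to $9$-periodic sequences (for the same $a$). Moreover, the points $(x_0,x_1)$ corresponding to these rational initial conditions fill densely the (real) elliptic curve $$a(x+1)(y+1)(x+y+a)-(a-1)(a^2-a+1)xy=0.$$
   Context: ''$9$-periodic'' means periodic with prime (least) period exactly $9$. Density refers to the usual topology on the set of real points $(x,y)\in\mathbb{R}^2$ of the curve. *)

(* Defs.v *)
From HB Require Import structures.
From mathcomp Require Import all_boot all_order all_algebra.
From mathcomp Require Import all_classical all_reals all_analysis.
Set Implicit Arguments.
Unset Strict Implicit.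
Unset Printing Implicit Defensive.
Import Order.TTheory GRing.Theory Num.Theory.
Import numFieldNormedType.Exports.
Local Open Scope classical_set_scope.
Local Open Scope ring_scope.

(* Division by 0 is total in MathComp (x / 0 = 0), so the recurrence only makes
   sense together with the requirement that no term vanishes. *)
Definition is_lyness (K : fieldType) (a : K) (x : nat -> K) : Prop :=
  forall n : nat, x n != 0 /\ x n.+2 = (a + x n.+1) / x n.

Definition has_prime_period (T : Type) (k : nat) (x : nat -> T) : Prop :=
  [/\ (0 < k)%N,
      forall n : nat, x (n + k)%N = x n
    & forall j : nat, (0 < j < k)%N -> ~ (forall n : nat, x (n + j)%N = x n)].

(* The pair p = (x_0, x_1) is an initial condition from which the recurrence can
   be iterated forever and yields a sequence of prime period k. *)
Definition lyness_periodic (K : fieldType) (a : K) (k : nat) (p : K * K) : Prop :=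
  exists x : nat -> K,
    [/\ x 0%N = p.1, x 1%N = p.2, is_lyness a x & has_prime_period k x].

Definition lyness9_curve (R : realType) (a : R) : set (R * R) :=
  [set p | a * (p.1 + 1) * (p.2 + 1) * (p.1 + p.2 + a)
           - (a - 1) * (a ^+ 2 - a + 1) * p.1 * p.2 = 0].

Definition real_point (R : realType) (p : rat * rat) : R * R :=
  (ratr p.1, ratr p.2).

Definition fills_densely (T : topologicalType) (S C : set T) : Prop :=
  S `<=` C /\ C `<=` closure S.

(* Main.v *)
(** The level set C on which 9-periodic points live is an elliptic curve over Q. The symmetry
    (x, y) -> (y, x) is inversion in a Weierstrass model Y^2 = f(X), and a rational point of
    order 2 is a fixed point x = y. Such a point would make the sextic
    l^6 + 4l^5 + 10l^4 + 10l^3 + 5l^2 + 2l + 1 a square at l = 1/x + 1/a (rational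
    18-torsion). This happens only for l = 0, -1, where a = 1 and C has no positive point: with
    l = u/v, a square value gives integers alpha, beta with alpha beta = u^2 + uv + v^2 and
    alpha^3 - 2 beta^3 = u^3 + 6u^2 v + 3u v^2 - v^3, hence a point of
    y^3 + w^3 - 2x^3 = 3xyw over Z[zeta_9 + zeta_9^-1], to which infinite descent on the norm
    of x applies, by unique factorization in that ring and in Z[zeta_9].

    Hence f has no rational root, while a positive rational point P lies to the left of a real
    root of f. If there were finitely many rational points, negation would be a fixed-point
    free involution of them, and so would Q -> -P - Q on those other than -P, which is
    contradictory by parity. Infinitely many points with bounded abscissa would contain close
    pairs, whose sum or difference has large abscissa; so abscissas are unbounded, and adding
    a point of large abscissa moves any point slightly in either direction, so no gap can
    remain. *)

(* The sextic has a hidden shape: its homogeneous form H satisfies 9 H = B^2 + 8 Q^3, with Q = u^2 +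
   uv + v^2 and B the cubic form above. So w^2 = H becomes (3w - B)(3w + B) = 8 Q^3, where the
   halves of the two factors are coprime, whence alpha and beta. The delicate prime is 3. Over
   Z[zeta] the cubic equation says that a product of three linear factors is 3 x^3; away from 3
   these are cubes up to units, and two facts remove the units: the cube root of unity is itself a
   cube in Z[zeta], which is why ninth roots are adjoined, and a unit of the real subring congruent
   to a rational integer modulo 3 is a cube. The descent runs only on points where the prime above 3
   divides x. The point coming from the sextic is not of this kind; but the line joining it to the
   known point (tau, -1, 1), with which it agrees modulo that prime, meets the cubic once more in a
   point that is. One round of descent passes through a second curve, a + b + c = -3z, abc = 2z^3,
   and divides the norm of x by at least 27. *)
From HB Require Import structures.
Require Import Defs.
From mathcomp Require Import all_boot all_order all_algebra.
From mathcomp Require Import realalg boolp.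
From mathcomp Require Import ring lra zify.
Set Implicit Arguments.
Unset Strict Implicit.
Unset Printing Implicit Defensive.
Import Order.TTheory GRing.Theory Num.Theory.
Local Open Scope ring_scope.

(** * The rings of integers Z[zeta_9 + zeta_9^-1] and Z[zeta_9] *)

(* Z[tau], where tau^3 = 3 tau - 1, i.e. tau = zeta + zeta^-1 for a primitive ninth root of
   unity zeta; Zf a b c is a + b tau + c tau^2. *)
Record zf := Zf { zf0 : int; zf1 : int; zf2 : int }.

Definition zf_tuple (x : zf) := (zf0 x, zf1 x, zf2 x).
Definition zf_untuple (x : int * int * int) := Zf x.1.1 x.1.2 x.2.
Lemma zf_tupleK : cancel zf_tuple zf_untuple. Proof. by case. Qed.

HB.instance Definition _ := Equality.copy zf (can_type zf_tupleK).
HB.instance Definition _ := Choice.copy zf (can_type zf_tupleK).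

Lemma zf_eqP (x y : zf) : zf0 x = zf0 y -> zf1 x = zf1 y -> zf2 x = zf2 y -> x = y.
Proof. by case: x y => [? ? ?] [? ? ?] /= -> -> ->. Qed.

Definition zf_add (x y : zf) := Zf (zf0 x + zf0 y) (zf1 x + zf1 y) (zf2 x + zf2 y).
Definition zf_opp (x : zf) := Zf (- zf0 x) (- zf1 x) (- zf2 x).
Definition zf_mul (x y : zf) :=
  let: Zf a b c := x in let: Zf d e f := y in
  let m3 := b * f + c * e in let m4 := c * f in
  Zf (a * d - m3) (a * e + b * d + 3 * m3 - m4) (a * f + b * e + c * d + 3 * m4).

Fact zf_addA : associative zf_add.
Proof. by move=> x y z; apply: zf_eqP => /=; ring. Qed.
Fact zf_addC : commutative zf_add.
Proof. by move=> x y; apply: zf_eqP => /=; ring. Qed.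
Fact zf_add0 : left_id (Zf 0 0 0) zf_add.
Proof. by move=> x; apply: zf_eqP => /=; ring. Qed.
Fact zf_addN : left_inverse (Zf 0 0 0) zf_opp zf_add.
Proof. by move=> x; apply: zf_eqP => /=; ring. Qed.

HB.instance Definition _ := GRing.isZmodule.Build zf zf_addA zf_addC zf_add0 zf_addN.

Fact zf_mulA : associative zf_mul.
Proof. by case=> ? ? ? [? ? ?] [? ? ?]; apply: zf_eqP => /=; ring. Qed.
Fact zf_mulC : commutative zf_mul.
Proof. by case=> ? ? ? [? ? ?]; apply: zf_eqP => /=; ring. Qed.
Fact zf_mul1 : left_id (Zf 1 0 0) zf_mul.
Proof. by case=> ? ? ?; apply: zf_eqP => /=; ring. Qed.
Fact zf_mulD : left_distributive zf_mul zf_add.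
Proof. by case=> ? ? ? [? ? ?] [? ? ?]; apply: zf_eqP => /=; ring. Qed.
Fact zf_10 : Zf 1 0 0 != 0 :> zf. Proof. by []. Qed.

HB.instance Definition _ :=
  GRing.Zmodule_isComNzRing.Build zf zf_mulA zf_mulC zf_mul1 zf_mulD zf_10.

(* Z[zeta] as zf[zeta], where zeta^2 = tau zeta - 1; Zo a b is a + b zeta. *)
Record zo := Zo { re : zf; im : zf }.
Definition zo_pair (x : zo) := (re x, im x).
Definition zo_unpair (x : zf * zf) := Zo x.1 x.2.
Lemma zo_pairK : cancel zo_pair zo_unpair. Proof. by case. Qed.
HB.instance Definition _ := Equality.copy zo (can_type zo_pairK).
HB.instance Definition _ := Choice.copy zo (can_type zo_pairK).
Lemma zo_eqP (x y : zo) : re x = re y -> im x = im y -> x = y.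
Proof. by case: x y => [? ?] [? ?] /= -> ->. Qed.

Definition tau : zf := Zf 0 1 0.
Definition zo_add (x y : zo) := Zo (re x + re y) (im x + im y).
Definition zo_opp (x : zo) := Zo (- re x) (- im x).
Definition zo_mul (x y : zo) :=
  let: Zo a b := x in let: Zo c d := y in
  Zo (a * c - b * d) (a * d + b * c + tau * (b * d)).
Fact zo_addA : associative zo_add.
Proof. by move=> x y z; apply: zo_eqP => /=; ring. Qed.
Fact zo_addC : commutative zo_add.
Proof. by move=> x y; apply: zo_eqP => /=; ring. Qed.
Fact zo_add0 : left_id (Zo 0 0) zo_add.
Proof. by move=> x; apply: zo_eqP => /=; ring. Qed.
Fact zo_addN : left_inverse (Zo 0 0) zo_opp zo_add.
Proof. by move=> x; apply: zo_eqP => /=; ring. Qed.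
HB.instance Definition _ := GRing.isZmodule.Build zo zo_addA zo_addC zo_add0 zo_addN.
Fact zo_mulA : associative zo_mul.
Proof. by case=> ? ? [? ?] [? ?]; apply: zo_eqP => /=; ring. Qed.
Fact zo_mulC : commutative zo_mul.
Proof. by case=> ? ? [? ?]; apply: zo_eqP => /=; ring. Qed.
Fact zo_mul1 : left_id (Zo 1 0) zo_mul.
Proof. by case=> ? ?; apply: zo_eqP => /=; ring. Qed.
Fact zo_mulD : left_distributive zo_mul zo_add.
Proof. by case=> ? ? [? ?] [? ?]; apply: zo_eqP => /=; ring. Qed.
Fact zo_10 : Zo 1 0 != 0 :> zo. Proof. by []. Qed.
HB.instance Definition _ :=
  GRing.Zmodule_isComNzRing.Build zo zo_mulA zo_mulC zo_mul1 zo_mulD zo_10.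

(** * Divisibility and coprimality in Bezout domains *)

Section Bezout.
Variable R : comNzRingType.
Implicit Types a b c d u x : R.

Definition dv a b := exists c, b = a * c.
Definition cop a b := exists u v, u * a + v * b = 1.
Definition unt a := exists b, a * b = 1.

Lemma dv_refl a : dv a a. Proof. by exists 1; rewrite mulr1. Qed.
Lemma dv_trans a b c : dv a b -> dv b c -> dv a c.
Proof. by case=> d -> [e ->]; exists (d * e); rewrite mulrA. Qed.
Lemma dv_mull a b c : dv a b -> dv a (c * b).
Proof. by case=> d ->; exists (c * d); ring. Qed.
Lemma dv_mulr a b c : dv a b -> dv a (b * c).
Proof. by case=> d ->; exists (d * c); ring. Qed.
Lemma dv_add a b c : dv a b -> dv a c -> dv a (b + c).
Proof. by case=> d -> [e ->]; exists (d + e); ring. Qed.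
Lemma dv_opp a b : dv a b -> dv a (- b).
Proof. by case=> d ->; exists (- d); ring. Qed.
Lemma dv_sub a b c : dv a b -> dv a c -> dv a (b - c).
Proof. by move=> ab ac; apply: dv_add => //; apply: dv_opp. Qed.
Lemma dv_mul a b c d : dv a b -> dv c d -> dv (a * c) (b * d).
Proof. by case=> e -> [f ->]; exists (e * f); ring. Qed.
Lemma unt_mul a b : unt a -> unt b -> unt (a * b).
Proof. by case=> c ac [d bd]; exists (c * d); rewrite mulrACA ac bd mulr1. Qed.
Lemma unt_exp a n : unt a -> unt (a ^+ n).
Proof. by case=> c ac; exists (c ^+ n); rewrite -exprMn ac expr1n. Qed.
Lemma unt_mulW a b : unt (a * b) -> unt a.
Proof. by case=> c abc; exists (b * c); rewrite mulrA. Qed.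
Lemma unt1 : unt 1. Proof. by exists 1; rewrite mulr1. Qed.
Lemma untN1 : unt (- 1). Proof. by exists (- 1); ring. Qed.

Lemma cop_sym a b : cop a b -> cop b a.
Proof. by case=> u [v uv]; exists v, u; rewrite addrC. Qed.
Lemma cop_mul a b c : cop a b -> cop a c -> cop a (b * c).
Proof.
case=> u [v E] [u' [v' E']]; exists (u * u' * a + u * v' * c + v * b * u'), (v * v').
rewrite -[RHS]mulr1 -{1}E -E'; ring.
Qed.
Lemma cop_exp a b n : cop a b -> cop a (b ^+ n).
Proof.
move=> ab; elim: n => [|n IH]; first by exists 0, 1; rewrite expr0; ring.
by rewrite exprS; apply: cop_mul.
Qed.
Lemma cop_dv a b c : dv c b -> cop a b -> cop a c.
Proof. by case=> d -> [u [v E]]; exists u, (v * d); rewrite -E; ring. Qed.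
Lemma cop_unt a u : unt u -> cop a u.
Proof. by case=> v uv; exists 0, v; rewrite mulrC mulr0 add0r mulrC. Qed.
Lemma gauss a b c : cop a b -> dv a (b * c) -> dv a c.
Proof.
case=> u [v E] [d bcE]; exists (u * c + v * d).
by rewrite -[LHS]mul1r -E mulrDl -(mulrA v) bcE; ring.
Qed.
Lemma cop_unt_dv a b : cop a b -> dv a b -> unt a.
Proof. by case=> u [v E] [d bE]; exists (u + v * d); rewrite -E bE; ring. Qed.

Hypothesis mul0 : forall a b, a * b = 0 -> a = 0 \/ b = 0.
Hypothesis bezout : forall a b, exists d u v, [/\ d = u * a + v * b, dv d a & dv d b].

Lemma mulI a b c : a <> 0 -> a * b = a * c -> b = c.
Proof.
move=> a0 abc; have /mul0[//|/eqP] : a * (b - c) = 0 by rewrite mulrBr abc subrr.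
by rewrite subr_eq0 => /eqP.
Qed.
Lemma exp_neq0 a n : a <> 0 -> a ^+ n <> 0.
Proof.
move=> a0; elim: n => [|n IH]; first by rewrite expr0; apply/eqP; apply: oner_neq0.
by rewrite exprS => /mul0[].
Qed.

Lemma cop_of_common a b : (forall d, dv d a -> dv d b -> unt d) -> cop a b.
Proof.
move=> H; have [d [u [v [dE da db]]]] := bezout a b.
have [e de] := H d da db; exists (e * u), (e * v).
by rewrite -de dE; ring.
Qed.

Lemma gcd_cop a b : a <> 0 -> exists d a' b', [/\ d <> 0, a = d * a', b = d * b' & cop a' b'].
Proof.
move=> a0; have [d [u [v [dE [a' aE] [b' bE]]]]] := bezout a b.
have d0 : d <> 0 by move=> d0; apply: a0; rewrite aE d0 mul0r.
exists d, a', b'; split=> //; exists u, v; apply: (mulI d0).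
by rewrite mulr1 [RHS]dE [in RHS]aE [in RHS]bE; ring.
Qed.

(** Unique factorization enters through gcds: with [d] the gcd of [c] and [a], the cofactor of [d]
    in [a] and [d ^+ 2] divide each other, by two uses of [gauss]. *)
Lemma coprime_mul_cube a b c : a <> 0 -> cop a b -> a * b = c ^+ 3 ->
  exists e d, unt e /\ a = e * d ^+ 3.
Proof.
move=> a0 ab abE; have [d [a' [c' [d0 aE cE a'c']]]] := gcd_cop c a0.
have E1 : a' * b = d ^+ 2 * c' ^+ 3.
  by apply: (mulI d0); rewrite mulrA -aE abE cE; ring.
have db : cop d b by apply/cop_sym/(cop_dv _ (cop_sym ab)); exists a'.
have [e a'E] : dv (d ^+ 2) a'.
  apply: (@gauss _ b); first by apply/cop_sym/cop_exp/cop_sym.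
  by rewrite mulrC E1; apply/dv_mulr/dv_refl.
have [f d2E] : dv a' (d ^+ 2).
  apply: (@gauss _ (c' ^+ 3)); first exact: cop_exp.
  by rewrite mulrC -E1; apply/dv_mulr/dv_refl.
exists e, d; split; last by rewrite aE a'E; ring.
exists f; apply: (mulI (exp_neq0 (n := 2) d0)); rewrite mulr1 mulrA -a'E; exact/esym.
Qed.

Lemma dv_cube a b : dv (a ^+ 3) (b ^+ 3) -> dv a b.
Proof.
have [->|/eqP a0] := eqVneq a 0.
  case=> c; rewrite expr0n /= mul0r => b0.
  suff -> : b = 0 by apply: dv_refl.
  by move: b0; rewrite !exprS expr0 mulr1 => /mul0[//|/mul0[]].
have [d [a' [b' [d0 -> -> c]]]] := gcd_cop b a0.
rewrite !exprMn => -[e E]; have {}E : b' ^+ 3 = a' ^+ 3 * e.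
  by apply: (mulI (exp_neq0 (n := 3) d0)); rewrite E; ring.
have : unt (a' ^+ 3).
  apply: (@cop_unt_dv _ (b' ^+ 3)); last by exists e.
  exact/cop_exp/cop_sym/cop_exp/cop_sym.
by rewrite exprS => /unt_mulW[f af]; exists (f * b'); rewrite mulrA -(mulrA d) af mulr1.
Qed.

(** A common divisor [d] of [a] and [b] divides [x ^+ 3]. Any common divisor of [d] and [x] is a
    unit by hypothesis, so [d] is also coprime to [x ^+ 3]. *)
Lemma cop_of_cube a b c x :
  a * b * c = x ^+ 3 -> (forall d, dv d a -> dv d b -> dv d x -> unt d) -> cop a b.
Proof.
move=> E H; apply: cop_of_common => d da db.
have /cop_unt_dv : cop d (x ^+ 3).
  apply/cop_exp/cop_of_common => e ed ex.
  by apply: H => //; apply: dv_trans ed _.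
by apply; rewrite -E -mulrA; apply: dv_mulr.
Qed.
End Bezout.

(** * Conjugations, norms and reduction modulo the primes above 3 *)

Lemma zfN (x : zf) : - x = Zf (- zf0 x) (- zf1 x) (- zf2 x).
Proof. by []. Qed.
Lemma zf_0E : 0 = Zf 0 0 0. Proof. by []. Qed.
Lemma zf_1E : 1 = Zf 1 0 0. Proof. by []. Qed.
Lemma zf_natE n : n%:R = Zf n%:R 0 0.
Proof. by elim: n => // n IH; rewrite !mulrSr IH. Qed.
Lemma zf_intE (m : int) : m%:~R = Zf m 0 0.
Proof.
case: m => n; first by rewrite -pmulrn zf_natE natz.
by rewrite NegzE mulrNz -pmulrn zf_natE zfN /= natz oppr0.
Qed.
Ltac zfring := rewrite ?expr0 ?exprS ?expr0 ?mulr1; apply: zf_eqP;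
  rewrite ?(zf_1E, zf_0E, zf_natE, zf_intE) /=; ring.

Lemma tau3 : tau ^+ 3 = 3 * tau - 1.
Proof. by []. Qed.
Lemma zf_def (x : zf) : x = (zf0 x)%:~R + (zf1 x)%:~R * tau + (zf2 x)%:~R * tau ^+ 2.
Proof. by case: x => a b c; rewrite !zf_intE; zfring. Qed.

(** Complex conjugation, since the inverse of zeta is tau - zeta; its fixed ring is the image of
    [r2o], and [nrm] is the relative norm. *)
Definition cj (x : zo) := Zo (re x + tau * im x) (- im x).
Definition r2o (x : zf) := Zo x 0.
Definition nrm (x : zo) : zf := re x ^+ 2 + tau * re x * im x + im x ^+ 2.

Lemma zo_0E : 0 = Zo 0 0. Proof. by []. Qed.
Lemma zo_1E : 1 = Zo 1 0. Proof. by []. Qed.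
Lemma zo_natE n : n%:R = Zo n%:R 0.
Proof. by elim: n => // n IH; rewrite !mulrSr IH; apply: zo_eqP => //=; rewrite addr0. Qed.
Ltac zoring := rewrite ?expr0 ?exprS ?expr0 ?mulr1; apply: zo_eqP;
  rewrite ?(zo_1E, zo_0E, zo_natE) /=; ring.

Fact r2o_additive : {morph r2o : x y / x - y}.
Proof. by move=> x y; apply: zo_eqP => /=; ring. Qed.
Fact r2o_multiplicative : monoid_morphism r2o.
Proof. by split=> // x y; apply: zo_eqP => /=; ring. Qed.
HB.instance Definition _ := GRing.isZmodMorphism.Build zf zo r2o r2o_additive.
HB.instance Definition _ := GRing.isMonoidMorphism.Build zf zo r2o r2o_multiplicative.
Fact conj_additive : {morph cj : x y / x - y}.
Proof. by move=> x y; apply: zo_eqP => /=; ring. Qed.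
Fact conj_multiplicative : monoid_morphism cj.
Proof.
split; first by [].
by move=> [a b] [c d]; apply: zo_eqP => /=; ring.
Qed.
HB.instance Definition _ := GRing.isZmodMorphism.Build zo zo cj conj_additive.
HB.instance Definition _ := GRing.isMonoidMorphism.Build zo zo cj conj_multiplicative.

Lemma conjK : involutive cj.
Proof. by case=> a b; apply: zo_eqP => /=; ring. Qed.
Lemma conj_r2o x : cj (r2o x) = r2o x.
Proof. by apply: zo_eqP => /=; ring. Qed.
Lemma r2o_inj : injective r2o. Proof. by move=> x y []. Qed.
Lemma mul_conj x : x * cj x = r2o (nrm x).
Proof. by case: x => a b; rewrite /nrm; zoring. Qed.
Lemma nrmM x y : nrm (x * y) = nrm x * nrm y.
Proof. by case: x y => a b [c d]; rewrite /nrm /=; ring. Qed.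
Lemma nrm_r2o x : nrm (r2o x) = x ^+ 2.
Proof. by rewrite /nrm /=; ring. Qed.
Lemma conj_real x : cj x = x -> x = r2o (re x).
Proof.
case: x => a b [_] /eqP; rewrite eq_sym -subr_eq0 opprK => /eqP bb.
suff -> : b = 0 by [].
by case: b bb => u v w [*]; apply: zf_eqP => /=; lia.
Qed.

(* The automorphism tau |-> tau^2 - 2. *)
Definition gal (x : zf) := let: Zf a b c := x in Zf (a - 2 * b + 4 * c) (- c) (b - c).
Fact sig_additive : {morph gal : x y / x - y}.
Proof. by case=> a b c [d e f]; apply: zf_eqP => /=; ring. Qed.
Fact sig_multiplicative : monoid_morphism gal.
Proof. by split=> // -[a b c] [d e f]; apply: zf_eqP => /=; ring. Qed.
HB.instance Definition _ := GRing.isZmodMorphism.Build zf zf gal sig_additive.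
HB.instance Definition _ := GRing.isMonoidMorphism.Build zf zf gal sig_multiplicative.

(** The absolute norm: the product of the three conjugates is a rational integer, so only its
    constant coordinate survives. *)
Definition NF (x : zf) : int := zf0 (x * (gal x * gal (gal x))).
Lemma NFE x : x * (gal x * gal (gal x)) = (NF x)%:~R.
Proof. by case: x => a b c; rewrite zf_intE; apply: zf_eqP => //=; ring. Qed.
Lemma zf_int_inj : injective (fun m : int => m%:~R : zf).
Proof. by move=> m n; rewrite !zf_intE => -[]. Qed.
Lemma NFM x y : NF (x * y) = NF x * NF y.
Proof. by apply: zf_int_inj; rewrite rmorphM /= -!NFE !rmorphM /=; ring. Qed.
Lemma NF1 : NF 1 = 1. Proof. by []. Qed.

Lemma F3_3 : 3 = 0 :> 'F_3. Proof. exact/val_inj. Qed.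
Lemma F3P (x : 'F_3) : [\/ x = 0, x = 1 | x = -1].
Proof.
by case: x => [[|[|[|]]]] // H; [apply: Or31|apply: Or32|apply: Or33]; apply: val_inj.
Qed.
Lemma F3_int_eq0 (m : int) : (m%:~R == 0 :> 'F_3) = (3 %| m)%Z.
Proof.
have H3 : (3 : int)%:~R = 0 :> 'F_3 by exact/val_inj.
rewrite (divz_eq m 3) rmorphD rmorphM /= H3 mulr0 add0r.
have : (0 <= m %% 3 < 3)%Z by rewrite modz_ge0 // ltz_pmod.
rewrite rpredDl; last exact: dvdz_mull.
by case: (m %% 3)%Z => [[|[|[|]]]|] // *.
Qed.

(* Reduction modulo 2 - tau, the prime above 3, where tau is -1. *)
Definition res (x : zf) : 'F_3 := (zf0 x - zf1 x + zf2 x)%:~R.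
Fact res_additive : {morph res : x y / x - y}.
Proof. by move=> x y; rewrite /res -rmorphB /=; congr _%:~R; ring. Qed.
Fact res_multiplicative : monoid_morphism res.
Proof.
split=> [|[a b c] [d e f]]; first by apply: val_inj.
rewrite /res /= -rmorphM /=; apply/eqP; rewrite -subr_eq0 -rmorphB F3_int_eq0 /=.
by apply/dvdzP; exists (c * f - (b * f + c * e)); ring.
Qed.
HB.instance Definition _ := GRing.isZmodMorphism.Build zf 'F_3 res res_additive.
HB.instance Definition _ := GRing.isMonoidMorphism.Build zf 'F_3 res res_multiplicative.

Definition varpi : zf := 2 - tau.
Definition mu : zf := (tau * (tau + 2)) ^+ 2.
Lemma three_pi : 3 = varpi ^+ 3 * mu. Proof. by []. Qed.
Lemma unt_mu : unt mu.
Proof. by exists (((3 - tau ^+ 2) * (tau ^+ 2 - 2 * tau + 1)) ^+ 2). Qed.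
Lemma res_pi : res varpi = 0. Proof. exact/val_inj. Qed.
Lemma res_mu : res mu = 1. Proof. exact/val_inj. Qed.
Lemma res_t : res tau = -1. Proof. exact/val_inj. Qed.

Lemma dv_piP x : dv varpi x <-> res x = 0.
Proof.
split=> [[y ->]|]; first by rewrite rmorphM /= res_pi mul0r.
move/eqP; rewrite F3_int_eq0 => /dvdzP[k E].
case: x E => a b c /= E.
(* Expansion in powers of [varpi] after substituting [tau = 2 - varpi], together with 3 = varpi (1 +
   tau)^2. *)
exists ((k + b + c)%:~R * (1 + tau) ^+ 2 - (b + 4 * c)%:~R + c%:~R * varpi).
rewrite !zf_intE /varpi; have -> : a = k * 3 + b - c by lia.
by zfring.
Qed.
Lemma cop_pi x : res x != 0 -> cop x varpi.
Proof.
move=> x0; have [e [H1 H2]] : exists e : zf, unt e /\ res (e * x - 1) = 0.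
  case: (F3P (res x)) x0 => E; rewrite E ?eqxx // => _.
    by exists 1; split; [exact: unt1|rewrite rmorphB rmorphM rmorph1 /= E mul1r subrr].
  exists (-1); split; [exact: untN1|rewrite rmorphB rmorphM rmorphN rmorph1 /= E].
  by rewrite mulrNN mulr1 subrr.
have [y yE] := (dv_piP _).2 H2; exists e, (- y).
by rewrite mulNr (mulrC y) -yE; ring.
Qed.

Definition zeta : zo := Zo 0 1.
(** The prime above 3 in Z[zeta]. Up to units, [varpi] is its square and [theta], a square root of
    -3, is its cube. *)
Definition lam : zo := 1 - zeta.
Definition om : zo := zeta ^+ 3.
Definition theta : zo := om - om ^+ 2.
Lemma omP : om ^+ 2 + om + 1 = 0. Proof. by []. Qed.
Lemma theta2 : theta ^+ 2 = -3. Proof. by []. Qed.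
Lemma conj_om : cj om = om ^+ 2. Proof. by []. Qed.
Lemma conj_theta : cj theta = - theta. Proof. by []. Qed.

(** Reduction modulo [lam], under which zeta becomes 1. *)
Definition zres (x : zo) : 'F_3 := res (re x) + res (im x).
Fact zres_additive : {morph zres : x y / x - y}.
Proof. by move=> x y; rewrite /zres /= !rmorphB /=; ring. Qed.
Fact zres_multiplicative : monoid_morphism zres.
Proof.
split=> [|[a b] [c d]]; first by apply: val_inj.
rewrite /zres /= -[a * c - _]/(a * c + - (b * d)) !(rmorphD, rmorphN, rmorphM) /= res_t.
by rewrite -[RHS]subr0 -(mul0r (res b * res d)) -F3_3; ring.
Qed.
HB.instance Definition _ := GRing.isZmodMorphism.Build zo 'F_3 zres zres_additive.
HB.instance Definition _ := GRing.isMonoidMorphism.Build zo 'F_3 zres zres_multiplicative.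

Lemma zres_r2o x : zres (r2o x) = res x.
Proof. by rewrite /zres /= raddf0 addr0. Qed.
Lemma zres_lam : zres lam = 0. Proof. exact/val_inj. Qed.
Lemma zres_conj x : zres (cj x) = zres x.
Proof.
rewrite /zres /= rmorphD rmorphM rmorphN /= res_t.
by rewrite -[RHS]subr0 -(mul0r (res (im x))) -F3_3; ring.
Qed.
Lemma dv_lamP x : dv lam x <-> zres x = 0.
Proof.
split=> [[y ->]|]; first by rewrite rmorphM /= zres_lam mul0r.
rewrite /zres -rmorphD => /dv_piP[y yE]; exists (cj lam * r2o y - r2o (im x)).
rewrite mulrBr mulrA mul_conj; have -> : nrm lam = varpi by [].
rewrite -rmorphM -yE /lam; case: x {y yE} => a b.
by zoring.
Qed.
Lemma nrm_res x : res (nrm x) = zres x ^+ 2.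
Proof. by rewrite -zres_r2o -mul_conj rmorphM /= zres_conj. Qed.

Definition theta_u : zo := Zo (Zf (-1) 3 2) (Zf 2 (-3) (-2)).
Lemma theta_lam : theta = lam ^+ 3 * theta_u. Proof. by []. Qed.
Lemma unt_theta_u : unt theta_u. 
Proof. by exists (cj theta_u * r2o (((3 - tau ^+ 2) * (tau ^+ 2 - 2 * tau + 1)) ^+ 2)). Qed.

(** * Real embeddings: trace against norm *)

Fact rho_ivt (R : rcfType) :
  exists2 x : R, 49 / 32 <= x <= 23 / 15 & root ('X^3 - 3 *: 'X + 1) x.
Proof.
by apply: poly_ivt; [lra|rewrite !hornerE /=; apply/andP; split; lra].
Qed.
Lemma rho_bounds (R : realFieldType) (x : R) : 49 / 32 <= x <= 23 / 15 ->
  11 / 32 <= x ^+ 2 - 2 <= 6 / 17.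
Proof.
move=> /andP[x1 x2].
have h1 : 0 <= (x - 49 / 32) * (x - 49 / 32) by apply: mulr_ge0; lra.
have h2 : 0 <= (x - 49 / 32) * (23 / 15 - x) by apply: mulr_ge0; lra.
by apply/andP; split; lra.
Qed.
Fact rho_ex : exists2 x : realalg, 49 / 32 <= x <= 23 / 15 & root ('X^3 - 3 *: 'X + 1) x.
Proof. exact: rho_ivt. Qed.
(** This is 2 cos 40 degrees; the conjugates [rho ^+ 2 - 2] and [2 - rho - rho ^+ 2] are 2 cos 80
    and 2 cos 160 degrees. The bracket is narrow because the estimates on units depend on it. *)
Definition rho : realalg := s2val (sig2W rho_ex).
Lemma rho_bd : 49 / 32 <= rho <= 23 / 15.
Proof. by rewrite /rho; case: (sig2W _). Qed.
Lemma rho3 : rho ^+ 3 = 3 * rho - 1.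
Proof.
rewrite /rho; case: (sig2W _) => x _ /= /rootP; rewrite !hornerE => E; apply/eqP; rewrite -subr_eq0; apply/eqP.
by rewrite -E; ring.
Qed.

Definition ev (x : zf) : realalg :=
  (zf0 x)%:~R + (zf1 x)%:~R * rho + (zf2 x)%:~R * rho ^+ 2.
Fact ev_additive : {morph ev : x y / x - y}.
Proof. by move=> x y; rewrite /ev /= !(rmorphD, rmorphN) /=; ring. Qed.
Fact ev_multiplicative : monoid_morphism ev.
Proof.
split=> [|[a b c] [d e f]]; first by rewrite /ev /=; ring.
rewrite /ev /= !(rmorphD, rmorphN, rmorphM) /=.
have r4 : rho ^+ 4 = 3 * rho ^+ 2 - rho by rewrite (exprD rho 3 1) rho3; ring.
set A := a%:~R; set B := b%:~R; set C := c%:~R.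
set D := d%:~R; set E := e%:~R; set F := f%:~R.
transitivity (A * D + (A * E + B * D) * rho + (A * F + B * E + C * D) * rho ^+ 2
   + (B * F + C * E) * rho ^+ 3 + C * F * rho ^+ 4); last by ring.
by rewrite r4 rho3; ring.
Qed.
HB.instance Definition _ := GRing.isZmodMorphism.Build zf realalg ev ev_additive.
HB.instance Definition _ := GRing.isMonoidMorphism.Build zf realalg ev ev_multiplicative.

(* One third of the trace. *)
Definition Tz (x : zf) : int := zf0 x + 2 * zf2 x.
Lemma ev_tr x : ev x + ev (gal x) + ev (gal (gal x)) = 3 * (Tz x)%:~R.
Proof. by case: x => a b c; rewrite /ev /Tz /= !(rmorphD, rmorphN, rmorphM) /=; ring. Qed.
Lemma ev_NF x : ev x * ev (gal x) * ev (gal (gal x)) = (NF x)%:~R.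
Proof. by rewrite -!rmorphM -mulrA NFE rmorph_int. Qed.
Lemma ev_tau : ev tau = rho. Proof. by rewrite /ev /=; ring. Qed.
Lemma ev_gtau : ev (gal tau) = rho ^+ 2 - 2.
Proof. by rewrite /ev /= ; ring. Qed.
Lemma ev_ggtau : ev (gal (gal tau)) = 2 - rho - rho ^+ 2.
Proof. by rewrite /ev /=; ring. Qed.

Lemma form_ge0 (R : realFieldType) (s p q : R) : -2 <= s <= 2 -> 0 <= p ^+ 2 + s * p * q + q ^+ 2.
Proof.
move=> /andP[s1 s2]; rewrite -(pmulr_rge0 _ (ltr0Sn R 3)).
have -> : 4 * (p ^+ 2 + s * p * q + q ^+ 2) = (2 * p + s * q) ^+ 2 + (s + 2) * (2 - s) * q ^+ 2 by ring.
apply: addr_ge0; first exact: sqr_ge0.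
by apply: mulr_ge0 (sqr_ge0 _); apply: mulr_ge0; lra.
Qed.
Lemma AGM3 (R : realFieldType) (a b c : R) : 0 <= a -> 0 <= b -> 0 <= c ->
  27 * (a * b * c) <= (a + b + c) ^+ 3.
Proof.
move=> a0 b0 c0; rewrite -subr_ge0.
have -> : (a + b + c) ^+ 3 - 27 * (a * b * c) =
  (a + b + c) * ((a - b) ^+ 2 + (b - c) ^+ 2 + (c - a) ^+ 2) / 2
  + 3 * (a * (b - c) ^+ 2 + b * (c - a) ^+ 2 + c * (a - b) ^+ 2) by field.
have s0 : 0 <= a + b + c by lra.
have := mulr_ge0 s0 (sqr_ge0 (a - b)); have := mulr_ge0 s0 (sqr_ge0 (b - c)).
have := mulr_ge0 s0 (sqr_ge0 (c - a)); have := mulr_ge0 a0 (sqr_ge0 (b - c)).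
have := mulr_ge0 b0 (sqr_ge0 (c - a)); have := mulr_ge0 c0 (sqr_ge0 (a - b)).
lra.
Qed.

Arguments gal : simpl never.

(** Each conjugate is a value of the form p^2 + s p q + q^2 with s a conjugate of tau, of absolute
    value below 2. *)
Lemma ev_nrm_ge0 X : [/\ 0 <= ev (nrm X), 0 <= ev (gal (nrm X)) & 0 <= ev (gal (gal (nrm X)))].
Proof.
have /andP[a1 a2] := rho_bd; have /andP[b1 b2] := rho_bounds rho_bd.
rewrite /nrm !(rmorphD, rmorphM, rmorphXn) /= ev_tau ev_gtau ev_ggtau.
by split; apply: form_ge0; apply/andP; split; lra.
Qed.

(** The inequality of arithmetic and geometric means for the three conjugates, whose mean is
    [Tz s]. *)
Lemma NF_le_Tz s : 0 <= ev s -> 0 <= ev (gal s) -> 0 <= ev (gal (gal s)) ->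
  (0 <= NF s <= Tz s ^+ 3) /\ 0 <= Tz s.
Proof.
move=> h0 h1 h2; have H := AGM3 h0 h1 h2; rewrite ev_tr ev_NF in H.
have P0 : 0 <= ev s * ev (gal s) * ev (gal (gal s)) by rewrite !mulr_ge0.
have T0 : 0 <= ev s + ev (gal s) + ev (gal (gal s)) by exact: addr_ge0 (addr_ge0 h0 h1) h2.
rewrite ev_NF ler0z in P0; rewrite ev_tr pmulr_rge0 // ler0z in T0.
split=> //; rewrite P0 /= -(ler_int realalg) rmorphXn /=.
rewrite -(ler_pM2l (_ : 0 < 27)) //; apply: le_trans H _.
by rewrite [leLHS](_ : _ = 27 * (Tz s)%:~R ^+ 3) //; ring.
Qed.

Definition N (X : zo) : int := NF (nrm X).
Definition T (X : zo) : int := Tz (nrm X).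
Lemma NM X Y : N (X * Y) = N X * N Y. Proof. by rewrite /N nrmM NFM. Qed.
Lemma N1 : N 1 = 1. Proof. by []. Qed.
Lemma N_ge0 X : 0 <= N X.
Proof. by have [? ? ?] := ev_nrm_ge0 X; have [] // := @NF_le_Tz (nrm X); case/andP. Qed.
Lemma N_le_T X : N X <= T X ^+ 3.
Proof. by have [? ? ?] := ev_nrm_ge0 X; have [] // := @NF_le_Tz (nrm X); case/andP. Qed.

(* The element n0 + n1 zeta + ... + n5 zeta^5. In the coordinates (n_i, n_(i+3)),
   those of zeta^i and zeta^i om, the form T is a sum of three Eisenstein norms. *)
Definition cyc (n0 n1 n2 n3 n4 n5 : int) : zo :=
  Zo (Zf (n0 - n2 + n4 + n5) (- n3 - n5) (- n4)) (Zf (n1 - n3 - n4 + n5) (n2 + n4 - n5) n3).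
Lemma cyc_ex X : exists n0 n1 n2 n3 n4 n5, X = cyc n0 n1 n2 n3 n4 n5.
Proof.
case: X => [[p0 p1 p2] [q0 q1 q2]].
exists (p0 + q1 + 2 * p2), (q0 + 2 * q2 - p2 + p1), (q1 + p2 - p1 - q2), q2, (- p2), (- p1 - q2).
by apply: zo_eqP; apply: zf_eqP => /=; ring.
Qed.

Definition eis (a b : int) : int := a ^+ 2 - a * b + b ^+ 2.
Lemma T_cyc n0 n1 n2 n3 n4 n5 : T (cyc n0 n1 n2 n3 n4 n5) = eis n0 n3 + eis n1 n4 + eis n2 n5.
Proof. by rewrite /T /Tz /nrm /eis !expr2 /=; ring. Qed.
Lemma eis_ge0 a b : 0 <= eis a b. Proof. by rewrite /eis; nia. Qed.
Lemma eis0 a b : eis a b = 0 -> a = 0 /\ b = 0. Proof. by rewrite /eis; nia. Qed.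
Lemma T_eq0 X : T X = 0 -> X = 0.
Proof.
have [n0 [n1 [n2 [n3 [n4 [n5 ->]]]]]] := cyc_ex X; rewrite T_cyc.
have := eis_ge0 n0 n3; have := eis_ge0 n1 n4; have := eis_ge0 n2 n5 => ? ? ? ?.
have [|-> ->] := @eis0 n0 n3; first by lia.
have [|-> ->] := @eis0 n1 n4; first by lia.
by have [|-> ->] := @eis0 n2 n5; first by lia.
Qed.
Lemma NF_expl a b c : NF (Zf a b c) = a ^+ 3 + 6 * a ^+ 2 * c - 3 * a * b ^+ 2 + 3 * a * b * c
  + 9 * a * c ^+ 2 - b ^+ 3 + 3 * b * c ^+ 2 + c ^+ 3.
Proof. by rewrite /NF /=; ring. Qed.

Lemma parity (a : int) : exists b : int, a = 2 * b \/ a = 2 * b + 1.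
Proof. by exists (a %/ 2)%Z; lia. Qed.

(** This is the inertness of 2: the norm form has no nontrivial zero modulo 2, as the eight parity
    classes show. *)
Lemma NF_even x m : NF x = 2 * m -> exists y, x = 2 * y.
Proof.
case: x => a b c; rewrite NF_expl.
have [a' [->|->]] := parity a; have [b' [->|->]] := parity b; have [c' [->|->]] := parity c;
  try by move=> H; exfalso; lia.
by exists (Zf a' b' c'); zfring.
Qed.

(** Infinite descent: a zero of the norm form is even, and half of it is a smaller zero. *)
Lemma NF_eq0 x : NF x = 0 -> x = 0.
Proof.
have [n] := ubnP (`|zf0 x| + `|zf1 x| + `|zf2 x|)%N.
elim: n x => // n IH x; rewrite ltnS => xn x0.
have [y xE] : exists y, x = 2 * y by apply: (@NF_even _ 0); rewrite x0.
have y2 : 2 * y = y + y by ring.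
have y0 : NF y = 0 by move: x0; rewrite xE NFM => /eqP; rewrite mulf_eq0 => /orP[|/eqP].
have E0 : zf0 x = 2 * zf0 y by rewrite xE y2 /=; ring.
have E1 : zf1 x = 2 * zf1 y by rewrite xE y2 /=; ring.
have E2 : zf2 x = 2 * zf2 y by rewrite xE y2 /=; ring.
have [E|/eqP yn0] := eqVneq y 0; first by rewrite xE E mulr0.
rewrite xE (IH y) ?mulr0 //; rewrite E0 E1 E2 in xn.
case: y yn0 {E0 E1 E2 IH xE y0 y2} xn => u v w /= yn0 xn.
have : ~ (u = 0 /\ v = 0 /\ w = 0) by move=> [? [? ?]]; apply: yn0; apply: zf_eqP.
lia.
Qed.

Lemma zf_mul0 (x y : zf) : x * y = 0 -> x = 0 \/ y = 0.
Proof.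
move=> /(congr1 NF); rewrite NFM => /eqP; rewrite mulf_eq0.
by case/orP => /eqP /NF_eq0; [left|right].
Qed.
Lemma nrm_eq0 X : nrm X = 0 -> X = 0.
Proof. by move=> X0; apply: T_eq0; rewrite /T X0. Qed.
Lemma N_eq0 X : N X = 0 -> X = 0.
Proof. by move/NF_eq0/nrm_eq0. Qed.
Lemma zo_mul0 (x y : zo) : x * y = 0 -> x = 0 \/ y = 0.
Proof.
move=> /(congr1 N); rewrite NM => /eqP; rewrite mulf_eq0.
by case/orP => /eqP /N_eq0; [left|right].
Qed.
Lemma N_gt0 X : X <> 0 -> 0 < N X.
Proof. by rewrite lt_neqAle eq_sym N_ge0 andbT => X0; apply/eqP => /N_eq0. Qed.

(** * Euclidean division in both rings *)

Lemma eis_reduce_small (n r1 r2 : int) : 0 < n -> `|2 * r1| <= n -> `|2 * r2| <= n ->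
  exists d1 d2, 3 * eis (r1 - n * d1) (r2 - n * d2) <= n ^+ 2 /\
   (3 * eis (r1 - n * d1) (r2 - n * d2) = n ^+ 2 ->
    exists k, n = 3 * k /\ (r1 - n * d1 = k /\ r2 - n * d2 = - k \/ r1 - n * d1 = - k /\ r2 - n * d2 = k)).
Proof.
wlog : r1 r2 / 0 <= r1 => [hw|r10] n0 R1 R2.
  have [|/ltW r1n] := leP 0 r1; first by move=> h; apply: hw.
  have [] := hw (- r1) (- r2); try lia.
  move=> d1 [d2 [H1 H2]]; exists (- d1), (- d2).
  have <- : eis (- r1 - n * d1) (- r2 - n * d2) = eis (r1 - n * - d1) (r2 - n * - d2) by rewrite /eis; ring.
  by split=> // /H2[k [-> H]]; exists k; split=> //; lia.
have [r2p|r2n] := leP 0 r2.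
  exists 0, 0; rewrite !mulr0 !subr0 /eis; split; first by nia.
  by move=> E; exfalso; nia.
set q := - r2; have r2E : r2 = - q by rewrite /q opprK.
rewrite {}r2E in R2 r2n *.
have A0 : 0 <= n - r1 - q by lia.
(* Up to the factor [n], these are the changes of [eis] when the lattice point (0, 0) is replaced by
   (1, 0) or by (0, -1); their signs tell which of the three is nearest. *)
have [A|A] := leP 0 (n - 2 * r1 - q); have [B|B] := leP 0 (n - r1 - 2 * q).
- exists 0, 0; rewrite !mulr0 !subr0 /eis.
  set a := n - 2 * r1 - q in A; set b := n - r1 - 2 * q in B.
  have E : 3 * (r1 ^+ 2 - r1 * - q + (- q) ^+ 2) = n ^+ 2 - (a * (n - a) + b * (n - b) + a * b) by rewrite /a /b; ring.
  have an : a <= n by rewrite /a; lia.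
  have bn : b <= n by rewrite /b; lia.
  have h1 : 0 <= a * (n - a) by apply: mulr_ge0; lia.
  have h2 : 0 <= b * (n - b) by apply: mulr_ge0; lia.
  have h3 : 0 <= a * b by apply: mulr_ge0.
  split; first by rewrite E; lia.
  rewrite E => E'; have {}h1 : a * (n - a) = 0 by lia.
  have {}h2 : b * (n - b) = 0 by lia.
  have {}h3 : a * b = 0 by lia.
  have a0 : a = 0 by case/eqP: h1; rewrite mulf_eq0; nia.
  have b0 : b = 0 by nia.
  by exists r1; split; rewrite /a /b in a0 b0; lia.
- exists 0, (-1); split; rewrite /eis; nia.
- exists 1, 0; split; rewrite /eis; nia.
- have [AB|BA] := leP (n - 2 * r1 - q) (n - r1 - 2 * q).
    exists 1, 0; split; rewrite /eis; nia.
  exists 0, (-1); split; rewrite /eis; nia.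
Qed.

(** The covering radius of the hexagonal lattice is 1 / sqrt 3, attained only at the deep holes,
    which are plus or minus (1/3, -1/3) modulo the lattice. The equality clause serves the
    borderline case of [euclid]. *)
Lemma eis_reduce (n w1 w2 : int) : 0 < n ->
  exists d1 d2, 3 * eis (w1 - n * d1) (w2 - n * d2) <= n ^+ 2 /\
   (3 * eis (w1 - n * d1) (w2 - n * d2) = n ^+ 2 ->
    exists k, n = 3 * k /\ (w1 - n * d1 = k /\ w2 - n * d2 = - k \/ w1 - n * d1 = - k /\ w2 - n * d2 = k)).
Proof.
move=> n0; have H (w : int) : exists q, `|2 * (w - n * q)| <= n.
  by exists ((2 * w + n) %/ (2 * n))%Z; nia.
have [q1 H1] := H w1; have [q2 H2] := H w2.
have [d1 [d2 [E1 E2]]] := eis_reduce_small n0 H1 H2.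
exists (q1 + d1), (q2 + d2); have -> : w1 - n * (q1 + d1) = w1 - n * q1 - n * d1 by ring.
have -> : w2 - n * (q2 + d2) = w2 - n * q2 - n * d2 by ring.
by split.
Qed.

Lemma cycD a0 a1 a2 a3 a4 a5 b0 b1 b2 b3 b4 b5 :
  cyc a0 a1 a2 a3 a4 a5 - cyc b0 b1 b2 b3 b4 b5 =
  cyc (a0 - b0) (a1 - b1) (a2 - b2) (a3 - b3) (a4 - b4) (a5 - b5).
Proof. by apply: zo_eqP; apply: zf_eqP => /=; ring. Qed.
Definition z2o (n : int) : zo := r2o (Zf n 0 0).
Lemma z2o_cyc n b0 b1 b2 b3 b4 b5 :
  z2o n * cyc b0 b1 b2 b3 b4 b5 = cyc (n * b0) (n * b1) (n * b2) (n * b3) (n * b4) (n * b5).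
Proof. by apply: zo_eqP; apply: zf_eqP => /=; ring. Qed.
Lemma N_z2o n : N (z2o n) = n ^+ 6.
Proof. by rewrite /N nrm_r2o /NF /=; ring. Qed.

Definition adj (y : zo) : zo := cj y * r2o (gal (nrm y) * gal (gal (nrm y))).
Lemma mul_adj y : y * adj y = z2o (N y).
Proof. by rewrite /adj mulrA mul_conj -rmorphM NFE zf_intE. Qed.

(** The quotient rounds x adj(y) / N(y) in three hexagonal lattices, so that the scaled remainder
    [r] has [T r <= n ^+ 2] and therefore [N r <= n ^+ 6]. If [T r] reaches [n ^+ 2], all three
    coordinate pairs sit at deep holes, and then [r] is [n / 3] times one of eight explicit
    elements, each of norm below 729 = 3^6. *)
Lemma euclid (x y : zo) : y <> 0 -> exists q, N (x - q * y) < N y.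
Proof.
move=> y0; set n := N y; have n0 : 0 < n by exact: N_gt0.
have Na : 0 < N (adj y).
  apply: N_gt0 => a0; have := mul_adj y; rewrite a0 mulr0 => /(congr1 N).
  by rewrite N_z2o -/n (_ : N 0 = 0) // => /esym/eqP; rewrite expf_eq0 /=; lia.
have NN : n * N (adj y) = n ^+ 6 by rewrite -N_z2o -mul_adj NM.
have [w0 [w1 [w2 [w3 [w4 [w5 wE]]]]]] := cyc_ex (x * adj y).
have [a0 [a3 [A1 A2]]] := eis_reduce w0 w3 n0.
have [b0 [b3 [B1 B2]]] := eis_reduce w1 w4 n0.
have [c0 [c3 [C1 C2]]] := eis_reduce w2 w5 n0.
exists (cyc a0 b0 c0 a3 b3 c3); set q := cyc _ _ _ _ _ _.
rewrite -(ltr_pM2r Na) NN -NM mulrBl -mulrA mul_adj wE mulrC z2o_cyc cycD.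
set r := cyc _ _ _ _ _ _.
have rT := N_le_T r; have := N_ge0 r; have := NM.
have TE : T r = eis (w0 - n * a0) (w3 - n * a3) + eis (w1 - n * b0) (w4 - n * b3) +
   eis (w2 - n * c0) (w5 - n * c3) by rewrite T_cyc.
have [Tn _ _|nT _ _] := ltP (T r) (n ^+ 2).
  apply: le_lt_trans rT _; have : 0 <= T r by rewrite TE (addr_ge0 (addr_ge0 (eis_ge0 _ _) (eis_ge0 _ _)) (eis_ge0 _ _)).
  move=> T0; rewrite (exprM n 2 3) ltrXn2r //; lia.
have [k [nk HA]] := A2 ltac:(lia); have [k' [nk' HB]] := B2 ltac:(lia); have [k'' [nk'' HC]] := C2 ltac:(lia).
have {nk' HB} HB : w1 - n * b0 = k /\ w4 - n * b3 = - k \/ w1 - n * b0 = - k /\ w4 - n * b3 = k by lia.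
have {nk'' HC} HC : w2 - n * c0 = k /\ w5 - n * c3 = - k \/ w2 - n * c0 = - k /\ w5 - n * c3 = k by lia.
have [s [Ns rE]] : exists s, N s < 729 /\ r = z2o k * s.
  rewrite /r; case: HA => -[-> ->]; case: HB => -[-> ->]; case: HC => -[-> ->];
   [exists (cyc 1 1 1 (-1) (-1) (-1))|exists (cyc 1 1 (-1) (-1) (-1) 1)
   |exists (cyc 1 (-1) 1 (-1) 1 (-1))|exists (cyc 1 (-1) (-1) (-1) 1 1)
   |exists (cyc (-1) 1 1 1 (-1) (-1))|exists (cyc (-1) 1 (-1) 1 (-1) 1)
   |exists (cyc (-1) (-1) 1 1 1 (-1))|exists (cyc (-1) (-1) (-1) 1 1 1)];
  by (split; [by vm_compute|rewrite z2o_cyc; congr cyc; rewrite ?mulr1 ?mulrN1]).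
have k6 : 0 < k ^+ 6 by rewrite exprn_gt0 //; lia.
by rewrite rE NM N_z2o nk exprMn [ltLHS]mulrC ltr_pM2r //.
Qed.

Lemma bezout_of_euclid (R : comNzRingType) (n : R -> int) :
  (forall x y : R, y <> 0 -> exists q, 0 <= n (x - q * y) < n y) ->
  forall a b : R, exists d u v, [/\ d = u * a + v * b, dv d a & dv d b].
Proof.
move=> H a b; have [m] := ubnP (`|n b|)%N.
elim: m a b => // m IH a b; rewrite ltnS => bm.
have [->|/eqP b0] := eqVneq b 0.
  by exists a, 1, 0; split; [ring|exact: dv_refl|exists 0; ring].
have [q /andP[q0 qb]] := H a b b0.
have [|d [u [v [dE [b' bE] [r rE]]]]] := IH b (a - q * b); first by lia.
exists d, v, (u - v * q); split; [by rewrite dE; ring| |by exists b'].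
by exists (r + q * b'); rewrite mulrDr -rE mulrCA -bE; ring.
Qed.
Lemma zo_bezout (a b : zo) : exists d u v, [/\ d = u * a + v * b, dv d a & dv d b].
Proof.
apply: (@bezout_of_euclid _ N) => x y y0; have [q H] := euclid x y0; exists q.
by rewrite N_ge0 H.
Qed.

Lemma zf_sqr_bound x : (NF x) ^+ 2 <= Tz (x ^+ 2) ^+ 3.
Proof.
rewrite expr2 -NFM -expr2; have [] := @NF_le_Tz (x ^+ 2); last by move=> /andP[].
all: by rewrite expr2 !rmorphM -expr2; apply: sqr_ge0.
Qed.
Lemma zf_coord x : exists m a b, x = Zf (m - 2 * b) a b.
Proof. by case: x => u v w; exists (u + 2 * w), v, w; apply: zf_eqP => //=; lia. Qed.
Lemma Tz_coord m a b : Tz (Zf (m - 2 * b) a b ^+ 2) = m ^+ 2 + 2 * eis a b.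
Proof. by rewrite /Tz /eis expr2 /=; ring. Qed.

(** By [Tz_coord] the trace form is the orthogonal sum of a line and a hexagonal plane. Rounding in
    each leaves at most 1/4 + 2/3 < 1 of [n ^+ 2]. *)
Lemma zf_euclid (x y : zf) : y <> 0 -> exists q, NF (x - q * y) ^+ 2 < NF y ^+ 2.
Proof.
move=> y0.
wlog : y y0 / 0 < NF y => [hw|n0].
  have [|h] := ltP 0 (NF y); first exact: hw.
  have h0 : NF y != 0 by apply/eqP => /NF_eq0.
  have NN : NF (- y) = - NF y by rewrite -mulN1r NFM (_ : NF (-1) = -1) // mulN1r.
  have [||q] := hw (- y); [by move/eqP; rewrite oppr_eq0 => /eqP|by rewrite NN; lia|].
  by rewrite NN sqrrN => H; exists (- q); rewrite mulNr -mulrN.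
set n := NF y in n0 *.
pose y' := gal y * gal (gal y).
have yy : y * y' = Zf n 0 0 by rewrite NFE zf_intE.
have NZ : NF (Zf n 0 0) = n ^+ 3 by rewrite NF_expl; ring.
have Ny : n * NF y' = n ^+ 3 by rewrite -NFM yy NZ.
have [m [a [b wE]]] := zf_coord (x * y').
have [d1 [d2 [H1 _]]] := eis_reduce a b n0.
have [d0 H0] : exists d0, `|2 * (m - n * d0)| <= n by exists ((2 * m + n) %/ (2 * n))%Z; nia.
exists (Zf (d0 - 2 * d2) d1 d2); set q := Zf _ _ _.
have y'0 : 0 < NF y' ^+ 2.
  by have : NF y' = n ^+ 2 by [apply: (@mulfI _ n); [lia|rewrite Ny; ring]]; move=> ->; rewrite -exprM exprn_gt0.
have E : (x - q * y) * y' = Zf ((m - n * d0) - 2 * (b - n * d2)) (a - n * d1) (b - n * d2).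
  by rewrite mulrBl -mulrA yy wE; apply: zf_eqP => /=; ring.
rewrite -(ltr_pM2r y'0) -!exprMn Ny -NFM E.
apply: le_lt_trans (zf_sqr_bound _) _; rewrite Tz_coord.
have -> : (n ^+ 3) ^+ 2 = (n ^+ 2) ^+ 3 by ring.
have := eis_ge0 (a - n * d1) (b - n * d2).
move: H0 H1; set r := m - n * d0; set e := eis _ _ => H0 H1 e0.
have r4 : 4 * r ^+ 2 <= n ^+ 2 by nia.
by rewrite ltrXn2r //; nia.
Qed.
Lemma zf_bezout (a b : zf) : exists d u v, [/\ d = u * a + v * b, dv d a & dv d b].
Proof.
apply: (@bezout_of_euclid _ (fun x => NF x ^+ 2)) => x y y0; have [q H] := zf_euclid x y0; exists q.
by rewrite sqr_ge0 H.
Qed.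

Lemma dv2P (x : zf) : dv 2 x <-> exists m, NF x = 2 * m.
Proof.
split=> [[y ->]|[m /NF_even[y ->]]]; last by exists y.
by exists (4 * NF y); rewrite NFM (_ : NF 2 = 8) //; ring.
Qed.
Lemma prime2 (x y : zf) : dv 2 (x * y) -> dv 2 x \/ dv 2 y.
Proof.
move=> /dv2P[m]; rewrite NFM => E.
have [a [Ea|Ea]] := parity (NF x); first by left; apply/dv2P; exists a.
have [b [Eb|Eb]] := parity (NF y); first by right; apply/dv2P; exists b.
by rewrite Ea Eb in E; exfalso; lia.
Qed.
Lemma unt_NF x : unt x <-> NF x = 1 \/ NF x = -1.
Proof.
split=> [[y /(congr1 NF)]|H].
  rewrite NFM NF1 => H; have : `|NF x|%N = 1%N by apply/eqP; rewrite -dvdn1; apply/dvdnP; exists `|NF y|%N; lia.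
  lia.
have := NFE x; case: H => -> E; first by exists (gal x * gal (gal x)); rewrite E.
by exists (- (gal x * gal (gal x))); rewrite mulrN E.
Qed.
(** The squared norm divides 8, so the norm is 1 or 2 up to sign; an even norm would make [x] even
    and its norm a multiple of 8. *)
Lemma sqr_dv2 (x : zf) : dv (x ^+ 2) 2 -> unt x.
Proof.
case=> y /(congr1 NF); rewrite expr2 !NFM (_ : NF 2 = 8) // => E.
have x0 : NF x != 0 by apply/eqP => x0; move: E; rewrite x0; lia.
have [a [Ea|Ea]] := parity (NF x).
  have /dv2P[z xE] : exists m, NF x = 2 * m by exists a.
  by move: E; rewrite xE NFM (_ : NF 2 = 8) //; lia.
apply/unt_NF.
have /dvdn_leq : (`|NF x| ^ 2 %| 8)%N by apply/dvdnP; exists `|NF y|%N; lia.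
move=> /(_ isT) H; have : (`|NF x| < 3)%N by rewrite -(ltn_exp2r _ _ (isT : (0 < 2)%N)); lia.
lia.
Qed.

(** * Roots of unity *)

Definition roots1 : seq zo :=
  [seq zeta ^+ k | k <- iota 0 9] ++ [seq - zeta ^+ k | k <- iota 0 9].
Lemma eis1 a b : eis a b = 1 -> a = 1 /\ b = 0 \/ a = 0 /\ b = 1 \/ a = 1 /\ b = 1 \/
  a = -1 /\ b = 0 \/ a = 0 /\ b = -1 \/ a = -1 /\ b = -1.
Proof.
rewrite /eis => H; have : -1 <= a <= 1 by nia.
have : -1 <= b <= 1 by nia.
move=> hb ha; have : a = -1 \/ a = 0 \/ a = 1 by lia.
have : b = -1 \/ b = 0 \/ b = 1 by lia.
by case=> [Eb|[Eb|Eb]]; case=> [Ea|[Ea|Ea]]; move: H; rewrite Ea Eb; lia.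
Qed.
(** Here [T X] is 1 and a sum of three nonnegative Eisenstein norms, so one of them is 1 and the
    others vanish: three times six candidates. *)
Lemma kronecker X : nrm X = 1 -> X \in roots1.
Proof.
move=> X1; have : T X = 1 by rewrite /T X1.
have [n0 [n1 [n2 [n3 [n4 [n5 ->]]]]]] := cyc_ex X; rewrite T_cyc.
have := eis_ge0 n0 n3; have := eis_ge0 n1 n4; have := eis_ge0 n2 n5 => g2 g1 g0 E.
have : [\/ [/\ eis n0 n3 = 1, eis n1 n4 = 0 & eis n2 n5 = 0],
           [/\ eis n0 n3 = 0, eis n1 n4 = 1 & eis n2 n5 = 0] |
           [/\ eis n0 n3 = 0, eis n1 n4 = 0 & eis n2 n5 = 1]].
  have [h0|h0] : eis n0 n3 = 0 \/ 0 < eis n0 n3 by lia.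
    have [h1|h1] : eis n1 n4 = 0 \/ 0 < eis n1 n4 by lia.
      by apply: Or33; split; lia.
    by apply: Or32; split; lia.
  by apply: Or31; split; lia.
case=> -[].
- move=> /eis1 H /eis0[-> ->] /eis0[-> ->]; 
  by case: H => [|[|[|[|[|]]]]] [-> ->]; vm_compute.
- move=> /eis0[-> ->] /eis1 H /eis0[-> ->]; 
  by case: H => [|[|[|[|[|]]]]] [-> ->]; vm_compute.
- move=> /eis0[-> ->] /eis0[-> ->] /eis1 H; 
  by case: H => [|[|[|[|[|]]]]] [-> ->]; vm_compute.
Qed.

Definition zf3 (x : zf) := [&& 3 %| zf0 x, 3 %| zf1 x & 3 %| zf2 x]%Z.
Lemma dv3_zf3 (x : zf) : dv 3 x -> zf3 x.
Proof.
case=> -[a b c] ->; have -> : 3 * Zf a b c = Zf (3 * a) (3 * b) (3 * c) by zfring.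
by rewrite /zf3 /= !dvdz_mulr.
Qed.
(** A computable consequence of divisibility by [theta], from theta^2 = -3. *)
Definition theta_test (x : zo) := zf3 (re (theta * x)) && zf3 (im (theta * x)).
Lemma dv_theta_test (x : zo) : dv theta x -> theta_test x.
Proof.
case=> y ->; rewrite /theta_test mulrA -expr2 theta2.
have -> : -3 * y = Zo (3 * - re y) (3 * - im y).
  by rewrite -[3]/(3%:R) -mulNrn; apply: zo_eqP; case: y => a b; rewrite ?zo_natE /=; ring.
by rewrite /= !dv3_zf3 //; eexists.
Qed.

Lemma roots1_theta e : e \in roots1 -> dv theta (e - 1) -> e \in [:: 1; om; om ^+ 2].
Proof.
have H : all (fun e => theta_test (e - 1) ==> (e \in [:: 1; om; om ^+ 2])) roots1 by vm_compute.
by move=> He /dv_theta_test T; have := allP H e He; rewrite T.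
Qed.
Lemma roots1_theta2 e : e \in roots1 -> dv theta (e ^+ 2 + e + 1) \/ dv theta (e ^+ 2 + e - 1) ->
  dv theta (e - 1).
Proof.
move=> He H; have : theta_test (e ^+ 2 + e + 1) || theta_test (e ^+ 2 + e - 1).
  by apply/orP; case: H => /dv_theta_test; [left|right].
have H1 : all (fun e => (theta_test (e ^+ 2 + e + 1) || theta_test (e ^+ 2 + e - 1)) ==>
   (e \in [:: 1; om; om ^+ 2])) roots1 by vm_compute.
move/allP: H1 => /(_ e He) /implyP H1 /H1.
rewrite !inE => /or3P[] /eqP->; first by exists 0; rewrite subrr mulr0.
  by exists (- om ^+ 2).
by exists om.
Qed.

(** * Units of the real ring modulo cubes *)

Lemma real_cone (R : realFieldType) (x y : R) : 0 < x -> x <= 1 -> 0 < y -> y <= 1 ->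
  7 / 8 <= 23 / 9 * x + 15 / 11 * y ->
  9 / 16 + 7 / 10 * y <= 22 / 3 * x ->
  7 / 10 + 9 / 16 * x <= 22 / 3 * y ->
  (1 + x + y) ^+ 3 < 216 * (x * y).
Proof.
move=> x0 x1 y0 y1 h1 h2 h3.
(* The convex function (2 + c)^3 lies below its chord between c = 0 and c = 1; this makes the
   inequality linear once a coordinate is at least 1/2. *)
have chord (c : R) : 0 <= c -> c <= 1 -> (2 + c) ^+ 3 <= 8 + 19 * c.
  move=> c0 c1; have c2 : c ^+ 2 <= c by nra.
  have c3 : c ^+ 3 <= c by rewrite exprS; nra.
  lra.
have [hx|hx] := leP (1 / 2) x.
  have : (1 + x + y) ^+ 3 <= (2 + y) ^+ 3 by rewrite lerXn2r ?nnegrE; lra.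
  have : 0 <= (x - 1 / 2) * y by apply: mulr_ge0; lra.
  by have := chord y (ltW y0) y1; lra.
have [hy|hy] := leP (1 / 2) y.
  have : (1 + x + y) ^+ 3 <= (2 + x) ^+ 3 by rewrite lerXn2r ?nnegrE; lra.
  have yx : 0 <= (y - 1 / 2) * x by apply: mulr_ge0; lra.
  by have := chord x (ltW x0) x1; lra.
have hx2 : 11 / 100 <= x by lra.
have hy2 : 11 / 100 <= y by lra.
have xy : 0 <= (x - 11 / 100) * (y - 11 / 100) by apply: mulr_ge0; lra.
have [s sE] : exists s, s = x + y by eexists.
have s2 : s ^+ 2 <= s by nra.
have s3 : s ^+ 3 <= s by rewrite exprS; nra.
have -> : (1 + x + y) ^+ 3 = (1 + s) ^+ 3 by rewrite sE; ring.
lra.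
Qed.

(** The three linear conditions keep the point away from the faces of the octant, where the product
    is small against the sum. Everything is homogeneous, so the largest coordinate can be scaled to
    1. *)
Lemma unit_cone (R : realFieldType) (a b c : R) : 0 < a -> b <= a -> c <= a -> 0 < b -> 0 < c ->
  7 / 8 * a <= 23 / 9 * b + 15 / 11 * c ->
  9 / 16 * a + 7 / 10 * c <= 22 / 3 * b ->
  7 / 10 * a + 9 / 16 * b <= 22 / 3 * c ->
  (a + b + c) ^+ 3 < 216 * (a * b * c).
Proof.
move=> a0 ba ca b0 c0 h1 h2 h3.
have bE : b = a * (b / a) by field; apply: lt0r_neq0.
have cE : c = a * (c / a) by field; apply: lt0r_neq0.
have := @real_cone R (b / a) (c / a); rewrite !ler_pdivrMr // !divr_gt0 // !mul1r.
move=> /(_ isT ba isT ca) H.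
have {}H : (1 + b / a + c / a) ^+ 3 < 216 * (b / a * (c / a)).
  by apply: H; rewrite -(ler_pM2l a0); nra.
have -> : a + b + c = a * (1 + b / a + c / a) by rewrite !mulrDr -bE -cE mulr1.
have -> : 216 * (a * b * c) = a ^+ 3 * (216 * (b / a * (c / a))) by field; apply: lt0r_neq0.
by rewrite exprMn ltr_pM2l // exprn_gt0.
Qed.

Lemma unit_real (R : realFieldType) (A B C : R) :
  A * B * C = 1 -> 0 <= A -> 0 <= B -> 0 <= C -> 6 <= A + B + C ->
  7 / 8 * A <= 23 / 9 * B + 15 / 11 * C ->
  9 / 16 * A + 7 / 10 * C <= 22 / 3 * B ->
  7 / 10 * A + 9 / 16 * B <= 22 / 3 * C -> B <= A -> C <= A -> False.
Proof.
move=> P A0 B0 C0 S h1 h2 h3 BA CA.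
have n0 (x y : R) : x * y = 1 -> 0 <= x -> 0 < x.
  by move=> xy; rewrite le0r => /orP[/eqP x0|//]; move/eqP: xy; rewrite x0 mul0r eq_sym oner_eq0.
have a0 : 0 < A by apply: n0 A0; rewrite -mulrA in P; exact: P.
have b0 : 0 < B by apply: (n0 _ (A * C)) => //; rewrite -P; ring.
have c0 : 0 < C by apply: (n0 _ (A * B)) => //; rewrite -P; ring.
have := unit_cone a0 BA CA b0 c0 h1 h2 h3; rewrite P mulr1 => H.
have : (6 : R) ^+ 3 <= (A + B + C) ^+ 3 by rewrite lerXn2r ?nnegrE //; lra.
by move=> /le_lt_trans /(_ H); lra.
Qed.

(** For [x], [y], [z] the squared conjugates of a unit, the last hypothesis says that no unit of
    [small_units] lowers their sum. Rounding the squared conjugates of the small units up to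
    rationals turns it into the cone conditions (for instance 26/11 - 1 = 15/11). In that cone a
    product 1 forces the sum below 6, since 216 = 6^3. *)
Lemma unit_real3 (R : realFieldType) (a b c x y z : R) :
  49 / 32 <= a <= 23 / 15 -> 11 / 32 <= b <= 6 / 17 -> c = - a - b ->
  a ^+ 2 = b + 2 -> b ^+ 2 = c + 2 -> c ^+ 2 = a + 2 ->
  0 <= x -> 0 <= y -> 0 <= z -> x * y * z = 1 -> 6 <= x + y + z ->
  (forall e f g, (e, f, g) \in [:: (a, b, c); (b, c, a); (c, a, b);
      (1 - b, 1 - c, 1 - a); (1 - c, 1 - a, 1 - b); (1 - a, 1 - b, 1 - c)] ->
    x + y + z <= x * e ^+ 2 + y * f ^+ 2 + z * g ^+ 2) -> False.
Proof.
move=> /andP[a1 a2] /andP[b1 b2] cE aa bb cc x0 y0 z0 P S H.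
have A2 : a ^+ 2 <= 26 / 11 by lra.
have B2 : b ^+ 2 <= 1 / 8 by lra.
have C2 : c ^+ 2 <= 32 / 9 by lra.
have D2 : (1 - b) ^+ 2 <= 7 / 16 by rewrite sqrrB; lra.
have E2 : (1 - c) ^+ 2 <= 25 / 3 by rewrite sqrrB; lra.
have F2 : (1 - a) ^+ 2 <= 3 / 10 by rewrite sqrrB; lra.
have G e f g k l m : (e, f, g) \in [:: (a, b, c); (b, c, a); (c, a, b);
      (1 - b, 1 - c, 1 - a); (1 - c, 1 - a, 1 - b); (1 - a, 1 - b, 1 - c)] ->
   e ^+ 2 <= k -> f ^+ 2 <= l -> g ^+ 2 <= m -> x + y + z <= x * k + y * l + z * m.
  move=> /H h ek fl gm; apply: le_trans h _.
  by rewrite !lerD // ler_wpM2l.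
have h1 := G a b c _ _ _ ltac:(by rewrite !inE eqxx) A2 B2 C2.
have h2 := G b c a _ _ _ ltac:(by rewrite !inE eqxx ?orbT) B2 C2 A2.
have h3 := G c a b _ _ _ ltac:(by rewrite !inE eqxx ?orbT) C2 A2 B2.
have h4 := G (1 - b) (1 - c) (1 - a) _ _ _ ltac:(by rewrite !inE eqxx ?orbT) D2 E2 F2.
have h5 := G (1 - c) (1 - a) (1 - b) _ _ _ ltac:(by rewrite !inE eqxx ?orbT) E2 F2 D2.
have h6 := G (1 - a) (1 - b) (1 - c) _ _ _ ltac:(by rewrite !inE eqxx ?orbT) F2 D2 E2.
move: {H G A2 B2 C2 D2 E2 F2 aa bb cc cE a1 a2 b1 b2} h1 h2 h3 h4 h5 h6 => h1 h2 h3 h4 h5 h6.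
(* The largest conjugate is moved to the front by a cyclic rotation, since the inequalities are
   stable only under these. *)
have [xy|yx] := leP x y.
  have [yz|zy] := leP y z.
    by apply: (@unit_real _ z x y) => //; [rewrite -P; ring|lra..].
  by apply: (@unit_real _ y z x) => //; [rewrite -P; ring|lra..].
have [xz|zx] := leP x z.
  by apply: (@unit_real _ z x y) => //; [rewrite -P; ring|lra..].
by apply: (@unit_real _ x y z) => //; lra.
Qed.

Definition small_units : seq zf :=
  [:: tau; gal tau; gal (gal tau); 1 - gal tau; 1 - gal (gal tau); 1 - tau].
Lemma ev_tr_sqr r : ev r ^+ 2 + ev (gal r) ^+ 2 + ev (gal (gal r)) ^+ 2 = 3 * (Tz (r ^+ 2))%:~R.
Proof. by rewrite -ev_tr expr2 !rmorphM. Qed.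
(** An integer trace above 1 is at least 2, so the squared conjugates sum to at least 6 and
    [unit_real3] applies. *)
Lemma unit_reduce r : unt r -> 1 < Tz (r ^+ 2) ->
  exists2 e, e \in small_units & Tz ((r * e) ^+ 2) < Tz (r ^+ 2).
Proof.
move=> ru r1.
have [/hasP//|/hasPn H] := boolP (has (fun e => Tz ((r * e) ^+ 2) < Tz (r ^+ 2)) small_units).
exfalso; apply: (@unit_real3 _ rho (rho ^+ 2 - 2) (2 - rho - rho ^+ 2)
   (ev r ^+ 2) (ev (gal r) ^+ 2) (ev (gal (gal r)) ^+ 2)).
- exact: rho_bd.
- exact: (rho_bounds rho_bd).
- by ring.
- by ring.
- transitivity (rho ^+ 3 * rho - 4 * rho ^+ 2 + 4); first by ring.
  by rewrite rho3; ring.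
- transitivity (rho ^+ 3 * rho + 2 * rho ^+ 3 - 3 * rho ^+ 2 - 4 * rho + 4); first by ring.
  by rewrite rho3; ring.
- exact: sqr_ge0.
- exact: sqr_ge0.
- exact: sqr_ge0.
- have := ev_NF r; rewrite -!exprMn => ->.
  by case/unt_NF: ru => ->; rewrite ?expr1n // rmorphN sqrrN expr1n.
- rewrite ev_tr_sqr.
  have : (2 : realalg) <= (Tz (r ^+ 2))%:~R by rewrite (ler_int _ 2).
  by lra.
move=> e f g efg.
have [u [us -> -> ->]] : exists u, [/\ u \in small_units, e = ev u, f = ev (gal u) & g = ev (gal (gal u))].
  move: efg; rewrite !inE -ev_ggtau -ev_gtau -ev_tau.
  have g3 : gal (gal (gal tau)) = tau by [].
  case/or4P => [/eqP[-> -> ->]|/eqP[-> -> ->]|/eqP[-> -> ->]|].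
  - by exists tau; split.
  - by exists (gal tau); split; rewrite // !inE eqxx ?orbT.
  - by exists (gal (gal tau)); split; rewrite // !inE eqxx ?orbT.
  case/or3P => /eqP[-> -> ->].
  - by exists (1 - gal tau); split; rewrite ?(rmorphB, rmorph1) //=.
  - by exists (1 - gal (gal tau)); split; rewrite ?(rmorphB, rmorph1) //=.
  - by exists (1 - tau); split; rewrite ?(rmorphB, rmorph1) //=.
have := H u us; rewrite -leNgt -(ler_int realalg) -(ler_pM2l (_ : 0 < 3 :> realalg)) //.
by rewrite -!ev_tr_sqr !rmorphM /= !exprMn.
Qed.

(** Membership modulo cubes of units. The sign is absorbed, as -1 is a cube, and so are negative
    exponents, as the inverse of x is x^2 times a cube. *)
Definition gen (r : zf) := exists i j e, unt e /\ r = tau ^+ i * gal tau ^+ j * e ^+ 3.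
Lemma genM x y : gen x -> gen y -> gen (x * y).
Proof.
move=> [i [j [e [eu ->]]]] [k [l [f [fu ->]]]]; exists (i + k)%N, (j + l)%N, (e * f).
by split; [exact: unt_mul|rewrite !exprD exprMn; ring].
Qed.
Lemma gen_cube e : unt e -> gen (e ^+ 3).
Proof. by exists 0%N, 0%N, e; split=> //; rewrite !expr0; ring. Qed.
Lemma gen_inv x y : unt x -> gen (x ^+ 2) -> y * x = 1 -> gen y.
Proof.
move=> xu gx yx; have -> : y = x ^+ 2 * y ^+ 3.
  by transitivity ((y * x) ^+ 2 * y); [rewrite yx expr1n mul1r|ring].
by apply: genM gx (gen_cube _); exists x.
Qed.
Lemma gen_small u : u \in small_units -> exists2 v, v * u = 1 & gen v.
Proof.
have t1 : unt tau by exists (3 - tau ^+ 2).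
have t2 : unt (gal tau) by exists (gal (3 - tau ^+ 2)).
have g1 : gen tau by exists 1%N, 0%N, 1; split; [exact: unt1|ring].
have g2 : gen (gal tau) by exists 0%N, 1%N, 1; split; [exact: unt1|ring].
have gN x : gen x -> gen (- x).
  move=> gx; rewrite -mulN1r (_ : -1 = (-1) ^+ 3); last by ring.
  by apply: genM gx; apply: gen_cube; exact: untN1.
have gi x y : y * x = 1 -> gen x -> gen y.
  move=> yx gx; apply: (@gen_inv x) => //; last by rewrite expr2; apply: genM.
  by exists y; rewrite mulrC.
have g12 : gen (- (tau * gal tau)) by apply/gN/genM.
have i1 : gen (1 - gal tau) by apply: (gi tau).
have i2 : gen (1 - gal (gal tau)) by apply: (gi (gal tau)).
have g3 : gen (gal (gal tau)) by apply: (gi (- (tau * gal tau))).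
rewrite !inE => /or3P[/eqP->|/eqP->|/or4P[] /eqP->].
- by exists (1 - gal tau).
- by exists (1 - gal (gal tau)).
- by exists (- (tau * gal tau)).
- by exists tau.
- by exists (gal tau).
- by exists (gal (gal tau)).
Qed.

Lemma Tz_sqr_ge0 x : 0 <= Tz (x ^+ 2).
Proof. by have [m [a [b ->]]] := zf_coord x; rewrite Tz_coord; have := eis_ge0 a b; nia. Qed.
Lemma unt_gen r : unt r -> gen r.
Proof.
have [n] := ubnP `|Tz (r ^+ 2)|%N; elim: n r => // n IH r; rewrite ltnS => rn ru.
have [r1|r1] := leP (Tz (r ^+ 2)) 1; last first.
  have [u us H] := unit_reduce ru r1.
  have [v vu gv] := gen_small us.
  have -> : r = (r * u) * v by rewrite -mulrA [u * v]mulrC vu mulr1.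
  apply: genM gv; apply: IH; 
    first by move: (Tz_sqr_ge0 (r * u)) H rn; move: (Tz _) (Tz _) => A B; lia.
  by apply: unt_mul ru _; exists v; rewrite mulrC.
have [m [a [b rE]]] := zf_coord r; move: r1; rewrite rE Tz_coord => r1.
have e0 := eis_ge0 a b.
have /eis0[a0 b0] : eis a b = 0 by nia.
have : m = 0 \/ m = 1 \/ m = -1 by nia.
case=> [m0|m1]; last first.
  rewrite a0 b0; case: m1 => ->; first by rewrite (_ : Zf _ _ _ = 1 ^+ 3) //; apply: gen_cube; exact: unt1.
  by rewrite (_ : Zf _ _ _ = (-1) ^+ 3) //; apply: gen_cube; exact: untN1.
by move: ru => /unt_NF; rewrite rE a0 b0 m0 (_ : NF _ = 0) //; case.
Qed.

Lemma cube_mod3 (e : zf) : exists (c : int) f, e ^+ 3 = Zf c 0 0 + 3 * f.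
Proof.
rewrite (zf_def e); move: (zf0 e) (zf1 e) (zf2 e) => a b c.
exists (a ^+ 3 - b ^+ 3 + c ^+ 3).
set A := a%:~R; set B := b%:~R; set C := c%:~R.
exists (B ^+ 3 * tau + C ^+ 3 * (3 * tau ^+ 2 - 2 * tau) + A ^+ 2 * B * tau + A ^+ 2 * C * tau ^+ 2
  + A * B ^+ 2 * tau ^+ 2 + B ^+ 2 * C * tau ^+ 4 + A * C ^+ 2 * tau ^+ 4 + B * C ^+ 2 * tau ^+ 5
  + 2 * A * B * C * tau ^+ 3).
have t6 : tau ^+ 6 = 9 * tau ^+ 2 - 6 * tau + 1 by [].
rewrite -zf_intE !(rmorphD, rmorphN, rmorphXn) /= -/A -/B -/C.
transitivity (A ^+ 3 + B ^+ 3 * tau ^+ 3 + C ^+ 3 * tau ^+ 6 + 3 * (A ^+ 2 * B * tau + A ^+ 2 * C * tau ^+ 2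
  + A * B ^+ 2 * tau ^+ 2 + B ^+ 2 * C * tau ^+ 4 + A * C ^+ 2 * tau ^+ 4 + B * C ^+ 2 * tau ^+ 5
  + 2 * A * B * C * tau ^+ 3)); first by ring.
by rewrite t6 tau3; ring.
Qed.

Lemma dvdz3_unit (c n : int) : ~~ (3 %| c)%Z -> (3 %| c * n)%Z = (3 %| n)%Z.
Proof. by move=> c3; rewrite Gauss_dvdzr // coprimezE prime_coprime. Qed.

(** Cubes are congruent to integers modulo 3, so [unt_gen] reduces the claim to the nine products
    [tau ^+ i * gal tau ^+ j] with exponents below 3; inspection shows that only the trivial one is
    congruent to an integer. *)
Lemma kummer r : unt r -> (exists c, dv 3 (r - Zf c 0 0)) -> exists2 s, unt s & r = s ^+ 3.
Proof.
move=> ru [c rc].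
have {ru} [i [j [e [eu rE]]]] := unt_gen ru.
have [m [f fE]] := cube_mod3 e.
have m3 : ~~ (3 %| m)%Z.
  apply/negP => /dvdzP[k mE].
  have /unt_NF H : unt (e ^+ 3) by apply: unt_exp.
  have e3 : e ^+ 3 = 3 * (Zf k 0 0 + f).
    by rewrite fE mulrDr; congr (_ + _); rewrite mE; zfring.
  by move: H; rewrite e3 NFM (_ : NF 3 = 27) //; lia.
have [i' [j' [h [hu [i3 [j3 hE]]]]]] : exists i' j' h, unt h /\ (i' < 3)%N /\ (j' < 3)%N /\
   tau ^+ i * gal tau ^+ j = tau ^+ i' * gal tau ^+ j' * h ^+ 3.
  exists (i %% 3)%N, (j %% 3)%N, (tau ^+ (i %/ 3) * gal tau ^+ (j %/ 3)).
  split; first by apply: unt_mul; apply: unt_exp; [exists (3 - tau ^+ 2)|exists (gal (3 - tau ^+ 2))].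
  rewrite !ltn_mod; do 2 split=> //.
  rewrite {1}(divn_eq i 3) {1}(divn_eq j 3) !exprD !exprM exprMn; ring.
have [m' [f' f'E]] := cube_mod3 h.
have m'3 : ~~ (3 %| m')%Z.
  apply/negP => /dvdzP[k mE].
  have /unt_NF H : unt (h ^+ 3) by apply: unt_exp.
  have e3 : h ^+ 3 = 3 * (Zf k 0 0 + f').
    by rewrite f'E mulrDr; congr (_ + _); rewrite mE; zfring.
  by move: H; rewrite e3 NFM (_ : NF 3 = 27) //; lia.
set g := tau ^+ i' * gal tau ^+ j' in hE.
have : zf3 (Zf 0 (m * m' * zf1 g) (m * m' * zf2 g)).
  have H : dv 3 (g * Zf m 0 0 * Zf m' 0 0 - Zf c 0 0).
    have -> : g * Zf m 0 0 * Zf m' 0 0 - Zf c 0 0 = (r - Zf c 0 0) - 3 * (g * (f * h ^+ 3 + f' * Zf m 0 0)).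
      have -> : r = g * h ^+ 3 * e ^+ 3 by rewrite rE hE.
      by rewrite fE f'E; ring.
    by apply: dv_sub => //; apply/dv_mulr/dv_refl.
  have := dv3_zf3 H; rewrite /zf3 /=.
  case: (g) => g0 g1 g2 /=.
  have eqv (p q : int) : p = q -> (3 %| p)%Z -> (3 %| q)%Z by move=> ->.
  by case/and3P => _ h1 h2; apply/andP; split; [apply: eqv h1|apply: eqv h2]; ring.
rewrite /zf3 /= -!mulrA !dvdz3_unit // => /andP[g1 g2].
have ij0 : (i' == 0%N) && (j' == 0%N).
  have : all (fun i => all (fun j => (3 %| zf1 (tau ^+ i * gal tau ^+ j))%Z && (3 %| zf2 (tau ^+ i * gal tau ^+ j))%Z
     ==> (i == 0%N) && (j == 0%N)) (iota 0 3)) (iota 0 3) by vm_compute.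
  move/allP/(_ i'); rewrite mem_iota => /(_ i3)/allP/(_ j'); rewrite mem_iota => /(_ j3)/implyP.
  by apply; rewrite g1 g2.
exists (h * e); first exact: unt_mul.
by rewrite rE hE /g; case/andP: ij0 => /eqP-> /eqP->; rewrite !expr0; ring.
Qed.

(** * Descent on y^3 + w^3 - 2x^3 = 3xyw *)

Definition zf_mulI := mulI zf_mul0.
Definition zo_mulI := mulI zo_mul0.

Lemma om2 : om ^+ 2 = - om - 1. Proof. by []. Qed.
Lemma theta_om : theta = 1 + 2 * om. Proof. by []. Qed.
Lemma varpi_neq0 : varpi <> 0. Proof. by []. Qed.
Lemma theta_neq0 : theta <> 0. Proof. by []. Qed.
Lemma lam_theta : dv theta (lam ^+ 3).
Proof.
have [v uv] := unt_theta_u; exists v.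
by rewrite theta_lam -mulrA uv mulr1.
Qed.
Lemma theta_three : dv theta 3.
Proof. by exists (- theta). Qed.
Lemma varpi_theta : dv (r2o varpi) theta.
Proof. by exists (Zo (Zf 1 (-2) (-1)) (Zf (-2) 2 2)). Qed.
Lemma theta_varpi2 : dv theta (r2o (varpi ^+ 2)).
Proof.
have -> : r2o (varpi ^+ 2) = lam ^+ 2 * cj lam ^+ 2 by [].
have -> : cj lam = - zeta ^+ 8 * lam by [].
apply: dv_trans lam_theta _.
by exists (zeta ^+ 16 * lam); ring.
Qed.
Lemma varpi3_three : dv 3 (varpi ^+ 3).
Proof.
have [v uv] := unt_mu; exists v.
by rewrite three_pi -mulrA uv mulr1.
Qed.
Lemma cop_lam X : zres X != 0 -> cop X lam.
Proof.
move=> x0; have [e [H1 H2]] : exists e : zo, unt e /\ zres (e * X - 1) = 0.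
  case: (F3P (zres X)) x0 => E; rewrite E ?eqxx // => _.
    by exists 1; split; [exact: unt1|rewrite rmorphB rmorphM rmorph1 /= E mul1r subrr].
  exists (-1); split; [exact: untN1|rewrite rmorphB rmorphM rmorphN rmorph1 /= E].
  by rewrite mulrNN mulr1 subrr.
have [Y YE] := (dv_lamP _).2 H2; exists e, (- Y).
by rewrite mulNr (mulrC Y) -YE; ring.
Qed.

Lemma sign_F3 (c : 'F_3) : c != 0 -> exists2 s : int, s = 1 \/ s = -1 & c = s%:~R.
Proof.
case: (F3P c) => -> // _; first by exists 1; [left|].
by exists (-1); [right|rewrite rmorphN].
Qed.
Lemma zres_int (s : int) : zres s%:~R = s%:~R. Proof. exact: rmorph_int. Qed.
Lemma res_int (s : int) : res s%:~R = s%:~R. Proof. exact: rmorph_int. Qed.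

(** In the cube of s + lam Y the cross terms carry 3 and the last term carries lam^3, which is
    associated to [theta]. *)
Lemma cube_theta X (s : int) : s = 1 \/ s = -1 -> zres X = s%:~R -> dv theta (X ^+ 3 - s%:~R).
Proof.
move=> s1 Xs; have : zres (X - s%:~R) = 0 by rewrite rmorphB /= zres_int Xs subrr.
case/dv_lamP => Y YE.
have -> : X ^+ 3 - s%:~R = lam ^+ 3 * Y ^+ 3 + 3 * (s%:~R ^+ 2 * (lam * Y) + s%:~R * (lam * Y) ^+ 2).
  have ss : s%:~R = s%:~R ^+ 3 :> zo by case: s1 => ->; rewrite ?rmorphN rmorph1; ring.
  transitivity (X ^+ 3 - s%:~R ^+ 3); first by rewrite -ss.
  by rewrite -exprMn -YE; ring.
by apply: dv_add; apply: dv_mulr; [exact: lam_theta|exact: theta_three].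
Qed.
Lemma cube_three x (s : int) : s = 1 \/ s = -1 -> res x = s%:~R -> dv 3 (x ^+ 3 - s%:~R).
Proof.
move=> s1 xs; have : res (x - s%:~R) = 0 by rewrite rmorphB /= res_int xs subrr.
case/dv_piP => y yE.
have -> : x ^+ 3 - s%:~R = varpi ^+ 3 * y ^+ 3 + 3 * (s%:~R ^+ 2 * (varpi * y) + s%:~R * (varpi * y) ^+ 2).
  have ss : s%:~R = s%:~R ^+ 3 :> zf by case: s1 => ->; rewrite ?rmorphN rmorph1; ring.
  transitivity (x ^+ 3 - s%:~R ^+ 3); first by rewrite -ss.
  by rewrite -exprMn -yE; ring.
by apply: dv_add; apply: dv_mulr; [exact: varpi3_three|exact: dv_refl].
Qed.

(* Equivalently y^3 + w^3 + x^3 - 3xyw = 3x^3, whose left side splits over zo as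
   (x + y + w) * V * cj V with V = fV y w x. *)
Definition onE (y w x : zf) := y ^+ 3 + w ^+ 3 - 2 * x ^+ 3 = 3 * x * y * w.
Definition fV (y w x : zf) : zo := r2o (x - w) + om * r2o (y - w).

Lemma cj_fV y w x : cj (fV y w x) = r2o (x - y) - om * r2o (y - w).
Proof.
rewrite /fV rmorphD rmorphM /= !conj_r2o conj_om om2 !rmorphB /=; ring.
Qed.
Lemma fV_sub y w x : fV y w x - cj (fV y w x) = theta * r2o (y - w).
Proof. by rewrite cj_fV /fV theta_om !rmorphB /=; ring. Qed.
Lemma fV_add y w x : fV y w x + cj (fV y w x) = r2o (2 * x - y - w).
Proof. by rewrite cj_fV /fV !rmorphB rmorphM /= rmorph_nat; ring. Qed.
Lemma nrm_fV y w x : nrm (fV y w x) = (x - w) * (x - y) + (y - w) ^+ 2.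
Proof.
apply: r2o_inj; rewrite -mul_conj cj_fV /fV !(rmorphD, rmorphM, rmorphN, rmorphXn) /=.
set a := r2o x; set b := r2o y; set c := r2o w.
transitivity ((a - c) * (a - b) + (b - c) ^+ 2 - (om ^+ 2 + om + 1) * (b - c) ^+ 2); first by ring.
by rewrite omP mul0r subr0.
Qed.
Lemma onE_mul y w x : onE y w x -> (x + y + w) * nrm (fV y w x) = 3 * x ^+ 3.
Proof.
rewrite nrm_fV => /eqP; rewrite -subr_eq0 => /eqP E.
by apply/eqP; rewrite -subr_eq0 -E; apply/eqP; ring.
Qed.

Lemma unt_of_dv_theta d : dv d theta -> zres d != 0 -> unt d.
Proof.
rewrite theta_lam => dt /cop_lam dl; apply: cop_unt_dv dt.
by apply: cop_mul; [exact: cop_exp|apply: cop_unt; exact: unt_theta_u].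
Qed.
(** Combining the three multiples of [d] yields (1 - om) w and (1 - om) y, so by coprimality [d]
    divides theta = om (1 - om). This leaves only powers of [lam], excluded by the residue. *)
Lemma common_unit y w x d : cop y w -> dv d (fV y w x) -> dv d (cj (fV y w x)) -> dv d (r2o x) ->
  zres d != 0 -> unt d.
Proof.
move=> [u [v yw]] dV dV' dx; apply: unt_of_dv_theta.
have H1 : dv d (om * (fV y w x - r2o x) - (cj (fV y w x) - r2o x)).
  by apply: dv_sub; [apply: dv_mull|]; apply: dv_sub.
have H2 : dv d ((fV y w x - r2o x) - om * (cj (fV y w x) - r2o x)).
  by apply: dv_sub; [|apply: dv_mull]; apply: dv_sub.
have e1 : om * (fV y w x - r2o x) - (cj (fV y w x) - r2o x) = (1 - om) * r2o w.
  rewrite cj_fV /fV !rmorphB /=; set a := r2o x; set b := r2o y; set c := r2o w.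
  transitivity ((1 - om) * c + (om ^+ 2 + om + 1) * (b - c)); first by ring.
  by rewrite omP mul0r addr0.
have e2 : (fV y w x - r2o x) - om * (cj (fV y w x) - r2o x) = (om - 1) * r2o y.
  rewrite cj_fV /fV !rmorphB /=; set a := r2o x; set b := r2o y; set c := r2o w.
  transitivity ((om - 1) * b + (om ^+ 2 + om + 1) * (b - c)); first by ring.
  by rewrite omP mul0r addr0.
have -> : theta = om * (r2o v * ((1 - om) * r2o w) - r2o u * ((om - 1) * r2o y)).
  have uv1 : r2o u * r2o y + r2o v * r2o w = 1 by rewrite -!rmorphM -rmorphD yw.
  by transitivity (om * (1 - om) * (r2o u * r2o y + r2o v * r2o w)); [rewrite uv1|ring].
by rewrite -e1 -e2; apply: dv_mull; apply: dv_sub; apply: dv_mull.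
Qed.

(** The quotient of a unit by its conjugate has relative norm 1, so [kronecker] applies. *)
Lemma unit_conj e : unt e -> exists2 h, h \in roots1 & e = h * cj e.
Proof.
move=> [e' ee]; have cee : cj e * cj e' = 1 by rewrite -rmorphM ee rmorph1.
exists (e * cj e').
  apply: kronecker; apply: r2o_inj; rewrite -mul_conj rmorphM /= conjK rmorph1.
  by transitivity ((e * e') * (cj e * cj e')); [ring|rewrite ee cee mulr1].
by rewrite -mulrA [cj e' * _]mulrC cee mulr1.
Qed.

Lemma unt_cj e : unt e -> unt (cj e).
Proof. by case=> f ef; exists (cj f); rewrite -rmorphM ef rmorph1. Qed.
Lemma unt_zres e : unt e -> zres e != 0.
Proof.
case=> f /(congr1 zres); rewrite rmorphM rmorph1 /= => H.
by apply/eqP => e0; move: H; rewrite e0 mul0r => /eqP; rewrite eq_sym oner_eq0.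
Qed.
Lemma unt_res e : unt e -> res e != 0.
Proof.
case=> f /(congr1 res); rewrite rmorphM rmorph1 /= => H.
by apply/eqP => e0; move: H; rewrite e0 mul0r => /eqP; rewrite eq_sym oner_eq0.
Qed.
Lemma unt_r2o x : unt (r2o x) -> unt x.
Proof.
case=> [[f g] /(congr1 re)] /= H; exists f; rewrite -[RHS]H; ring.
Qed.
Lemma dv_zres d a : dv d a -> zres a != 0 -> zres d != 0.
Proof. by case=> b -> ; rewrite rmorphM /= mulf_eq0 negb_or => /andP[]. Qed.
Lemma dv_res d a : dv d a -> res a != 0 -> res d != 0.
Proof. by case=> b -> ; rewrite rmorphM /= mulf_eq0 negb_or => /andP[]. Qed.
Lemma zres_neq0 X : zres X != 0 -> X <> 0.
Proof. by move=> H X0; move: H; rewrite X0 rmorph0 eqxx. Qed.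
Lemma res_neq0 X : res X != 0 -> X <> 0.
Proof. by move=> H X0; move: H; rewrite X0 rmorph0 eqxx. Qed.
Lemma F3_two (a : 'F_3) : 2 * a = - a.
Proof. by rewrite -[LHS]subr0 -(mul0r a) -F3_3; ring. Qed.

(** [V] is coprime to its conjugate and to [u], and the product of the three is a unit times a cube.
    A common factor of [V], [u] and [x] would also divide the conjugate factor, as
    [fV + cj fV = 3 x - (x + y + w)]. *)
Lemma fV_cube y w x V u k : cop y w -> dv V (fV y w x) -> zres V != 0 -> unt k ->
  u * nrm V = k * x ^+ 3 -> dv (r2o u) (r2o (x + y + w)) ->
  exists e X, [/\ unt e, zres e != 0, zres X != 0 & V = e * X ^+ 3].
Proof.
move=> yw VV V0 [k' kk] E uU.
have VV' : dv (cj V) (cj (fV y w x)) by case: VV => g ->; exists (cj g); rewrite rmorphM.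
have E' : V * cj V * r2o (u * k') = r2o x ^+ 3.
  rewrite mul_conj -!rmorphM -rmorphXn; congr r2o.
  by transitivity (u * nrm V * k'); [ring|rewrite E; transitivity (x ^+ 3 * (k * k')); [ring|rewrite kk mulr1]].
have c1 : cop V (cj V).
  apply: (cop_of_cube zo_bezout E') => d dV dV' dx; apply: (@common_unit y w x) => //.
  - exact: dv_trans dV VV.
  - exact: dv_trans dV' VV'.
  - exact: dv_zres dV V0.
have c2 : cop V (r2o (u * k')).
  apply: (@cop_of_cube _ zo_bezout _ _ (cj V) (r2o x)).
    by rewrite -E'; ring.
  move=> d dV du dx; apply: (@common_unit y w x) => //; last exact: dv_zres dV V0.
    exact: dv_trans dV VV.
  have -> : cj (fV y w x) = 3 * r2o x - r2o (x + y + w) - fV y w x.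
    have -> : cj (fV y w x) = fV y w x + cj (fV y w x) - fV y w x by ring.
    rewrite fV_add; move: (fV _ _ _) => F.
    by rewrite !(rmorphB, rmorphD, rmorphM) /= ?rmorph_nat ?rmorph1; ring.
  apply: dv_sub; last exact: dv_trans dV VV.
  apply: dv_sub; first exact: dv_mull.
  apply: dv_trans uU; move: du; rewrite rmorphM.
  have kk2 : r2o k' * r2o k = 1 by rewrite -rmorphM mulrC kk rmorph1.
  by move=> /(@dv_mulr _ _ _ (r2o k)); rewrite -mulrA kk2 mulr1.
have [e [X [eu VE]]] := coprime_mul_cube zo_mul0 zo_bezout (zres_neq0 V0) (cop_mul c1 c2)
  (etrans (mulrA _ _ _) E').
exists e, X; split=> //; first exact: unt_zres.
by apply: contraNneq V0 => X0; rewrite VE rmorphM rmorphXn /= X0 expr0n mulr0.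
Qed.

Lemma F3_cube (a : 'F_3) : a ^+ 3 = a.
Proof. by case: (F3P a) => ->; rewrite ?expr0n ?expr1n //; ring. Qed.
Lemma onE_res y w x : onE y w x -> res y + res w + res x = 0.
Proof.
move/(congr1 res); rewrite !(rmorph_nat, rmorphXn, rmorphB, rmorphD, rmorphM) /= !F3_cube F3_3 F3_two.
by rewrite !mul0r => <-; ring.
Qed.
Lemma F3_two_eq0 (a : 'F_3) : 2 * a = 0 -> a = 0.
Proof. by rewrite F3_two => /eqP; rewrite oppr_eq0 => /eqP. Qed.
Lemma dv_half (d a : zo) : dv d 3 -> dv d (2 * a) -> dv d a.
Proof.
move=> d3 d2; have -> : a = 3 * a - 2 * a by ring.
by apply: dv_sub => //; apply: dv_mulr.
Qed.
Lemma varpi3_inv : exists2 k, unt k & varpi ^+ 3 = 3 * k.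
Proof.
have [v uv] := unt_mu; exists v; first by exists mu; rewrite mulrC.
by rewrite three_pi -mulrA uv mulr1.
Qed.

Lemma nrmXn X n : nrm (X ^+ n) = nrm X ^+ n.
Proof. by elim: n => // n IH; rewrite !exprS nrmM IH. Qed.

(** A local obstruction at 3. After one [varpi] is removed, [V] is e X^3 with e a unit. Modulo
    [theta] cubes become signs, and the equation reads h^2 + h + 1 = 0 or h^2 + h - 1 = 0 for the
    root of unity h = e / cj e. Hence h is 1 modulo [theta], so [varpi] divides y - w, against the
    residues. *)
Lemma onE_side y w x : onE y w x -> cop y w -> res y = 0 -> res w != 0 -> res x != 0 -> False.
Proof.
move=> E yw y0 w0 x0.
have xw : res w = - res x by have := onE_res E; rewrite y0 add0r => /eqP; rewrite addr_eq0 => /eqP.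
have /dv_piP[S1 SE] : res (2 * x - y - w) = 0.
  by rewrite !(rmorph_nat, rmorphB, rmorphM) /= F3_two y0 xw; ring.
pose U1 := varpi ^+ 2 * mu * x - S1.
have UE : x + y + w = varpi * U1.
  rewrite /U1; transitivity (3 * x - (2 * x - y - w)); first by ring.
  by rewrite SE {1}three_pi; ring.
set V := fV y w x.
have VS : 2 * V = r2o (2 * x - y - w) + theta * r2o (y - w).
  by rewrite -(fV_add y w x) -(fV_sub y w x) -/V; ring.
have [V1 VE] : dv (r2o varpi) V.
  apply: dv_half; first by exists (r2o (varpi ^+ 2 * mu)).
  rewrite VS SE rmorphM; apply: dv_add; first exact/dv_mulr/dv_refl.
  exact/dv_mulr/varpi_theta.
have nE : U1 * nrm V1 = mu * x ^+ 3.
  have := onE_mul E; rewrite -/V UE VE nrmM nrm_r2o three_pi => H.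
  apply: (zf_mulI (exp_neq0 zf_mul0 (n := 3) varpi_neq0)).
  by transitivity (varpi * U1 * (varpi ^+ 2 * nrm V1)); [ring|rewrite H; ring].
have V10 : zres V1 != 0.
  apply/eqP => V10; move/(congr1 res): nE.
  rewrite rmorphM [RHS]rmorphM /= nrm_res V10 expr0n mulr0 res_mu mul1r (rmorphXn _ 3) /= F3_cube => /esym/eqP.
  by rewrite (negbTE x0).
have [e [X [eu e0 X0 V1E]]] := @fV_cube y w x V1 U1 mu yw ltac:(by exists (r2o varpi); rewrite -/V VE mulrC)
  V10 unt_mu nE ltac:(by exists (r2o varpi); rewrite UE mulrC rmorphM).
have [h hr eh] := unit_conj eu.
have [s s1 Xs] := sign_F3 X0.
have [s' s'1 es] := sign_F3 e0.
have [x1 xE] : dv (nrm X) x.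
  apply: (dv_cube zf_mul0 zf_bezout); have [m mm] := unt_mu.
  exists (U1 * nrm e * m).
  transitivity (mu * x ^+ 3 * m); first by transitivity (x ^+ 3 * (mu * m)); [rewrite mm mulr1|ring].
  by rewrite -nE V1E nrmM nrmXn; ring.
have nX0 : nrm X <> 0 by apply: res_neq0; rewrite nrm_res expf_neq0.
have x1E : mu * x1 ^+ 3 = U1 * nrm e.
  apply: (zf_mulI (exp_neq0 zf_mul0 (n := 3) nX0)).
  transitivity (mu * x ^+ 3); first by rewrite xE; ring.
  by rewrite -nE V1E nrmM nrmXn; ring.
have x10 : res x1 != 0 by apply: contraNneq x0 => H; rewrite xE rmorphM /= H mulr0.
have [s2 s21 x1s] := sign_F3 x10.
have C1 := cube_theta s1 Xs.
have C2 : dv theta (cj X ^+ 3 - s%:~R) by apply: (cube_theta s1); rewrite zres_conj.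
have C3 : dv theta (cj e ^+ 3 - s'%:~R) by apply: (cube_theta s'1); rewrite zres_conj.
have C4 : dv theta (r2o (mu * x1 ^+ 3) - s2%:~R).
  have -> : r2o (mu * x1 ^+ 3) - s2%:~R = r2o (mu - 1) * r2o (x1 ^+ 3) + r2o (x1 ^+ 3 - s2%:~R).
    by rewrite !(rmorphB, rmorphM, rmorph1, rmorph_int) /=; ring.
  apply: dv_add; first by apply: dv_mulr; apply: dv_trans theta_varpi2 _; exists (r2o (Zf (-21) 49 32)).
  have [c ->] := cube_three s21 x1s; rewrite rmorphM; apply: dv_mulr.
  by rewrite rmorph_nat; exact: theta_three.
have vpo : r2o varpi <> 0 by [].
have sum0 : V1 + cj V1 = r2o S1.
  apply: (zo_mulI vpo); transitivity (r2o (varpi * S1)); last by rewrite rmorphM.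
  by rewrite -SE -(fV_add y w x) -/V VE rmorphM /= conj_r2o; ring.
pose G := r2o U1 + V1 + cj V1.
have GE : dv theta G.
  have -> : G = r2o (varpi ^+ 2) * r2o (mu * x).
    by rewrite /G -addrA sum0 -rmorphD -rmorphM /U1; congr r2o; ring.
  exact/dv_mulr/theta_varpi2.
set c := cj e in eh C3 *; set Y := cj X in C2 *.
have cV1 : cj V1 = c * Y ^+ 3 by rewrite V1E rmorphM rmorphXn.
have ec : e * c = r2o (nrm e) by exact: mul_conj.
(* This is [G] multiplied by [e * c], with each cube replaced by its sign modulo [theta] and [e] by
   [h * c]. *)
have D1 : dv theta (s2%:~R + s%:~R * s'%:~R * (h ^+ 2 + h)).
  have -> : s2%:~R + s%:~R * s'%:~R * (h ^+ 2 + h) = G * (e * c) - (r2o (mu * x1 ^+ 3) - s2%:~R)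
     - e * (e * c) * (X ^+ 3 - s%:~R) - c * (e * c) * (Y ^+ 3 - s%:~R)
     - s%:~R * (h * (h + 1)) * (c ^+ 3 - s'%:~R) :> zo.
    rewrite /G cV1 V1E x1E rmorphM /= -ec.
    transitivity (s2%:~R + s%:~R * s'%:~R * (h ^+ 2 + h)
      + (s%:~R * (e * c) * (e + c) - s%:~R * (h * (h + 1)) * c ^+ 3)); last by ring.
    by rewrite {1 2}eh; ring.
  apply: dv_sub (dv_mull _ C3); apply: dv_sub (dv_mull _ C2); apply: dv_sub (dv_mull _ C1).
  exact: dv_sub (dv_mulr _ GE) C4.
have D2 : dv theta (h ^+ 2 + h + (s2 * (s * s'))%:~R).
  have -> : h ^+ 2 + h + (s2 * (s * s'))%:~R = (s * s')%:~R * (s2%:~R + s%:~R * s'%:~R * (h ^+ 2 + h)) :> zo.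
    by case: s1 => ->; case: s'1 => ->; rewrite ?mulrN1 ?mulN1r ?mulr1 ?rmorphN ?rmorph1 ?opprK ?rmorphN; ring.
  exact: dv_mull.
have D3 : dv theta (h - 1).
  apply: (roots1_theta2 hr).
  have : s2 * (s * s') = 1 \/ s2 * (s * s') = -1 by case: s1 => ->; case: s'1 => ->; case: s21 => ->; auto.
  by case=> E1; move: D2; rewrite E1 ?rmorphN rmorph1; auto.
have [k kE] : dv theta (V1 - cj V1).
  have -> : V1 - cj V1 = e * (X ^+ 3 - s%:~R) - c * (Y ^+ 3 - s%:~R) + s%:~R * c * (h - 1).
    by rewrite cV1 V1E; transitivity (e * X ^+ 3 - c * Y ^+ 3 - s%:~R * (e - h * c)); [rewrite -eh subrr mulr0 subr0|ring].
  by apply: dv_add; [apply: dv_sub|]; apply: dv_mull.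
have : r2o varpi * k = r2o (y - w).
  apply: (zo_mulI theta_neq0); rewrite -(fV_sub y w x) -/V VE rmorphM /= conj_r2o.
  by transitivity (r2o varpi * (theta * k)); [ring|rewrite -kE; ring].
move/(congr1 zres); rewrite rmorphM /= !zres_r2o res_pi mul0r rmorphB /= y0 sub0r => /esym/eqP.
by rewrite oppr_eq0 (negbTE w0).
Qed.

(** The cube roots of unity are cubes of ninth roots, so [h] can be absorbed into [v ^+ 3]; what is
    left is fixed by conjugation. *)
Lemma root_shift e h : e = h * cj e -> h \in [:: 1; om; om ^+ 2] ->
  exists r v, e = r2o r * v ^+ 3 /\ unt v.
Proof.
move=> eh; rewrite !inE => H.
have o3 : om ^+ 3 = 1 by vm_compute.
have z8 : (zeta ^+ 8) ^+ 3 = om ^+ 2 by vm_compute.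
have z7 : (zeta ^+ 7) ^+ 3 = om by vm_compute.
have real E : cj E = E -> E = r2o (re E) := @conj_real E.
case/or3P: H => /eqP hE; rewrite hE in eh.
- exists (re e), 1; split; last exact: unt1.
  by rewrite -real; [rewrite expr1n mulr1|rewrite [RHS]eh mul1r].
- exists (re (om * e)), (zeta ^+ 8); split; last by exists zeta; vm_compute.
  rewrite z8 -real; first by transitivity (om ^+ 3 * e); [rewrite o3 mul1r|ring].
  by rewrite rmorphM /= conj_om [in RHS]eh mulrA -expr2.
- exists (re (om ^+ 2 * e)), (zeta ^+ 7); split; last by exists (zeta ^+ 2); vm_compute.
  rewrite z7 -real; first by transitivity (om ^+ 3 * e); [rewrite o3 mul1r|ring].
  rewrite rmorphM (rmorphXn _ 2) /= conj_om [in RHS]eh mulrA -exprM -exprD.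
  by congr (_ * _).
Qed.

(** Now [V] is [theta] times a factor prime to [lam], and the cube argument gives V = theta r X^3
    and x + y + w = r z^3 with a real unit r. The displayed equation is 3 x = (x + y + w) + (V + cj
    V), divided by r. *)
Lemma onE_factor y w x : onE y w x -> cop y w -> res x = 0 -> res y != 0 -> x <> 0 ->
  exists r X z, [/\ unt r, zres X != 0, x = r * nrm X * z,
    r2o z ^+ 3 + theta * (X ^+ 3 - cj X ^+ 3) = r2o (3 * nrm X * z) &
    forall h, dv h (re X) -> dv h (im X) -> dv h z -> unt h].
Proof.
move=> E yw x0 y0 xn0.
have wy : res w = - res y by have := onE_res E; rewrite x0 addr0 addrC => /eqP; rewrite addr_eq0 => /eqP.
have d0 : res (y - w) != 0.
  rewrite rmorphB /= wy opprK; apply: contraNneq y0 => H; apply/eqP/F3_two_eq0.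
  by rewrite -H; ring.
have /dv_piP[S1 SE1] : res (2 * x - y - w) = 0.
  by rewrite !(rmorph_nat, rmorphB, rmorphM) /= F3_two x0 wy; ring.
have [x' xE] := (dv_piP x).2 x0.
have [m mu_m] := unt_mu.
have vp3 := exp_neq0 zf_mul0 (n := 3) varpi_neq0.
(* A second factor [varpi] in 2x - y - w: modulo [varpi] the factored equation, written with [S1],
   reduces to - S1^3 = 0. *)
have /dv_piP[S2 SE2] : res S1 = 0.
  have H : (varpi ^+ 2 * mu * x - S1) * (S1 ^+ 2 + varpi * mu * (y - w) ^+ 2) = 4 * mu * x ^+ 3.
    apply: (zf_mulI vp3).
    transitivity (4 * (3 * x ^+ 3)); last by rewrite {1}three_pi; ring.
    rewrite -(onE_mul E) nrm_fV.
    transitivity ((3 * x - varpi * S1) * ((varpi * S1) ^+ 2 + 3 * (y - w) ^+ 2)).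
      by rewrite {1 2}three_pi; ring.
    by rewrite -SE1; ring.
  move/(congr1 res): H; rewrite xE.
  have -> : varpi ^+ 2 * mu * (varpi * x') - S1 = varpi * (varpi ^+ 2 * mu * x') - S1 by ring.
  have -> : S1 ^+ 2 + varpi * mu * (y - w) ^+ 2 = S1 ^+ 2 + varpi * (mu * (y - w) ^+ 2) by ring.
  have -> : 4 * mu * (varpi * x') ^+ 3 = varpi * (4 * mu * varpi ^+ 2 * x' ^+ 3) by ring.
  rewrite rmorphM [RHS]rmorphM /= rmorphB rmorphD /= !(rmorphM _ varpi) /= res_pi !mul0r sub0r addr0.
  move=> /eqP; rewrite mulf_eq0 oppr_eq0 => /orP[/eqP//|].
  by rewrite (rmorphXn _ 2) /= sqrf_eq0 => /eqP.
have SE : 2 * x - y - w = varpi ^+ 2 * S2 by rewrite SE1 SE2; ring.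
set V := fV y w x.
have VS : 2 * V = r2o (2 * x - y - w) + theta * r2o (y - w).
  by rewrite -(fV_add y w x) -(fV_sub y w x) -/V; ring.
have [V1 VE] : dv theta V.
  apply: dv_half; first exact: theta_three.
  rewrite VS SE rmorphM; apply: dv_add; last exact/dv_mulr/dv_refl.
  exact/dv_mulr/theta_varpi2.
have cVE : cj V = - theta * cj V1 by rewrite VE rmorphM /= conj_theta.
have V1d : V1 + cj V1 = r2o (y - w).
  apply: (zo_mulI theta_neq0); rewrite -(fV_sub y w x) -/V VE rmorphM /= conj_theta; ring.
have V10 : zres V1 != 0.
  apply: contraNneq d0 => H; apply/eqP; rewrite -zres_r2o -V1d rmorphD /= zres_conj H; ring.
have nE : (x + y + w) * nrm V1 = 1 * x ^+ 3.
  have nt : nrm theta = 3 by vm_compute.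
  have three0 : (3 : zf) <> 0 by move/(congr1 zf0).
  have := onE_mul E; rewrite -/V VE nrmM nt mul1r => H.
  by apply: (zf_mulI three0); rewrite -H; ring.
have [e [X0 [eu e0 X00 V1E]]] := @fV_cube y w x V1 (x + y + w) 1 yw
  ltac:(by exists theta; rewrite -/V VE mulrC) V10 (unt1 _) nE (dv_refl _).
(* The whole [varpi ^+ 3] contained in [x ^+ 3] lies in this factor, because [nrm V1] is prime to
   [varpi]. *)
have U3 : dv 3 (x + y + w).
  apply: dv_trans varpi3_three _.
  have c : cop (varpi ^+ 3) (nrm V1).
    apply/cop_sym/cop_exp/cop_pi; by rewrite nrm_res expf_neq0.
  apply: (gauss c); rewrite mulrC nE mul1r xE exprMn; exact/dv_mulr/dv_refl.
have Vd : dv theta (V1 - cj V1).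
  have [u uE] := U3.
  have H : theta * (V1 - cj V1) = theta * (theta * (r2o u - r2o x)).
    rewrite mulrBr -[X in X - _]VE -[X in _ - X]opprK -mulNr -cVE opprK fV_add.
    have -> : 2 * x - y - w = 3 * x - (x + y + w) by ring.
    by rewrite uE mulrA -expr2 theta2 -mulrBr rmorphM rmorphB /= rmorph_nat; ring.
  exists (r2o u - r2o x); exact: zo_mulI theta_neq0 H.
have [h hr eh] := unit_conj eu.
have [s s1 Xs] := sign_F3 X00.
have C1 := cube_theta s1 Xs.
have C2 : dv theta (cj X0 ^+ 3 - s%:~R) by apply: (cube_theta s1); rewrite zres_conj.
have [f ef] := unt_cj eu.
have D3 : dv theta (h - 1).
  have -> : h - 1 = s%:~R * f * ((V1 - cj V1) - e * (X0 ^+ 3 - s%:~R) + cj e * (cj X0 ^+ 3 - s%:~R)).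
    have -> : cj V1 = cj e * cj X0 ^+ 3 by rewrite V1E rmorphM rmorphXn.
    rewrite V1E; transitivity (s%:~R ^+ 2 * (e * f - cj e * f)); last by ring.
    have -> : s%:~R ^+ 2 = 1 :> zo by case: s1 => ->; rewrite ?rmorphN rmorph1; ring.
    by rewrite ef {1}eh -mulrA ef mulr1 mul1r.
  apply: dv_mull; apply: dv_add (dv_mull _ C2); exact: dv_sub Vd (dv_mull _ C1).
have [r [v [eE vu]]] := root_shift eh (roots1_theta hr D3).
pose X := v * X0.
have V1E' : V1 = r2o r * X ^+ 3 by rewrite V1E [in LHS]eE /X; ring.
have X1 : zres X != 0 by rewrite /X rmorphM /= mulf_neq0 ?X00 ?unt_zres.
have ru : unt r by apply: unt_r2o; apply: (unt_mulW (b := v ^+ 3)); rewrite -eE.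
have [r' rr] := ru.
have rn0 : r <> 0 by apply: res_neq0; apply: unt_res.
have nX0 : nrm X <> 0 by apply: res_neq0; rewrite nrm_res expf_neq0.
have E3 : (x + y + w) * (r ^+ 2 * nrm X ^+ 3) = x ^+ 3.
  by rewrite -[RHS]mul1r -nE V1E' nrmM nrm_r2o nrmXn.
have [z0 z0E] : dv (nrm X) x.
  apply: (dv_cube zf_mul0 zf_bezout); exists ((x + y + w) * r ^+ 2).
  by rewrite -E3; ring.
pose z := r' * z0.
have xE' : x = r * nrm X * z by rewrite /z z0E; transitivity (r * r' * (nrm X * z0)); [rewrite rr mul1r|ring].
have UE : x + y + w = r * z ^+ 3.
  have q0 : r ^+ 2 * nrm X ^+ 3 <> 0.
    by case/zf_mul0; [exact: (exp_neq0 zf_mul0 rn0)|exact: (exp_neq0 zf_mul0 nX0)].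
  apply: (zf_mulI q0); rewrite mulrC E3 xE'; ring.
exists r, X, z; split; [exact: ru|exact: X1|exact: xE'| |].
- have ro0 : r2o r <> 0 by move=> /r2o_inj.
  apply: (zo_mulI ro0).
  have cV1 : cj V1 = r2o r * cj X ^+ 3 by rewrite V1E' rmorphM rmorphXn /= conj_r2o.
  transitivity (r2o (x + y + w) + theta * (V1 - cj V1)).
    have rz : r2o (r * z ^+ 3) = r2o r * r2o z ^+ 3 by rewrite rmorphM (rmorphXn _ 3).
    by rewrite UE cV1 V1E' rz; ring.
  have -> : theta * (V1 - cj V1) = V + cj V by rewrite cVE {1}VE; ring.
  by rewrite fV_add -rmorphD -rmorphM; congr r2o; rewrite {1 2}xE'; ring.
- move=> g gr gi gz; apply: unt_r2o.
  have gX : dv (r2o g) X.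
    case: (X) gr gi => a b /= [a' ->] [b' ->]; exists (Zo a' b'); by zoring.
  have gV : dv (r2o g) V by rewrite VE V1E' exprS; do 2 apply: dv_mull; apply: dv_mulr.
  apply: (common_unit yw gV).
  + by case: gV => k kE; exists (cj k); rewrite -/V kE rmorphM /= conj_r2o.
  + by rewrite xE'; case: gz => k ->; exists (r2o (r * nrm X * k)); rewrite -rmorphM; congr r2o; ring.
  + exact: dv_zres gX X1.
Qed.

(** * Valuations at 3 and the intermediate curve *)

Definition kap : zf := Zf 3 (-4) (-3).
Definition del : zf := - (tau + 2).
(** X - cj X is im X times 2 zeta - tau. The unit [del] comes from (2 zeta - tau)^2 = tau^2 - 4 =
    varpi del, and the unit [kap] from theta (2 zeta - tau) = varpi^2 kap. *)
Lemma theta_diff X : theta * (X ^+ 3 - cj X ^+ 3) =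
  r2o (varpi ^+ 2 * kap * (im X * (varpi * del * im X ^+ 2 + 3 * nrm X))).
Proof.
have XY : X - cj X = r2o (im X) * (2 * zeta - r2o tau) by case: X => a b; zoring.
have e1 : (2 * zeta - r2o tau) ^+ 2 = r2o (varpi * del) by vm_compute.
have e2 : theta * (2 * zeta - r2o tau) = r2o (varpi ^+ 2 * kap) by vm_compute.
transitivity (theta * ((X - cj X) * ((X - cj X) ^+ 2 + 3 * (X * cj X)))); first by ring.
rewrite mul_conj XY exprMn e1 [LHS](_ : _ = theta * (2 * zeta - r2o tau) *
  (r2o (im X) * (r2o (im X) ^+ 2 * r2o (varpi * del) + 3 * r2o (nrm X)))); last by ring.
rewrite e2; move: (varpi ^+ 2 * kap) (varpi * del) => a b.
by zoring.
Qed.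

Lemma res_kap : res kap = 1. Proof. by apply: val_inj. Qed.
Lemma res_del : res del = -1. Proof. by apply: val_inj. Qed.
Lemma kap_del : 1 + kap * del = varpi ^+ 2 * Zf (-28) 64 42. Proof. by vm_compute. Qed.

(** A comparison of [varpi]-adic orders. The congruence 1 + kap del = 0 modulo varpi^2 rules out
    [im X] prime to [varpi]; after that the equation, divided repeatedly by [varpi], yields one more
    factor of [z] at a time. The last one comes from t^3 = t in F_3, and in total varpi^4 divides
    [z]. *)
Lemma onE_factor_val X z : zres X != 0 -> res z = 0 ->
  r2o z ^+ 3 + theta * (X ^+ 3 - cj X ^+ 3) = r2o (3 * nrm X * z) ->
  res (im X) = 0 /\ exists z1, z = 3 * z1 /\ res z1 = 0.
Proof.
move=> X0 z0; rewrite theta_diff.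
have s1 : res (nrm X) = 1.
  by rewrite nrm_res; case: (F3P (zres X)) X0 => -> //; rewrite ?sqrrN ?expr1n.
move: (im X) (nrm X) s1 => q s s1 E.
have {}E : z ^+ 3 + varpi ^+ 2 * kap * (q * (varpi * del * q ^+ 2 + 3 * s)) = 3 * s * z.
  by apply: r2o_inj; rewrite -E rmorphD (rmorphXn _ 3).
have vn := varpi_neq0.
have [z' zE] := (dv_piP z).2 z0; rewrite zE {1 2}three_pi in E.
have {}E : z' ^+ 3 - varpi * (mu * s * z') = - (kap * q * (del * q ^+ 2 + varpi ^+ 2 * mu * s)).
  apply: (zf_mulI (exp_neq0 zf_mul0 (n := 3) vn)); apply/eqP; rewrite -subr_eq0; apply/eqP.
  move/eqP: E; rewrite -subr_eq0 => /eqP E; rewrite -[RHS]E; ring.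
have [q0|q0] := eqVneq (res q) 0; last first.
  have z'q : res z' = res q.
    have := congr1 res E; rewrite rmorphB rmorphN (rmorphM _ varpi) (rmorphXn _ 3) /= res_pi mul0r subr0 F3_cube.
    move=> ->; rewrite rmorphM (rmorphM _ kap) rmorphD /= res_kap mul1r.
    rewrite rmorphM (rmorphXn _ 2) /= res_del.
    have -> : res (varpi ^+ 2 * mu * s) = 0.
      have -> : varpi ^+ 2 * mu * s = varpi * (varpi * mu * s) by ring.
      by rewrite rmorphM /= res_pi mul0r.
    by rewrite addr0 -[RHS]F3_cube; ring.
  have [g g1 qg] := sign_F3 q0.
  have [c1 c1E] : dv (varpi ^+ 2) (z' ^+ 3 - q ^+ 3).
    apply: (dv_trans (b := 3)); first by exists (varpi * mu); rewrite three_pi; ring.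
    have -> : z' ^+ 3 - q ^+ 3 = (z' ^+ 3 - g%:~R) - (q ^+ 3 - g%:~R) by ring.
    by apply: dv_sub; apply: (cube_three g1); rewrite ?z'q.
  have H : mu * s * z' = varpi * (c1 + Zf (-28) 64 42 * q ^+ 3 + kap * q * mu * s).
    apply: (zf_mulI vn).
    transitivity (z' ^+ 3 + kap * q * (del * q ^+ 2 + varpi ^+ 2 * mu * s)).
      by move/eqP: E; rewrite subr_eq => /eqP ->; ring.
    transitivity ((z' ^+ 3 - q ^+ 3) + (1 + kap * del) * q ^+ 3 + varpi ^+ 2 * (kap * q * mu * s)); first by ring.
    by rewrite c1E kap_del; ring.
  move/(congr1 res): H; rewrite !(rmorphM _ (mu * s)) (rmorphM _ mu) (rmorphM _ varpi) /= res_mu s1 res_pi mul0r !mul1r z'q.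
  by move/eqP; rewrite (negbTE q0).
split=> //.
have [q' qE] := (dv_piP q).2 q0; rewrite qE in E.
have z'0 : res z' = 0.
  have := congr1 res E; rewrite rmorphB rmorphN (rmorphM _ varpi) (rmorphXn _ 3) /= res_pi mul0r subr0 F3_cube.
  have -> : kap * (varpi * q') * (del * (varpi * q') ^+ 2 + varpi ^+ 2 * mu * s) =
    varpi * (kap * q' * (del * (varpi * q') ^+ 2 + varpi ^+ 2 * mu * s)) by ring.
  by move=> ->; rewrite rmorphM /= res_pi mul0r oppr0.
have [z2 z2E] := (dv_piP z').2 z'0; rewrite z2E in E.
have {}E : varpi * z2 ^+ 3 - mu * s * z2 = - (varpi * (kap * q' * (del * q' ^+ 2 + mu * s))).
  apply: (zf_mulI (exp_neq0 zf_mul0 (n := 2) vn)); apply/eqP; rewrite -subr_eq0; apply/eqP.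
  move/eqP: E; rewrite -subr_eq0 => /eqP E; rewrite -[RHS]E; ring.
have z20 : res z2 = 0.
  have := congr1 res E; rewrite rmorphB rmorphN !(rmorphM _ varpi) (rmorphM _ (mu * s)) (rmorphM _ mu) /=.
  by rewrite res_pi res_mu s1 !mul0r oppr0 !mul1r sub0r => /eqP; rewrite oppr_eq0 => /eqP.
have [z3 z3E] := (dv_piP z2).2 z20; rewrite z3E in E.
have {}E : varpi * (varpi ^+ 2 * z3 ^+ 3) - mu * s * z3 = - (kap * (q' * (del * q' ^+ 2 + mu * s))).
  apply: (zf_mulI vn); apply/eqP; rewrite -subr_eq0; apply/eqP.
  move/eqP: E; rewrite -subr_eq0 => /eqP E; rewrite -[RHS]E; ring.
have z30 : res z3 = 0.
  have D : res (del * q' ^+ 2 + mu * s) = - res q' ^+ 2 + 1.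
    by rewrite rmorphD 2!rmorphM (rmorphXn _ 2) /= res_del res_mu s1 mulN1r mulr1.
  have := congr1 res E; rewrite rmorphB rmorphN (rmorphM _ varpi) (rmorphM _ (mu * s)) (rmorphM _ mu) (rmorphM _ kap) (rmorphM _ q') /=.
  rewrite D res_pi res_mu s1 res_kap mul0r !mul1r sub0r => /eqP; rewrite eqr_opp => /eqP ->.
  by rewrite mulrDr mulr1 mulrN -exprS F3_cube addNr.
have [k _ kE] := varpi3_inv.
exists (k * z3); split; last by rewrite rmorphM /= z30 mulr0.
by rewrite zE z2E z3E; transitivity (varpi ^+ 3 * z3); [ring|rewrite kE; ring].
Qed.

Lemma zo_split X : X = r2o (re X) + zeta * r2o (im X).
Proof. by case: X => a b; zoring. Qed.
Lemma theta_rot X :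
  [/\ theta * (X - cj X) = r2o (Zf 4 (-1) (-2) * im X),
      theta * (om * X - om ^+ 2 * cj X) = r2o (- 3 * re X + Zf (-2) (-1) 1 * im X) &
      theta * (om ^+ 2 * X - om * cj X) = r2o (3 * re X + Zf (-2) 2 1 * im X)].
Proof.
have e0 : theta * (zeta - cj zeta) = r2o (Zf 4 (-1) (-2)) by vm_compute.
have e1 : theta * (om * zeta - om ^+ 2 * cj zeta) = r2o (Zf (-2) (-1) 1) by vm_compute.
have e2 : theta * (om ^+ 2 * zeta - om * cj zeta) = r2o (Zf (-2) 2 1) by vm_compute.
have f1 : theta * (om - om ^+ 2) = r2o (- 3) by vm_compute.
have f2 : theta * (om ^+ 2 - om) = r2o 3 by vm_compute.
have cX : cj X = r2o (re X) + cj zeta * r2o (im X).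
  by rewrite {1}(zo_split X) (rmorphD _ (r2o (re X))) (rmorphM _ zeta) /= !conj_r2o.
have gen (s t : zo) (k m P Q : zf) (c z : zo) : theta * (s - t) = r2o k ->
    theta * (s * z - t * c) = r2o m ->
    theta * (s * (r2o P + z * r2o Q) - t * (r2o P + c * r2o Q)) = r2o (k * P + m * Q).
  move=> ek em; rewrite (rmorphD _ (k * P)) (rmorphM _ k) (rmorphM _ m) /= -ek -em; ring.
split.
- have := gen 1 1 0 (Zf 4 (-1) (-2)) (re X) (im X) (cj zeta) zeta.
  rewrite !mul1r mul0r add0r subrr mulr0 -zo_split -cX.
  by move=> ->.
- by rewrite cX {1}(zo_split X) (gen _ _ _ _ _ _ _ _ f1 e1).
- by rewrite cX {1}(zo_split X) (gen _ _ _ _ _ _ _ _ f2 e2).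
Qed.

(** The splitting of A^3 + B^3 + C^3 - 3ABC at A = theta X, B = - theta Y, C = - Z. On the curve Z^3
    + theta (X^3 - Y^3) = 3XYZ the product is 2 Z^3. *)
Lemma rot_prod (X Y Z : zo) : (theta * (X - Y) - Z) * (theta * (om * X - om ^+ 2 * Y) - Z)
  * (theta * (om ^+ 2 * X - om * Y) - Z) = - 3 * (theta * (X ^+ 3 - Y ^+ 3)) + 9 * (X * Y) * Z - Z ^+ 3.
Proof.
have e : (om * X - om ^+ 2 * Y) * (om ^+ 2 * X - om * Y) = X ^+ 2 + X * Y + Y ^+ 2.
  have o2 : om ^+ 2 + om = -1 by [].
  have o3 : om ^+ 3 = 1 by [].
  transitivity (om ^+ 3 * (X ^+ 2 + Y ^+ 2) - X * Y * (om ^+ 3 * om + om ^+ 2)); first by ring.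
  by rewrite o3 !mul1r [om + _]addrC o2; ring.
have e' : (om * X - om ^+ 2 * Y) + (om ^+ 2 * X - om * Y) = Y - X.
  have o2 : om ^+ 2 + om = -1 by [].
  by transitivity ((om ^+ 2 + om) * (X - Y)); [ring|rewrite o2; ring].
move: (om * X - _) (om ^+ 2 * X - _) e e' => A B e e'.
transitivity ((theta * (X - Y) - Z) * (theta ^+ 2 * (A * B) - theta * Z * (A + B) + Z ^+ 2)); first by ring.
rewrite e e' theta2.
transitivity (- 3 * (theta * (X ^+ 3 - Y ^+ 3)) + 3 * Z * (X ^+ 2 + X * Y + Y ^+ 2) +
  theta ^+ 2 * Z * (X - Y) ^+ 2 - Z ^+ 3); first by ring.
by rewrite theta2; ring.
Qed.

(** A solution of [onE] gives such a point with a = -2x^3, b = y^3, c = w^3, z = -xyw; the second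
    half of the descent inverts this map. *)
Definition triple (a b c z : zf) :=
  [/\ a + b + c = - (3 * z), a * b * c = 2 * z ^+ 3 &
   [/\ forall h, dv h a -> dv h b -> dv h z -> unt h,
       forall h, dv h a -> dv h c -> dv h z -> unt h &
       forall h, dv h b -> dv h c -> dv h z -> unt h]].
Lemma triple_swap a b c z : triple a b c z -> triple b a c z.
Proof.
case=> [S P [h1 h2 h3]]; split; [by rewrite -S; ring|by rewrite -P; ring|split=> // h ? ?; exact: h1].
Qed.
Lemma triple_swap' a b c z : triple a b c z -> triple a c b z.
Proof.
case=> [S P [h1 h2 h3]]; split; [by rewrite -S; ring|by rewrite -P; ring|split=> // h ? ?; exact: h3].
Qed.

Lemma F3_trichotomy (x y : 'F_3) : y != 0 -> [\/ [/\ x = 0, x - y != 0 & x + y != 0],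
   [/\ x - y = 0, x != 0 & x + y != 0] | [/\ x + y = 0, x != 0 & x - y != 0]].
Proof.
move=> y0; have [->|x0] := eqVneq x 0.
  by apply: Or31; split; [reflexivity|rewrite sub0r oppr_eq0|rewrite add0r].
have [xy|xy] := eqVneq x y.
  apply: Or32; split; [by rewrite xy subrr|exact: isT|].
  by rewrite xy; case: (F3P y) y0 => ->.
apply: Or33; split; [|exact: isT|by rewrite subr_eq0].
case: (F3P x) x0 xy => ->; case: (F3P y) y0 => -> // _ _ _; [exact: subrr|exact: addNr].
Qed.

(** The entries are the linear factors of [rot_prod] divided by 3. Their residues are t, t - p and t
    + p with p nonzero in F_3, so exactly one of them vanishes. *)
Lemma onE_triple X z1 : zres X != 0 -> res (im X) = 0 ->
  r2o (3 * z1) ^+ 3 + theta * (X ^+ 3 - cj X ^+ 3) = r2o (3 * nrm X * (3 * z1)) ->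
  (forall h, dv h (re X) -> dv h (im X) -> dv h (3 * z1) -> unt h) -> res z1 = 0 ->
  exists a b c, [/\ triple a b c z1, res a = 0, res b != 0 & res c != 0].
Proof.
move=> X0 q0 E H z10.
have p0 : res (re X) != 0 by move: X0; rewrite /zres q0 addr0.
have [q' qE] := (dv_piP _).2 q0.
have [r0 r1 r2] := theta_rot X.
set p := re X in p0 r1 r2 H.
pose a0 := Zf 2 0 (-1) * q' - z1.
pose a1 := - p + Zf (-1) (-1) 1 * q' - z1.
pose a2 := p + Zf (-1) 1 0 * q' - z1.
have k0 : Zf 4 (-1) (-2) * varpi = 3 * Zf 2 0 (-1) by vm_compute.
have k1 : Zf (-2) (-1) 1 * varpi = 3 * Zf (-1) (-1) 1 by vm_compute.
have k2 : Zf (-2) 2 1 * varpi = 3 * Zf (-1) 1 0 by vm_compute.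
have A0 : theta * (X - cj X) - r2o (3 * z1) = r2o (3 * a0).
  by rewrite r0 -rmorphB qE mulrA k0 /a0; congr r2o; ring.
have A1 : theta * (om * X - om ^+ 2 * cj X) - r2o (3 * z1) = r2o (3 * a1).
  by rewrite r1 -rmorphB qE mulrA k1 /a1; congr r2o; ring.
have A2 : theta * (om ^+ 2 * X - om * cj X) - r2o (3 * z1) = r2o (3 * a2).
  by rewrite r2 -rmorphB qE mulrA k2 /a2; congr r2o; ring.
have P : a0 * a1 * a2 = 2 * z1 ^+ 3.
  have := rot_prod X (cj X) (r2o (3 * z1)); rewrite A0 A1 A2 mul_conj.
  have -> : theta * (X ^+ 3 - cj X ^+ 3) = r2o (3 * nrm X * (3 * z1)) - r2o (3 * z1) ^+ 3 by rewrite -E; ring.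
  move=> E2; apply: (zf_mulI (a := 27)); first by move/(congr1 zf0).
  apply: r2o_inj; transitivity (r2o (3 * a0) * r2o (3 * a1) * r2o (3 * a2)); first by zoring.
  by rewrite E2; move: (nrm X) => s; zoring.
have S : a0 + a1 + a2 = - (3 * z1).
  have k3 : Zf 2 0 (-1) + Zf (-1) (-1) 1 + Zf (-1) 1 0 = 0 by vm_compute.
  transitivity ((Zf 2 0 (-1) + Zf (-1) (-1) 1 + Zf (-1) 1 0) * q' - 3 * z1); first by rewrite /a0 /a1 /a2; ring.
  by rewrite k3; ring.
have two h : dv h a0 -> dv h a1 -> dv h a2 -> dv h z1 -> unt h.
  move=> h0 h1 h2 hz; have ku : (Zf 2 0 (-1)) * (Zf 1 (-1) (-1)) = 1 by vm_compute.
  have hq : dv h q'.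
    have -> : q' = (a0 + z1) * Zf 1 (-1) (-1).
      by rewrite /a0; transitivity (q' * (Zf 2 0 (-1) * Zf 1 (-1) (-1))); [rewrite ku mulr1|ring].
    by apply: dv_mulr; apply: dv_add.
  apply: H; [|by rewrite qE; apply: dv_mull|exact: dv_mull].
  have -> : p = a2 + z1 - Zf (-1) 1 0 * q' by rewrite /a2; ring.
  by apply: dv_sub; [apply: dv_add|apply: dv_mull].
have T : triple a0 a1 a2 z1.
  have s0 : a0 = - (3 * z1) - a1 - a2 by rewrite -S; ring.
  have s1 : a1 = - (3 * z1) - a0 - a2 by rewrite -S; ring.
  have s2 : a2 = - (3 * z1) - a0 - a1 by rewrite -S; ring.
  have sd h u v : dv h u -> dv h v -> dv h z1 -> dv h (- (3 * z1) - u - v).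
    by move=> hu hv hz; apply: dv_sub hv; apply: dv_sub hu; apply/dv_opp/dv_mull.
  split; [exact: S|exact: P|split] => h h1 h2 hz.
  - by apply: (two h h1 h2 _ hz); rewrite s2; apply: sd.
  - by apply: (two h h1 _ h2 hz); rewrite s1; apply: sd.
  - by apply: (two h _ h1 h2 hz); rewrite s0; apply: sd.
have R0 : res a0 = res q'.
  by rewrite /a0 rmorphB rmorphM /= z10 subr0 (_ : res _ = 1) ?mul1r //; apply: val_inj.
have R1 : res a1 = res q' - res p.
  have u : res (Zf (-1) (-1) 1) = 1 by apply: val_inj.
  by rewrite /a1 rmorphB rmorphD rmorphN (rmorphM _ _ q') /= z10 subr0 u mul1r addrC.
have R2 : res a2 = res q' + res p.
  have u : res (Zf (-1) 1 0) = 1 by apply: val_inj.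
  by rewrite /a2 rmorphB rmorphD (rmorphM _ _ q') /= z10 subr0 u mul1r addrC.
have := @F3_trichotomy (res q') (res p) p0; rewrite -R1 -R2 -R0.
clearbody a0 a1 a2; case=> -[x1 x2 x3].
- exists a0, a1, a2; split; [exact: T|exact: x1|exact: x2|exact: x3].
- exists a1, a0, a2; split; [exact: triple_swap|exact: x1|exact: x2|exact: x3].
- exists a2, a0, a1; split; [exact/triple_swap/triple_swap'|exact: x1|exact: x2|exact: x3].
Qed.

(** The square of a common divisor divides 2 z^3 and is prime to [z], so it divides 2. *)
Lemma triple_cop a b c z : triple a b c z -> cop a b.
Proof.
case=> [S P [h1 _ _]]; apply: (cop_of_common zf_bezout) => d da db; apply: sqr_dv2.
have dz : cop d z.
  by apply: (cop_of_common zf_bezout) => e ed ez; apply: h1 ez; apply: dv_trans ed _.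
have H : dv (d ^+ 2) (z ^+ 3 * 2).
  by rewrite mulrC -P expr2; apply: dv_mulr; apply: dv_mul.
apply: gauss H; apply: cop_exp; exact/cop_sym/cop_exp/cop_sym.
Qed.

(** Cubes prime to [varpi] are signs modulo 3, so e / f is a sign modulo 3 and [kummer] applies. *)
Lemma unit_ratio e f x y : unt e -> unt f -> res x != 0 -> res y != 0 ->
  dv 3 (e * x ^+ 3 + f * y ^+ 3) -> exists2 s, unt s & e = f * s ^+ 3.
Proof.
move=> eu [f' ff] x0 y0 H.
have [s s1 xs] := sign_F3 x0; have [t t1 yt] := sign_F3 y0.
have sE : s%:~R ^+ 2 = 1 :> zf by case: s1 => ->; rewrite ?rmorphN rmorph1; ring.
have D : dv 3 (e * f' - Zf (- (s * t)) 0 0).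
  have -> : Zf (- (s * t)) 0 0 = - (s%:~R * t%:~R) :> zf by rewrite -rmorphM -rmorphN /= zf_intE.
  have -> : e * f' - - (s%:~R * t%:~R) = f' * s%:~R * ((e * x ^+ 3 + f * y ^+ 3)
     - e * (x ^+ 3 - s%:~R) - f * (y ^+ 3 - t%:~R)) :> zf.
    transitivity (e * f' * s%:~R ^+ 2 + f * f' * (s%:~R * t%:~R) : zf); first by rewrite sE ff; ring.
    ring.
  apply/dv_mull/dv_sub; [apply: (dv_sub H)|]; apply: dv_mull; exact: cube_three.
have f'u : unt f' by exists f; rewrite mulrC.
have [|v vu vE] := kummer (unt_mul eu f'u); first by exists (- (s * t)).
exists v => //; rewrite -vE; transitivity (e * (f * f')); [by rewrite ff mulr1|ring].
Qed.

Lemma triple_even a b c z : triple a b c z -> z <> 0 -> dv 2 a ->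
  exists e1 e2 e3 x y w s,
  [/\ [/\ a = 2 * (e1 * x ^+ 3), b = e2 * y ^+ 3, c = e3 * w ^+ 3 & z = s * (x * y * w)],
     [/\ unt e1, unt e2, unt e3 & unt s] & s ^+ 3 = e1 * e2 * e3].
Proof.
move=> T z0 [a' aE]; have cab := triple_cop T; have cac := triple_cop (triple_swap' T).
have cbc := triple_cop (triple_swap' (triple_swap T)).
have two0 : (2 : zf) <> 0 by move/(congr1 zf0).
have E : a' * b * c = z ^+ 3.
  by case: T => [_ P _]; apply: (zf_mulI two0); rewrite -P aE; ring.
have z30 := exp_neq0 zf_mul0 (n := 3) z0.
have a0 : a' <> 0 by move=> a0; apply: z30; rewrite -E a0; ring.
have b0 : b <> 0 by move=> b0; apply: z30; rewrite -E b0; ring.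
have c0 : c <> 0 by move=> c0; apply: z30; rewrite -E c0; ring.
have a'b : cop a' b by apply/cop_sym/(cop_dv _ (cop_sym cab)); exists 2; rewrite mulrC.
have a'c : cop a' c by apply/cop_sym/(cop_dv _ (cop_sym cac)); exists 2; rewrite mulrC.
have CC := coprime_mul_cube zf_mul0 zf_bezout.
have [e1 [x [e1u xE]]] := CC a' (b * c) z a0 (cop_mul a'b a'c) ltac:(by rewrite mulrA).
have [e2 [y [e2u yE]]] := CC b (a' * c) z b0 (cop_mul (cop_sym a'b) cbc) ltac:(by rewrite -E; ring).
have [e3 [w [e3u wE]]] := CC c (a' * b) z c0 (cop_mul (cop_sym a'c) (cop_sym cbc)) ltac:(by rewrite -E; ring).
have P : z ^+ 3 = e1 * e2 * e3 * (x * y * w) ^+ 3 by rewrite -E xE yE wE; ring.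
have [s sE] : dv (x * y * w) z.
  by apply: (dv_cube zf_mul0 zf_bezout); exists (e1 * e2 * e3); rewrite P mulrC.
have s3 : s ^+ 3 = e1 * e2 * e3.
  have q0 : (x * y * w) ^+ 3 <> 0 by move=> q0; apply: z30; rewrite P q0 mulr0.
  by apply: (zf_mulI q0); rewrite mulrC [RHS]mulrC -P sE; ring.
exists e1, e2, e3, x, y, w, s; split; [|split=> //|exact: s3].
  by split; [rewrite aE xE|exact: yE|exact: wE|rewrite sE mulrC].
apply: (unt_mulW (b := s ^+ 2)); rewrite -exprS s3.
by apply: unt_mul => //; apply: unt_mul.
Qed.

(** One ratio of units being a cube, so is the other, because [e1 * e2 * e3] is a cube; both are
    absorbed into the coordinates. *)
Lemma triple_norm e1 e2 e3 (x y w s z : zf) : unt e3 -> unt s ->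
  2 * (e1 * x ^+ 3) + e2 * y ^+ 3 + e3 * w ^+ 3 = - (3 * z) -> z = s * (x * y * w) ->
  s ^+ 3 = e1 * e2 * e3 ->
  (exists2 g, unt g & e1 = e3 * g ^+ 3) \/ (exists2 g, unt g & e2 = e3 * g ^+ 3) ->
  exists g h, [/\ unt g, unt h, onE (h * y) w (g * x) & z = - e3 * ((g * x) * (h * y) * w)].
Proof.
move=> [f ff] su S zE s3.
have F3 : f ^+ 3 * e3 ^+ 3 = 1 by rewrite -exprMn mulrC ff expr1n.
have fu : unt f by exists e3; rewrite mulrC.
have main g h : unt g -> unt h -> e1 = e3 * g ^+ 3 -> e2 = e3 * h ^+ 3 -> s = e3 * (g * h) ->
    exists g h, [/\ unt g, unt h, onE (h * y) w (g * x) & z = - e3 * ((g * x) * (h * y) * w)].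
  move=> gu hu e1E e2E sE; exists (- g), h; split => //.
  - by rewrite -mulN1r; apply: unt_mul gu; exact: untN1.
  - rewrite /onE; have S' : 2 * (g * x) ^+ 3 + (h * y) ^+ 3 + w ^+ 3 = - (3 * (g * x * (h * y) * w)).
      transitivity (f * (e3 * (2 * (g * x) ^+ 3 + (h * y) ^+ 3 + w ^+ 3))).
        by rewrite mulrA [f * _]mulrC ff mul1r.
      transitivity (f * (- (3 * z))); first by rewrite -S e1E e2E; ring.
      rewrite zE sE; transitivity (- (3 * (e3 * f * (g * x * (h * y) * w)))); first by ring.
      by rewrite ff mul1r.
    transitivity (2 * (g * x) ^+ 3 + (h * y) ^+ 3 + w ^+ 3); [ring|rewrite S'; ring].
  - by rewrite zE sE; ring.
case=> [[g gu gE]|[g gu gE]].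
- have [g' gg] := gu; have G3 : g ^+ 3 * g' ^+ 3 = 1 by rewrite -exprMn gg expr1n.
  apply: (main g (s * (f * g')) gu _ gE); first by apply: unt_mul su _; apply: unt_mul fu _; exists g; rewrite mulrC.
    transitivity (e3 * f ^+ 3 * g' ^+ 3 * s ^+ 3); last by ring.
    rewrite s3 gE; transitivity ((f ^+ 3 * e3 ^+ 3) * (g ^+ 3 * g' ^+ 3) * e2); last by ring.
    by rewrite F3 G3 !mul1r.
  transitivity ((e3 * f) * (g * g') * s); [by rewrite ff gg !mul1r|ring].
- have [g' gg] := gu; have G3 : g ^+ 3 * g' ^+ 3 = 1 by rewrite -exprMn gg expr1n.
  apply: (main (s * (f * g')) g _ gu _ gE); first by apply: unt_mul su _; apply: unt_mul fu _; exists g; rewrite mulrC.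
    transitivity (e3 * f ^+ 3 * g' ^+ 3 * s ^+ 3); last by ring.
    rewrite s3 gE; transitivity ((f ^+ 3 * e3 ^+ 3) * (g ^+ 3 * g' ^+ 3) * e1); last by ring.
    by rewrite F3 G3 !mul1r.
  transitivity ((e3 * f) * (g * g') * s); [by rewrite ff gg !mul1r|ring].
Qed.

Lemma res_mulE (e x : zf) : res (e * x ^+ 3) = res e * res x.
Proof. by rewrite rmorphM (rmorphXn _ 3) /= F3_cube. Qed.
Lemma res_mulV (e x : zf) : res (e * x ^+ 3) != 0 -> res x != 0.
Proof. by rewrite res_mulE mulf_eq0 negb_or => /andP[]. Qed.

Lemma triple_three a b c z : triple a b c z -> res a = 0 -> res b != 0 -> res c != 0 ->
  res z = 0 /\ dv 3 (b + c).
Proof.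
move=> [S P _] a0 b0 c0.
have z0 : res z = 0.
  have := congr1 res P; rewrite (rmorphM _ _ c) (rmorphM _ a) (rmorphM _ 2) rmorph_nat (rmorphXn _ 3) /=.
  by rewrite a0 !mul0r F3_cube => /esym/F3_two_eq0.
split=> //.
have [z' zE] := (dv_piP z).2 z0.
have D : dv 3 a.
  apply: dv_trans varpi3_three _.
  have cc : cop (varpi ^+ 3) (b * c).
    by apply/cop_sym/cop_exp/cop_pi; rewrite rmorphM mulf_neq0.
  by apply: (gauss cc); rewrite mulrC mulrA P zE; exists (2 * z' ^+ 3); ring.
have -> : b + c = - (3 * z) - a by rewrite -S; ring.
by apply: dv_sub D; apply/dv_opp/dv_mulr/dv_refl.
Qed.

(** The prime 2 divides one of the entries. If it is the entry divisible by [varpi], the new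
    solution has [varpi] dividing x; otherwise [varpi] would divide y, which [onE_side] excludes. *)
Lemma triple_descent a b c z : triple a b c z -> z <> 0 ->
  res a = 0 -> res b != 0 -> res c != 0 ->
  exists Y W X, [/\ onE Y W X, cop Y W, res X = 0, res Y != 0 & X <> 0 /\ dv X z].
Proof.
move=> T z0 a0 b0 c0.
have side b' c' : triple a b' c' z -> res b' != 0 -> res c' != 0 -> dv 2 b' -> False.
  move=> T' b'0 c'0 b2; have [_ D] := triple_three T' a0 b'0 c'0.
  have cop_ac := triple_cop (triple_swap' T').
  have [e1 [e2 [e3 [x [y [w [s [[bE aE cE zE] [u1 u2 u3 us] s3]]]]]]]] := triple_even (triple_swap T') z0 b2.
  have x0 : res x != 0.
    by move: b'0; rewrite bE rmorphM /= mulf_eq0 negb_or => /andP[_ /res_mulV].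
  have w0 : res w != 0 by apply: (@res_mulV e3); rewrite -cE.
  have y0 : res y = 0.
    by move: a0; rewrite aE res_mulE => /eqP; rewrite mulf_eq0 (negbTE (unt_res u2)) => /eqP.
  have R : exists2 g, unt g & e1 = e3 * g ^+ 3.
    apply: (@unit_ratio e1 e3 (- x) w u1 u3 _ w0); first by rewrite rmorphN oppr_eq0.
    have -> : e1 * (- x) ^+ 3 + e3 * w ^+ 3 = (b' + c') - 3 * (e1 * x ^+ 3) by rewrite bE cE; ring.
    by apply: dv_sub D _; apply/dv_mulr/dv_refl.
  have S : 2 * (e1 * x ^+ 3) + e2 * y ^+ 3 + e3 * w ^+ 3 = - (3 * z).
    by case: T' => [<- _ _]; rewrite aE bE cE; ring.
  have [g [h [gu hu E _]]] := triple_norm u3 us S zE s3 (or_introl R).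
  apply: (onE_side E).
  - apply: cop_sym; apply: (cop_dv (b := a)); last first.
      apply: cop_sym; apply: (cop_dv (b := c')) => //.
      by rewrite cE exprS; apply/dv_mull/dv_mulr/dv_refl.
    have [h' hh] := hu; exists (h' * (e2 * y ^+ 2)); rewrite aE.
    by transitivity (h * h' * (e2 * y ^+ 3)); [rewrite hh mul1r|ring].
  - by rewrite rmorphM /= y0 mulr0.
  - exact: w0.
  - by rewrite rmorphM mulf_neq0 // unt_res.
have /prime2[/prime2[a2|b2]|c2] : dv 2 (a * b * c) by case: T => [_ -> _]; apply/dv_mulr/dv_refl.
- have [_ D] := triple_three T a0 b0 c0.
  have [e1 [e2 [e3 [x [y [w [s [[aE bE cE zE] [u1 u2 u3 us] s3]]]]]]]] := triple_even T z0 a2.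
  have y0 : res y != 0 by apply: (@res_mulV e2); rewrite -bE.
  have w0 : res w != 0 by apply: (@res_mulV e3); rewrite -cE.
  have x0 : res x = 0.
    move: a0; rewrite aE (rmorphM _ 2) rmorph_nat /= => /F3_two_eq0/eqP.
    by rewrite res_mulE mulf_eq0 (negbTE (unt_res u1)) => /eqP.
  have R : exists2 g, unt g & e2 = e3 * g ^+ 3.
    by apply: (@unit_ratio e2 e3 y w u2 u3 y0 w0); rewrite -bE -cE.
  have S : 2 * (e1 * x ^+ 3) + e2 * y ^+ 3 + e3 * w ^+ 3 = - (3 * z).
    by case: T => [<- _ _]; rewrite aE bE cE.
  have [g [h [gu hu E zE']]] := triple_norm u3 us S zE s3 (or_intror R).
  exists (h * y), w, (g * x); split; [exact: E| | | |split].
  + have cbc := triple_cop (triple_swap' (triple_swap T)).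
    apply: cop_sym; apply: (cop_dv (b := b)); last first.
      apply: cop_sym; apply: (cop_dv (b := c)) => //.
      by rewrite cE exprS; apply/dv_mull/dv_mulr/dv_refl.
    have [h' hh] := hu; exists (h' * (e2 * y ^+ 2)); rewrite bE.
    by transitivity (h * h' * (e2 * y ^+ 3)); [rewrite hh mul1r|ring].
  + by rewrite rmorphM /= x0 mulr0.
  + by rewrite rmorphM mulf_neq0 // unt_res.
  + by move=> gx; apply: z0; rewrite zE' gx; ring.
  + by rewrite zE'; exists (- e3 * (h * y * w)); ring.
- by case: (side b c T b0 c0 b2).
- by case: (side c b (triple_swap' T) c0 b0 c2).
Qed.

Lemma onE_descent y w x : onE y w x -> cop y w -> res x = 0 -> res y != 0 -> x = 0.
Proof.
move: {2}`|NF x|%N.+1 (ltnSn `|NF x|%N) => n; elim: n y w x => // n IH y w x.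
rewrite ltnS => xn E yw x0 y0; apply/eqP; apply: contraT => /eqP xn0; exfalso.
have [r [X [z [ru X0 xE zE H]]]] := onE_factor E yw x0 y0 xn0.
have s0 : res (nrm X) != 0 by rewrite nrm_res expf_neq0.
have z0 : res z = 0.
  move/eqP: x0; rewrite xE (rmorphM _ (r * nrm X)) (rmorphM _ r) /= mulf_eq0.
  by rewrite (negbTE (mulf_neq0 (unt_res ru) s0)) => /eqP.
have [q0 [z1 [z1E z10]]] := onE_factor_val X0 z0 zE.
rewrite z1E in zE H xE.
have [a [b [c [T a0 b0 c0]]]] := onE_triple X0 q0 zE H z10.
have z1n : z1 <> 0 by move=> z1n; apply: xn0; rewrite xE z1n !mulr0.
have [Y [W [X' [E' YW X'0 Y0 [X'n [k kE]]]]]] := triple_descent T z1n a0 b0 c0.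
apply: X'n; apply: (IH Y W X') => //; apply: leq_trans xn.
(* The factor 3, of norm 27, is what makes the norm strictly smaller. *)
have xE' : x = (r * nrm X * k) * (3 * X') by rewrite xE kE; ring.
have : NF x <> 0 by move=> /NF_eq0.
rewrite xE' NFM (NFM 3) (_ : NF 3 = 27) // => nz.
move: (NF _) (NF X') nz => u v nz; rewrite !abszM.
have : `|u|%N <> 0%N by lia.
have : `|v|%N <> 0%N by lia.
by rewrite (_ : `|27%Z|%N = 27%N) //; move: `|u|%N `|v|%N => p q *; nia.
Qed.

(** Once the gcd of all three coordinates is removed, a common factor of y and w has its square
    dividing 2 x^3 and is prime to x, hence is a unit. *)
Lemma onE_res0 y w x : onE y w x -> res x = 0 -> res y != 0 -> x = 0.
Proof.
move=> E x0 y0.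
have [g [y' [w' [g0 yE wE c']]]] := gcd_cop zf_mul0 zf_bezout w (res_neq0 y0).
have [h [g' [x' [h0 gE xE c'']]]] := gcd_cop zf_mul0 zf_bezout x g0.
have yE' : y = h * (g' * y') by rewrite yE gE; ring.
have wE' : w = h * (g' * w') by rewrite wE gE; ring.
have E' : onE (g' * y') (g' * w') x'.
  apply: (zf_mulI (exp_neq0 zf_mul0 (n := 3) h0)).
  transitivity (y ^+ 3 + w ^+ 3 - 2 * x ^+ 3); first by rewrite yE' wE' xE; ring.
  by rewrite E yE' wE' xE; ring.
have gu : unt g'.
  apply: sqr_dv2; have H : dv (g' ^+ 2) (x' ^+ 3 * 2).
    have -> : x' ^+ 3 * 2 = g' ^+ 2 * (g' * y' ^+ 3 + g' * w' ^+ 3 - 3 * x' * y' * w').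
      move/eqP: E'; rewrite -subr_eq0 => /eqP E'; apply/eqP; rewrite -subr_eq0 -oppr_eq0.
      by apply/eqP; rewrite -[RHS]E'; ring.
    exact/dv_mulr/dv_refl.
  by apply: gauss H; apply: cop_exp; exact/cop_sym/cop_exp/cop_sym.
have res_h : res h != 0 by apply: (@dv_res h y) y0; exists (g' * y').
have x'0 : res x' = 0.
  by move/eqP: x0; rewrite xE rmorphM mulf_eq0 (negbTE res_h) => /eqP.
rewrite xE (onE_descent E') ?mulr0 //.
  apply: cop_mul; first by apply: cop_unt.
  apply/cop_sym/cop_mul; first exact: cop_unt.
  exact: cop_sym.
by apply: (@dv_res (g' * y') y) y0; exists h; rewrite mulrC.
Qed.

(** * From integer solutions to the descent *)

Definition cubE (a b e : zf) := a ^+ 3 - 2 * b ^+ 3 - e ^+ 3 + 3 * a * b * e.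
(* The residual intersection of the cubic with the line through (a, b, e) and (p, -1, 1). *)
Lemma third_point (a b e p k1 k2 c : zf) : cubE a b e = 0 -> cubE p (-1) 1 = 0 ->
  (a ^+ 2 + b * e) * p + (- 2 * b ^+ 2 + a * e) * (-1) + (- e ^+ 2 + a * b) = - (c * k2) ->
  a * (p ^+ 2 - 1) + b * (p - 2) - e * (1 + p) = c * k1 ->
  onE (k1 * a + k2 * p) (- (k1 * e + k2)) (k1 * b - k2).
Proof.
move=> F1 F2 F3 F4; apply/eqP; rewrite -subr_eq0; apply/eqP.
transitivity (k1 ^+ 3 * cubE a b e + k2 ^+ 3 * cubE p (-1) 1 + 3 * k1 ^+ 2 * k2 *
  ((a ^+ 2 + b * e) * p + (- 2 * b ^+ 2 + a * e) * (-1) + (- e ^+ 2 + a * b)) +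
  3 * k1 * k2 ^+ 2 * (a * (p ^+ 2 - 1) + b * (p - 2) - e * (1 + p))).
  by rewrite /cubE; ring.
by rewrite F1 F2 F3 F4; ring.
Qed.

Lemma dv3_coord (x : zf) k0 k1 k2 : zf0 x = 3 * k0 -> zf1 x = 3 * k1 -> zf2 x = 3 * k2 -> dv 3 x.
Proof. by case: x => a b c /= -> -> ->; exists (Zf k0 k1 k2); zfring. Qed.

Lemma res_eqN1 (x : zf) k : zf0 x - zf1 x + zf2 x = -1 + 3 * k -> res x = -1.
Proof.
by rewrite /res => ->; rewrite rmorphD rmorphM /= rmorph_nat F3_3 mul0r addr0 rmorphN.
Qed.

(** The element e = -2v - u tau + v tau^2 satisfies e^3 = 3 Q e + B, where Q and B are the two
    right-hand sides. *)
Lemma cubE_int (u v al be : int) : al * be = u ^+ 2 + u * v + v ^+ 2 ->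
  al ^+ 3 - 2 * be ^+ 3 = u ^+ 3 + 6 * u ^+ 2 * v + 3 * u * v ^+ 2 - v ^+ 3 ->
  cubE (Zf al 0 0) (Zf be 0 0) (Zf (- 2 * v) (- u) v) = 0.
Proof.
move=> Eq EB.
have eE : Zf (- 2 * v) (- u) v ^+ 3 = 3 * Zf (u ^+ 2 + u * v + v ^+ 2) 0 0 * Zf (- 2 * v) (- u) v +
      Zf (u ^+ 3 + 6 * u ^+ 2 * v + 3 * u * v ^+ 2 - v ^+ 3) 0 0 by zfring.
rewrite /cubE eE -Eq -EB; move: (Zf (- 2 * v) _ _) => [x y z]; zfring.
Qed.

(** Modulo [varpi] the point (al, be, e) is (1, 1, -1), the negative of (tau, -1, 1). The third
    point of the line through both therefore falls under [onE_res0], and the conclusions say that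
    coordinates of its vanishing x-entry are zero. *)
Lemma descent_input (a b c d m : int) (al := 1 + 3 * a) (be := 1 + 3 * b) (u := -1 + 3 * c) (v := 3 * d) :
  a + b - c + d = 3 * m -> al * be = u ^+ 2 + u * v + v ^+ 2 ->
  al ^+ 3 - 2 * be ^+ 3 = u ^+ 3 + 6 * u ^+ 2 * v + 3 * u * v ^+ 2 - v ^+ 3 -> 
  [/\ v * (al + be - u - 2 * v) = 0 & al ^+ 2 + be ^+ 2 + u * (al + be) + 2 * (u * v) + v ^+ 2 = 0].
Proof.
move=> Em Eq EB.
pose e := Zf (- 2 * v) (- u) v; pose A := Zf al 0 0; pose B := Zf be 0 0.
(* Under the congruences both line coefficients of [third_point] are divisible by 3; [K1] and [K2]
   are the quotients, the second with opposite sign. *)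
pose r0 := b * d - 2 * b ^+ 2 - 2 * (a * d) + 2 * (c * d) + 4 * d ^+ 2 - a * b.
pose r1 := - a ^+ 2 - b * d - a * c - 2 * (c * d) - d ^+ 2.
pose r2 := b * c + a * d + c ^+ 2 - d ^+ 2.
pose K10 := -1 - a - 2 * b + 3 * d; pose K11 := b - d + c; pose K12 := a - d + c.
pose K1 := Zf K10 K11 K12.
pose K22 := - c - b + d + 3 * r2.
pose K2 := Zf (-1 - 3 * d - a - 5 * b + 3 * r0) (- a + d - c + 3 * r1) K22.
have F1 : cubE A B e = 0 by apply: cubE_int.
have F2 : cubE tau (-1) 1 = 0 by vm_compute.
have F3 : (A ^+ 2 + B * e) * tau + (- 2 * B ^+ 2 + A * e) * (-1) + (- e ^+ 2 + A * B) = - (3 * K2).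
  rewrite /A /B /e /K2 /K22 /r0 /r1 /r2 /al /be /u /v; zfring.
have F4 : A * (tau ^+ 2 - 1) + B * (tau - 2) - e * (1 + tau) = 3 * K1.
  rewrite /A /B /e /K1 /K10 /K11 /K12 /al /be /u /v; zfring.
have E := third_point F1 F2 F3 F4.
(* As 1 + tau = 3 - varpi, the y-entry is [varpi] modulo 3, so it contains [varpi] exactly once,
   while the x-entry is divisible by 3. *)
have [Z1 D1] : dv 3 (K1 * A + K2 * tau + (1 + tau)).
  apply: (@dv3_coord _ (- m + d + a * K10 - r2) (- m - b - d + r0 + a * K11 + K22) (r1 + a * K12)).
  - transitivity (- (a + b - c + d) + 3 * (d + a * K10 - r2)); last by rewrite Em; ring.
    by rewrite /= /K22 /K10 /al; ring.
  - transitivity (- (a + b - c + d) + 3 * (- b - d + r0 + a * K11 + K22)); last by rewrite Em; ring.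
    by rewrite /= /K22 /K11 /K12 /al; ring.
  - by rewrite /= /K12 /al; ring.
have [Z2 D2] : dv 3 (K1 * B - K2).
  apply: (@dv3_coord _ (b + 2 * d - r0 + b * K10) (m + c - d - r1 + b * K11) (m + c - d - r2 + b * K12)).
  - by rewrite /= /K10 /be; ring.
  - transitivity (a + b - c + d + 3 * (c - d - r1 + b * K11)); last by rewrite Em; ring.
    by rewrite /= /K11 /K12 /be; ring.
  - transitivity (a + b - c + d + 3 * (c - d - r2 + b * K12)); last by rewrite Em; ring.
    by rewrite /= /K22 /K12 /be; ring.
have D3 : res (K1 * e + K2) = 0.
  rewrite rmorphD (rmorphM _ K1) /= (@res_eqN1 K1 (d - b)); last by rewrite /= /K10 /K11 /K12; ring.
  rewrite (@res_eqN1 K2 (- d - 2 * b + r0 - r1 + r2)); last by rewrite /= /K22; ring.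
  by rewrite (@res_eqN1 e (c - d)) ?mulrNN ?mul1r ?addrN // /= /u /v; ring.
have M2 : 3 * (K1 * B - K2) = Zf (2 * (v * (al + be - u - 2 * v)))
    (al ^+ 2 + be ^+ 2 + u * (al + be) + 2 * (u * v) + v ^+ 2) (al * be - v * (al + be) - u ^+ 2 + v ^+ 2).
  by rewrite /B /K1 /K2 /K22 /K10 /K11 /K12 /r0 /r1 /r2 /al /be /u /v; zfring.
have [W WE] := (dv_piP _).2 D3.
have Y1 : K1 * A + K2 * tau = varpi * (1 + varpi ^+ 2 * mu * (Z1 - 1)).
  transitivity (K1 * A + K2 * tau + (1 + tau) - (3 - varpi)); first by rewrite /varpi; ring.
  by rewrite D1 three_pi; ring.
have X1 : K1 * B - K2 = varpi * (varpi ^+ 2 * mu * Z2) by rewrite D2 three_pi; ring.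
have E' : onE (1 + varpi ^+ 2 * mu * (Z1 - 1)) (- W) (varpi ^+ 2 * mu * Z2).
  apply: (zf_mulI (exp_neq0 zf_mul0 (n := 3) varpi_neq0)).
  transitivity ((varpi * (1 + varpi ^+ 2 * mu * (Z1 - 1))) ^+ 3 + (- (varpi * W)) ^+ 3
     - 2 * (varpi * (varpi ^+ 2 * mu * Z2)) ^+ 3); first by ring.
  by rewrite -Y1 -WE -X1 E Y1 WE X1; ring.
have rp k : res (varpi ^+ 2 * mu * k) = 0.
  have -> : varpi ^+ 2 * mu * k = varpi * (varpi * mu * k) by ring.
  by rewrite rmorphM /= res_pi mul0r.
have Z0 : varpi ^+ 2 * mu * Z2 = 0.
  apply: (onE_res0 E'); first exact: rp.
  have := rp (Z1 - 1); move: (_ * (Z1 - 1)) => k kE.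
  by rewrite rmorphD rmorph1 /= kE addr0; exact: oner_neq0.
rewrite X1 Z0 !mulr0 in M2.
have := congr1 zf0 M2; have := congr1 zf1 M2; move=> /= H1 /eqP H0.
split; last exact/esym.
by move: H0; rewrite eq_sym mulf_eq0 => /orP[//|/eqP].
Qed.

(** * The sextic l^6 + 4l^5 + 10l^4 + 10l^3 + 5l^2 + 2l + 1 *)

Definition qform (u v : int) := u ^+ 2 + u * v + v ^+ 2.
Definition bform (u v : int) := u ^+ 3 + 6 * u ^+ 2 * v + 3 * u * v ^+ 2 - v ^+ 3.
Definition hform (u v : int) := u ^+ 6 + 4 * u ^+ 5 * v + 10 * u ^+ 4 * v ^+ 2 + 10 * u ^+ 3 * v ^+ 3
  + 5 * u ^+ 2 * v ^+ 4 + 2 * u * v ^+ 5 + v ^+ 6.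
Lemma hform_bq u v : 9 * hform u v = bform u v ^+ 2 + 8 * qform u v ^+ 3.
Proof. by rewrite /hform /bform /qform; ring. Qed.

Lemma int_mul0 (a b : int) : a * b = 0 -> a = 0 \/ b = 0.
Proof. by move/eqP; rewrite mulf_eq0 => /orP[]/eqP; [left|right]. Qed.
Lemma int_bezout (a b : int) : exists d u v, [/\ d = u * a + v * b, dv d a & dv d b].
Proof.
have [u [v E]] := Bezoutz a b; exists (gcdz a b), u, v; split; first by rewrite -E.
  by have /dvdzP[k aE] := dvdz_gcdl a b; exists k; rewrite mulrC.
by have /dvdzP[k aE] := dvdz_gcdr a b; exists k; rewrite mulrC.
Qed.
Lemma int_unt (a : int) : unt a -> a = 1 \/ a = -1.
Proof.
by case=> b /(congr1 absz); rewrite abszM => /eqP; rewrite muln_eq1 => /andP[/eqP a1 _]; lia.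
Qed.
Lemma int_dv_le (a b : int) : dv a b -> b <> 0 -> (`|a| <= `|b|)%N.
Proof. by case=> k -> ab; rewrite abszM leq_pmulr // absz_gt0; apply/eqP => k0; apply: ab; rewrite k0 mulr0. Qed.

Lemma res3_eq0 (m : int) : m%:~R = 0 :> 'F_3 -> exists k, m = 3 * k.
Proof. by move/eqP; rewrite F3_int_eq0 => /dvdzP[k ->]; exists k; rewrite mulrC. Qed.
Lemma three_prime (e : int) : dv e 3 -> unt e \/ dv 3 e.
Proof.
move=> e3; have := int_dv_le e3 ltac:(done); case: e3 => k E le.
have : e = 3 \/ e = -3 \/ e = 1 \/ e = -1.
  have : e = 3 \/ e = -3 \/ e = 2 \/ e = -2 \/ e = 0 \/ e = 1 \/ e = -1 by lia.
  by case=> [->|[->|[e2|[e2|[e2|[->|->]]]]]]; rewrite ?e2 in E; lia.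
case=> [->|[->|[->|->]]].
- by right; apply: dv_refl.
- by right; exists (-1).
- by left; apply: unt1.
- by left; apply: untN1.
Qed.

(** If 3 divided Q, then u = v modulo 3, Q = 3k with k = v^2 modulo 3, and 9 divides B. The identity
    [hform_bq] would then give 3 | w and 3 | k, hence 3 | v and 3 | u. *)
Lemma qform_not3 (u v w : int) : cop u v -> w ^+ 2 = hform u v -> ~ dv 3 (qform u v).
Proof.
move=> uv E [k qE].
have /res3_eq0[j uE] : (u - v)%:~R = 0 :> 'F_3.
  apply/eqP; rewrite -sqrf_eq0 -rmorphXn /=.
  have -> : (u - v) ^+ 2 = 3 * (k - u * v) by rewrite mulrBr -qE /qform; ring.
  by rewrite rmorphM rmorph_nat /= F3_3 mul0r.
have {}uE : u = v + 3 * j by rewrite -uE; ring.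
have vn3 : v%:~R != 0 :> 'F_3.
  apply/eqP => /res3_eq0[i vE]; have : unt (3 : int).
    apply: (cop_unt_dv (b := v)); last by exists i.
    apply: cop_sym; apply: (cop_dv (b := u)); last exact: cop_sym.
    by exists (i + j); rewrite uE vE; ring.
  by case/int_unt.
have kE : k = v ^+ 2 + 3 * (v * j + j ^+ 2).
  by apply: (@mulfI _ 3) => //; rewrite -qE /qform uE; ring.
have BE : bform u v = 9 * (v ^+ 3 + 3 * (3 * j ^+ 2 * v + 2 * j * v ^+ 2 + j ^+ 3)).
  by rewrite /bform uE; ring.
set b := v ^+ 3 + _ in BE.
have : w ^+ 2 = 9 * b ^+ 2 + 24 * k ^+ 3.
  by apply: (@mulfI _ 9) => //; rewrite E hform_bq BE qE; ring.
have [w' ->] : exists w', w = 3 * w'.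
  apply: res3_eq0; apply/eqP; rewrite -sqrf_eq0 -rmorphXn /=; apply/eqP.
  have -> : w ^+ 2 = 3 * (3 * b ^+ 2 + 8 * k ^+ 3).
    by apply: (@mulfI _ 9) => //; rewrite E hform_bq BE qE; ring.
  by rewrite rmorphM rmorph_nat /= F3_3 mul0r.
move=> E2; move: vn3; apply/negP/negPn.
have k0 : k%:~R = 0 :> 'F_3.
  rewrite -[LHS]F3_cube -rmorphXn /=.
  have -> : k ^+ 3 = 3 * (3 * k ^+ 3 - w' ^+ 2 + b ^+ 2).
    apply: (@mulfI _ 3) => //; apply/eqP; rewrite -subr_eq0; apply/eqP.
    transitivity ((3 * w') ^+ 2 - (9 * b ^+ 2 + 24 * k ^+ 3)); first by ring.
    by rewrite E2 subrr.
  by rewrite rmorphM rmorph_nat /= F3_3 mul0r.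
rewrite -sqrf_eq0 -rmorphXn /=; have -> : v ^+ 2 = k - 3 * (v * j + j ^+ 2) by rewrite kE; ring.
by rewrite rmorphB rmorphM rmorph_nat /= F3_3 mul0r subr0 k0.
Qed.

(** A common divisor is prime to v and to 3; eliminating u^2 shows that it divides u + 2v, and then
    3 v^2. *)
Lemma cop_qform (u v e : int) : cop u v -> ~ dv 3 (qform u v) ->
  dv e (qform u v) -> dv e (bform u v) -> unt e.
Proof.
move=> uv q3 eq eb.
have CC := cop_of_common int_bezout.
have ev : cop e v.
  apply: (CC) => f fe fv; have fu : cop f u.
    by apply: cop_sym; apply: cop_dv fv uv.
  apply: (cop_unt_dv (b := u ^+ 2)); first exact: cop_exp.
  have -> : u ^+ 2 = qform u v - v * (u + v) by rewrite /qform; ring.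
  by apply: dv_sub; [apply: dv_trans fe eq|apply: dv_mulr].
have e3 : cop e 3.
  apply: (CC) => f fe f3; case: (three_prime f3) => // H; case: q3.
  by apply: dv_trans H _; apply: dv_trans fe eq.
have e3v2 : cop e (3 * v ^+ 2) by apply: cop_mul e3 _; apply: cop_exp.
have H1 : dv e (u + 2 * v).
  apply: (gauss e3v2).
  have -> : 3 * v ^+ 2 * (u + 2 * v) = (u + 5 * v) * qform u v - bform u v.
    by rewrite /qform /bform; ring.
  by apply: dv_sub eb; apply: dv_mull.
apply: (cop_unt_dv e3v2).
have -> : 3 * v ^+ 2 = qform u v - (u + 2 * v) * (u - v) by rewrite /qform; ring.
by apply: dv_sub eq _; apply: dv_mulr.
Qed.

Lemma int_sqr_dv2 (d : int) : dv (d ^+ 2) 2 -> unt d.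
Proof.
move=> d2; have := int_dv_le d2 ltac:(done); rewrite abszX => H.
have : d = 1 \/ d = -1.
  case: d2 => k E; have : (`|d| <= 1)%N by rewrite -ltnS -(ltn_exp2r _ _ (isT : 0 < 2)%N); apply: leq_ltn_trans H _.
  move=> d1; have : d <> 0 by move=> d0; move: E; rewrite d0; lia.
  by lia.
by case=> ->; [apply: unt1|apply: untN1].
Qed.
Lemma int_prime2 (x y q : int) : x * y = 2 * q -> exists k, x = 2 * k \/ y = 2 * k.
Proof.
move=> E; have [a [->|Ea]] := parity x; first by exists a; left.
have [b [->|Eb]] := parity y; first by exists b; right.
by move: E; rewrite Ea Eb; lia.
Qed.
Lemma int_cube (x y : int) : x ^+ 3 = y ^+ 3 -> x = y.
Proof.
move=> E; have : (x - y) * (x ^+ 2 + x * y + y ^+ 2) = 0.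
  by transitivity (x ^+ 3 - y ^+ 3); [ring|rewrite E subrr].
case/int_mul0 => [/eqP|H]; first by rewrite subr_eq0 => /eqP.
have y0 : y = 0 by nia.
by move: H; rewrite y0; nia.
Qed.
Lemma int_coprime_cube (a b c : int) : a <> 0 -> cop a b -> a * b = c ^+ 3 -> exists d, a = d ^+ 3.
Proof.
move=> a0 ab E; have [e [d [/int_unt eu ->]]] := coprime_mul_cube int_mul0 int_bezout a0 ab E.
by case: eu => ->; [exists d|exists (- d)]; ring.
Qed.

(** The halves [s] and [s'] of 3w - B and 3w + B are coprime with product 2 Q^3, so one is a cube
    and the other twice a cube. *)
Lemma split_int (u v w : int) : v <> 0 -> cop u v -> w ^+ 2 = hform u v ->
  exists al be, al * be = qform u v /\ al ^+ 3 - 2 * be ^+ 3 = bform u v.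
Proof.
move=> v0 uv E; have q3 := qform_not3 uv E.
have q0 : qform u v <> 0 by rewrite /qform; nia.
set q := qform u v in q3 q0 *; set B := bform u v.
have P : (3 * w - B) * (3 * w + B) = 2 * (4 * q ^+ 3).
  transitivity (9 * w ^+ 2 - B ^+ 2); first by ring.
  by rewrite E hform_bq; rewrite -/q -/B; ring.
have [s [s' [sE sE']]] : exists s s', 3 * w - B = 2 * s /\ 3 * w + B = 2 * s'.
  have [k [Ek|Ek]] := int_prime2 P.
    by exists k, (k + B); split=> //; lia.
  by exists (k - B), k; split=> //; lia.
have {}P : s * s' = 2 * q ^+ 3.
  by apply: (@mulfI _ 4) => //; transitivity ((2 * s) * (2 * s')); [ring|rewrite -sE -sE' P; ring].
have BE : B = s' - s by lia.
have CC := cop_of_common int_bezout.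
have ss : cop s s'.
  apply: (CC) => d ds ds'.
  have dB : dv d B by rewrite BE; apply: dv_sub.
  have dq : cop d q.
    by apply: (CC) => e ed eq; apply: (cop_qform uv q3 eq); apply: dv_trans ed dB.
  apply: int_sqr_dv2; have H : dv (d ^+ 2) (q ^+ 3 * 2).
    by rewrite mulrC -P expr2; apply: dv_mul.
  by apply: gauss H; apply: cop_exp; exact/cop_sym/cop_exp/cop_sym.
have main x y : cop x y -> 2 * x * y = 2 * q ^+ 3 ->
   exists a b, [/\ x = a ^+ 3, y = b ^+ 3 & a * b = q].
  move=> xy E2; have {}E2 : x * y = q ^+ 3 by lia.
  have q30 : q ^+ 3 <> 0 by apply: (exp_neq0 int_mul0).
  have x0 : x <> 0 by move=> x0; apply: q30; rewrite -E2 x0 mul0r.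
  have y0 : y <> 0 by move=> y0; apply: q30; rewrite -E2 y0 mulr0.
  have [a aE] := int_coprime_cube x0 xy E2.
  have [b bE] := int_coprime_cube y0 (cop_sym xy) (etrans (mulrC _ _) E2).
  by exists a, b; split=> //; apply: int_cube; rewrite exprMn -aE -bE.
have [k [Ek|Ek]] := int_prime2 P.
- have [||b [a [bE aE ab]]] := main k s'.
  + by apply: cop_sym; apply: (cop_dv (b := s)); [exists 2; rewrite mulrC|exact: cop_sym].
  + by rewrite -P Ek.
  + by exists a, b; split; [rewrite mulrC|rewrite BE Ek bE aE].
- have [||b [a [bE aE ab]]] := main k s.
  + by apply: cop_sym; apply: (cop_dv (b := s')); [exists 2; rewrite mulrC|exact: ss].
  + by rewrite -P Ek; ring.
  + by exists (- a), (- b); split; [rewrite mulrNN mulrC|rewrite BE Ek bE aE; ring].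
Qed.

Lemma F3_sol (x y : 'F_3) : x * y = 1 -> x - 2 * y = -1 -> x = 1 /\ y = 1.
Proof.
rewrite F3_two opprK => P S; have {}S : x = - 1 - y by rewrite -S; ring.
move: P; rewrite S; case: (F3P y) => ->.
- by rewrite mulr0 => /eqP; rewrite eq_sym oner_eq0.
- by split; [apply: val_inj|].
- by rewrite subrr mul0r => /eqP; rewrite eq_sym oner_eq0.
Qed.

(** By [descent_input], v = 0 or al + be = u + 2v. The latter, put into the second relation, gives v
    (2u + v) = 0, and 2u + v is nonzero modulo 3. *)
Lemma qform_normal (u v al be : int) : cop u v -> u%:~R = -1 :> 'F_3 -> v%:~R = 0 :> 'F_3 ->
  al * be = qform u v -> al ^+ 3 - 2 * be ^+ 3 = bform u v -> qform u v = 1.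
Proof.
move=> uv u1 v0 Eq EB.
have [al1 be1] : al%:~R = 1 :> 'F_3 /\ be%:~R = 1 :> 'F_3.
  apply: F3_sol.
    rewrite -rmorphM /= Eq /qform !rmorphD rmorphM !rmorphXn /= u1 v0; ring.
  have := congr1 (fun n : int => n%:~R : 'F_3) EB.
  have -> : bform u v = u ^+ 3 + v * (6 * u ^+ 2 + 3 * u * v - v ^+ 2) by rewrite /bform; ring.
  rewrite rmorphB (rmorphM _ 2) rmorph_nat rmorphD (rmorphM _ v) !(rmorphXn _ 3) /=.
  by rewrite !F3_cube v0 mul0r addr0 u1.
have sub1 (x : int) (s : int) : x%:~R = s%:~R :> 'F_3 -> exists k, x = s + 3 * k.
  move=> xs; have /res3_eq0[k kE] : (x - s)%:~R = 0 :> 'F_3 by rewrite rmorphB /= xs subrr.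
  by exists k; rewrite -kE; ring.
have [a aE] := sub1 al 1 al1; have [b bE] := sub1 be 1 be1.
have [c cE] : exists c, u = -1 + 3 * c by apply: sub1; rewrite rmorphN.
have [d dE] := res3_eq0 v0.
rewrite aE bE cE dE in Eq EB.
have [m Em] : exists m, a + b - c + d = 3 * m.
  exists (c ^+ 2 + c * d + d ^+ 2 - a * b - c); apply: (@mulfI _ 3) => //.
  transitivity ((1 + 3 * a) * (1 + 3 * b) - qform (-1 + 3 * c) (3 * d)
    + 3 * (3 * (c ^+ 2 + c * d + d ^+ 2 - a * b - c))); first by rewrite /qform; ring.
  by rewrite Eq subrr add0r.
have [/int_mul0 H1 H2] := descent_input Em Eq EB.
have Eq' := Eq; rewrite -aE -bE -cE -dE in H1 H2 Eq'.
case: H1 => [v00|S].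
  have /int_unt : unt u by apply: (cop_unt_dv uv); rewrite v00; exists 0; rewrite mulr0.
  by rewrite /qform v00 => -[] ->; ring.
have {}S : al + be = u + 2 * v by clear -S; lia.
have : v * (u * 2 + v) = 0.
  apply: (@mulfI _ 3) => //; rewrite mulr0 -H2.
  transitivity ((al + be) ^+ 2 - 2 * (al * be) + u * (al + be) + 2 * (u * v) + v ^+ 2); last by ring.
  by rewrite S Eq' /qform; ring.
case/int_mul0 => [v00|v2].
  have /int_unt : unt u by apply: (cop_unt_dv uv); rewrite v00; exists 0; rewrite mulr0.
  by rewrite /qform v00 => -[] ->; ring.
have : (u * 2 + v)%:~R = 0 :> 'F_3 by rewrite v2.
rewrite rmorphD rmorphM /= u1 v0 addr0 rmorph_nat mulrC F3_two opprK => /eqP.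
by rewrite oner_eq0.
Qed.

(** Q and B are invariant under (u, v) -> (v, - u - v), and a global sign only changes that of B.
    Since u and v differ modulo 3, these symmetries bring each of the six residue classes to u = -1,
    v = 0. *)
Theorem hform_sqr (u v w : int) : v <> 0 -> cop u v -> w ^+ 2 = hform u v -> qform u v = 1.
Proof.
move=> v0 uv E; have [al [be [Eq EB]]] := split_int v0 uv E.
have q3 := qform_not3 uv E.
have rot (x y : int) : cop x y -> cop y (- x - y).
  by case=> p [r pr]; exists (r - p), (- p); rewrite -pr; ring.
have qrot x y : qform y (- x - y) = qform x y by rewrite /qform; ring.
have brot x y : bform y (- x - y) = bform x y by rewrite /bform; ring.
have qneg x y : qform (- x) (- y) = qform x y by rewrite /qform; ring.
have bneg x y : bform (- x) (- y) = - bform x y by rewrite /bform; ring.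
have cneg (x y : int) : cop x y -> cop (- x) (- y).
  by case=> p [r pr]; exists (- p), (- r); rewrite -pr; ring.
have Eq2 : (- al) * (- be) = qform u v by rewrite mulrNN.
have EB2 : (- al) ^+ 3 - 2 * (- be) ^+ 3 = - bform u v by rewrite -EB; ring.
have uv' := rot _ _ uv; have uv'' := rot _ _ uv'.
have fin x y : cop x y -> qform x y = qform u v -> bform x y = bform u v \/ bform x y = - bform u v ->
    x%:~R = -1 :> 'F_3 -> y%:~R = 0 :> 'F_3 -> qform u v = 1.
  move=> xy qE bE x1 y0; rewrite -qE; case: bE => bE.
    by apply: (qform_normal xy x1 y0); rewrite ?qE ?bE; [exact: Eq|exact: EB].
  by apply: (qform_normal xy x1 y0); rewrite ?qE ?bE; [exact: Eq2|exact: EB2].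
have q3' : (qform u v)%:~R <> 0 :> 'F_3.
  by move/res3_eq0 => [k kE]; apply: q3; rewrite kE; exists k.
have d3 : u%:~R != v%:~R :> 'F_3.
  apply/eqP => d; apply: q3'; rewrite /qform !rmorphD rmorphM !rmorphXn /= d.
  by transitivity (3 * v%:~R ^+ 2 : 'F_3); [ring|rewrite F3_3 mul0r].
have N n : (- n)%:~R = - n%:~R :> 'F_3 by rewrite rmorphN.
have S x y : (- x - y)%:~R = - x%:~R - y%:~R :> 'F_3 by rewrite rmorphB rmorphN.
case: (F3P u%:~R) d3 => u1; case: (F3P v%:~R) => v1; rewrite u1 v1 ?eqxx // => _.
- apply: (fin _ _ uv''); rewrite ?qneg ?bneg ?qrot ?qrot ?brot ?brot ?N ?S ?N ?S ?N ?u1 ?v1; first [reflexivity|by left|by right|by apply: val_inj].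
- apply: (fin _ _ (cneg _ _ uv'')); rewrite ?qneg ?bneg ?qrot ?qrot ?brot ?brot ?N ?S ?N ?S ?N ?u1 ?v1; first [reflexivity|by left|by right|by apply: val_inj].
- apply: (fin _ _ (cneg _ _ uv)); rewrite ?qneg ?bneg ?qrot ?qrot ?brot ?brot ?N ?S ?N ?S ?N ?u1 ?v1; first [reflexivity|by left|by right|by apply: val_inj].
- apply: (fin _ _ uv'); rewrite ?qneg ?bneg ?qrot ?qrot ?brot ?brot ?N ?S ?N ?S ?N ?u1 ?v1; first [reflexivity|by left|by right|by apply: val_inj].
- apply: (fin _ _ uv); rewrite ?qneg ?bneg ?qrot ?qrot ?brot ?brot ?N ?S ?N ?S ?N ?u1 ?v1; first [reflexivity|by left|by right|by apply: val_inj].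
- apply: (fin _ _ (cneg _ _ uv')); rewrite ?qneg ?bneg ?qrot ?qrot ?brot ?brot ?N ?S ?N ?S ?N ?u1 ?v1; first [reflexivity|by left|by right|by apply: val_inj].
Qed.

Theorem hpoly_sqr (l r : rat) :
  r ^+ 2 = l ^+ 6 + 4 * l ^+ 5 + 10 * l ^+ 4 + 10 * l ^+ 3 + 5 * l ^+ 2 + 2 * l + 1 -> l = 0 \/ l = -1.
Proof.
move=> E; set n := numq l; set d := denq l; set p := numq r; set s := denq r.
have d0 : d <> 0 by apply/eqP/denq_neq0.
have s0 : s <> 0 by apply/eqP/denq_neq0.
have dq0 : d%:~R != 0 :> rat by rewrite intr_eq0; apply/eqP.
have sq0 : s%:~R != 0 :> rat by rewrite intr_eq0; apply/eqP.
have lE : l = n%:~R / d%:~R by rewrite divq_num_den.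
have rE : r = p%:~R / s%:~R by rewrite divq_num_den.
have H : (p * d ^+ 3) ^+ 2 = s ^+ 2 * hform n d.
  apply: (@intr_inj rat); rewrite /hform !(rmorphD, rmorphM, rmorphXn, rmorph_nat) /=.
  transitivity (s%:~R ^+ 2 * d%:~R ^+ 6 * r ^+ 2 : rat); first by rewrite rE; field.
  by rewrite E lE; field.
have /dvdzP[w wE] : (s %| p * d ^+ 3)%Z.
  rewrite dvdzE -(@dvdn_pexp2r _ _ 2) // -!abszX -dvdzE H; exact: dvdz_mulr.
have {}H : w ^+ 2 = hform n d.
  by apply: (@mulfI _ (s ^+ 2)); [rewrite expf_neq0 //; apply/eqP|rewrite -H wE; ring].
have nd : cop n d.
  have [u [v uv]] := Bezoutz n d; exists u, v; rewrite uv.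
  by apply/eqP; have := coprime_num_den l; rewrite /coprime /gcdz => /eqP ->.
have d_gt0 : 0 < d by apply: denq_gt0.
have := hform_sqr d0 nd H; rewrite /qform => Q.
have [nE|[nE dE]] : n = 0 \/ n = -1 /\ d = 1.
  have d1 : d = 1 by nia.
  by move: Q; rewrite d1; nia.
  by left; rewrite lE nE mul0r.
by right; rewrite lE nE dE.
Qed.

(** * Rational points on cubics *)

Lemma involution_even (T : eqType) (f : T -> T) (s : seq T) : uniq s ->
  {in s, forall x, [/\ f x \in s, f x != x & f (f x) = x]} -> ~~ odd (size s).
Proof.
move: {2}(size s) (leqnn (size s)) => n; elim: n s => [|n IH] [|x s] //= sn /andP[xs us] H.
have [fxs fx ffx] := H x (mem_head _ _); rewrite inE (negbTE fx) /= in fxs.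
have sE : size (rem (f x) s) = (size s).-1 by rewrite size_rem.
have s0 : (0 < size s)%N by case: (s) fxs.
have : ~~ odd (size (rem (f x) s)).
  apply: IH; [by rewrite sE; lia|exact: rem_uniq|].
  move=> y; rewrite mem_rem_uniq // inE => /andP[yfx ys].
  have [fys fy ffy] := H y ltac:(by rewrite inE ys orbT).
  split=> //; rewrite mem_rem_uniq // inE; apply/andP; split.
    by apply: contraNneq xs => fyx; move: ys; rewrite -ffy fyx ffx.
  move: fys; rewrite inE => /orP[/eqP fyx|//].
  by move: yfx; rewrite -fyx ffy eqxx.
by rewrite sE; lia.
Qed.

(** * Chords and tangents of a Weierstrass cubic *)

Section Chords.
Variables (F : fieldType) (p q : F).
Definition cub (x : F) := x ^+ 3 + p * x + q.
Definition on_cub (P : F * F) := P.2 ^+ 2 == cub P.1.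
(** Covers chords and tangents at once: the second equation is the difference of the two curve
    equations divided by the difference of the abscissas. The point [third] is not reflected, so it
    is -(P + Q) in the group. *)
Definition is_slope (P Q : F * F) (l : F) :=
  Q.2 = P.2 - l * (P.1 - Q.1) /\
  l * (P.2 + Q.2) = P.1 ^+ 2 + P.1 * Q.1 + Q.1 ^+ 2 + p.
Definition third (P Q : F * F) (l : F) : F * F :=
  let x := l ^+ 2 - P.1 - Q.1 in (x, P.2 + l * (x - P.1)).

Lemma line_cub P Q l x : on_cub P -> is_slope P Q l ->
  cub x - (P.2 + l * (x - P.1)) ^+ 2 = (x - P.1) * (x - Q.1) * (x - (third P Q l).1).
Proof.
case: P Q => [x1 y1] [x2 y2]; rewrite /on_cub /is_slope /third /cub /= => /eqP E [-> S].
have pE : p = l * (y1 + (y1 - l * (x1 - x2))) - (x1 ^+ 2 + x1 * x2 + x2 ^+ 2) by rewrite S; ring.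
have qE : q = y1 ^+ 2 - x1 ^+ 3 - p * x1 by rewrite E; ring.
by rewrite qE pE; ring.
Qed.
Lemma third_on P Q l : on_cub P -> is_slope P Q l -> on_cub (third P Q l).
Proof.
move=> oP S; have := line_cub (third P Q l).1 oP S.
by rewrite subrr mulr0 /on_cub => /eqP; rewrite subr_eq0 => /eqP ->.
Qed.
Lemma third_slope P Q l : on_cub P -> is_slope P Q l -> is_slope P (third P Q l) l.
Proof.
case: P Q => [x1 y1] [x2 y2]; rewrite /on_cub /is_slope /third /cub /= => /eqP E [-> S]; split; first by ring.
have pE : p = l * (y1 + (y1 - l * (x1 - x2))) - (x1 ^+ 2 + x1 * x2 + x2 ^+ 2) by rewrite S; ring.
by rewrite pE; ring.
Qed.
Lemma third_third P Q l : is_slope P Q l -> third P (third P Q l) l = Q.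
Proof.
case: P Q => [x1 y1] [x2 y2]; rewrite /third /= => -[/= -> _].
by congr pair; ring.
Qed.
Lemma chord_slope P Q : on_cub P -> on_cub Q -> P.1 != Q.1 ->
  is_slope P Q ((P.2 - Q.2) / (P.1 - Q.1)).
Proof.
case: P Q => [x1 y1] [x2 y2]; rewrite /on_cub /is_slope /cub /= => /eqP E1 /eqP E2.
rewrite -subr_eq0 => d0; split; first by field.
apply: (mulfI d0); transitivity (y1 ^+ 2 - y2 ^+ 2); first by field.
by rewrite E1 E2; ring.
Qed.

Hypothesis two0 : (2 : F) != 0.
Definition slope (P Q : F * F) := if P.1 == Q.1 then (3 * P.1 ^+ 2 + p) / (2 * P.2)
  else (P.2 - Q.2) / (P.1 - Q.1).
Lemma slopeP P Q : on_cub P -> on_cub Q -> P.2 != 0 -> Q <> (P.1, - P.2) -> is_slope P Q (slope P Q).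
Proof.
move=> oP oQ y0 QP; rewrite /slope; case: eqVneq => [x12|]; last exact: chord_slope.
case: P Q oP oQ y0 QP x12 => [x1 y1] [x2 y2]; rewrite /on_cub /= => /eqP E1 /eqP E2 y0 QP x12.
rewrite -x12 in E2 QP *.
have /eqP : (y1 - y2) * (y1 + y2) = 0.
  by transitivity (y1 ^+ 2 - y2 ^+ 2); [ring|rewrite E1 E2 subrr].
rewrite mulf_eq0 subr_eq0 addrC addr_eq0 => /orP[/eqP y12|/eqP y12]; last by case: QP; rewrite y12.
by rewrite -y12; split; rewrite /= ?subrr ?mulr0 ?subr0 //; field; rewrite two0 y0.
Qed.
Lemma slope_uniq P Q l : P.2 != 0 -> Q <> (P.1, - P.2) -> is_slope P Q l -> slope P Q = l.
Proof.
case: P Q => [x1 y1] [x2 y2] /= y0 QP [/= y2E S]; rewrite /slope /=; case: eqVneq => [x12|].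
  rewrite -x12 subrr mulr0 subr0 in y2E; rewrite -x12 y2E in S *.
  apply: (mulIf (x := 2 * y1)); first by rewrite mulf_neq0.
  rewrite divfK ?mulf_neq0 //; transitivity (x1 ^+ 2 + x1 * x1 + x1 ^+ 2 + p); first by ring.
  by rewrite -S; ring.
by rewrite -subr_eq0 y2E => d0; field.
Qed.
End Chords.

(** The slope bounds express that the sum and the difference of the two points have bounded
    abscissas. They make the cubic and its derivative at [x1] of order [|x1 - x2|], and the
    discriminant is a combination of these two values. *)
Lemma disc_bound (F : realFieldType) (p q N x1 x2 y1 y2 : F) :
  y1 ^+ 2 = cub p q x1 -> y2 ^+ 2 = cub p q x2 -> 0 <= N -> `|x1| <= N -> `|x2| <= N ->
  0 < `|x1 - x2| < 1 ->
  ((y1 - y2) / (x1 - x2)) ^+ 2 <= 3 * N -> ((y1 + y2) / (x1 - x2)) ^+ 2 <= 3 * N ->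
  `|4 * p ^+ 3 + 27 * q ^+ 2| <=
  (24 * p ^+ 2 * N + 3 * (2 * `|p| * N + 3 * `|q|) * (9 * N + 6 * N ^+ 2)) * `|x1 - x2|.
Proof.
move=> E1 E2 N0 a1 a2 /andP[D0 D1].
have [D DE] : exists D, D = x1 - x2 by eexists.
have [d dE] : exists d, d = `|D| by eexists.
rewrite -DE -dE in D0 D1 *.
have Dn : D ^+ 2 = d ^+ 2 by rewrite dE real_normK ?num_real.
have D2 : 0 < D ^+ 2 by rewrite Dn exprn_gt0.
rewrite !expr_div_n !ler_pdivrMr // => s1 s2.
have [Y1 Y1E] : exists Y, Y = y1 ^+ 2 by eexists.
have [Y2 Y2E] : exists Y, Y = y2 ^+ 2 by eexists.
have [B BE] : exists B, B = 3 * N * D ^+ 2 by eexists.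
rewrite -BE in s1 s2.
have Y10 : 0 <= Y1 by rewrite Y1E sqr_ge0.
have Y20 : 0 <= Y2 by rewrite Y2E sqr_ge0.
have s12 : Y1 + Y2 <= B.
  have -> : Y1 + Y2 = ((y1 - y2) ^+ 2 + (y1 + y2) ^+ 2) / 2 by rewrite Y1E Y2E; field.
  by lra.
have f1 : Y1 <= B by lra.
have f2 : Y2 <= B by lra.
have BE' : B = d * (3 * N * d) by rewrite BE Dn; ring.
have [g gE] : exists g, g = x1 ^+ 2 + x1 * x2 + x2 ^+ 2 + p by eexists.
have gD : `|g| <= 3 * N * d.
  rewrite -(ler_pM2l D0) -BE' {1}dE -normrM.
  have -> : D * g = Y1 - Y2 by rewrite Y1E Y2E E1 E2 /cub DE gE; ring.
  by rewrite ler_norml; apply/andP; split; lra.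
have [f' f'E] : exists f', f' = 3 * x1 ^+ 2 + p by eexists.
have f'D : `|f'| <= 6 * N * d.
  have -> : f' = g + D * (x1 + x1 + x2) by rewrite f'E gE DE; ring.
  apply: le_trans (ler_normD _ _) _; rewrite normrM -dE.
  have : `|x1 + x1 + x2| <= N + N + N.
    by do 2 (apply: le_trans (ler_normD _ _) _; apply: lerD => //).
  move/(ler_wpM2l (ltW D0)); move: (d * `|_|) gD => u; move: `|g| => v; lra.
have NN : 0 <= N ^+ 2 by apply: sqr_ge0.
have fD : `|3 * Y1 - x1 * f'| <= (9 * N + 6 * N ^+ 2) * d.
  apply: le_trans (ler_normB _ _) _; rewrite !normrM (ger0_norm (x := 3)) // (ger0_norm Y10).
  have H1 : Y1 <= 3 * N * d.
    by apply: le_trans f1 _; rewrite BE' ler_piMl ?(ltW D1) // !mulr_ge0 // ltW.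
  have : `|x1| * `|f'| <= N * (6 * N * d) by apply: ler_pM.
  by move: (`|x1| * `|f'|) => u; lra.
have cE : `|3 * (2 * p * x1 - 3 * q)| <= 3 * (2 * `|p| * N + 3 * `|q|).
  rewrite normrM (ger0_norm (x := 3)) // ler_pM2l //; apply: le_trans (ler_normB _ _) _.
  rewrite !normrM (ger0_norm (x := 2)) // (ger0_norm (x := 3)) // lerD2r ler_wpM2l // mulr_ge0 //.
(* Here 3 f - x f' is 2px + 3q, and multiplying it by 2px - 3q leaves only x^2, which f'
   eliminates. *)
have -> : 4 * p ^+ 3 + 27 * q ^+ 2 = 4 * p ^+ 2 * f' - 3 * (2 * p * x1 - 3 * q) * (3 * Y1 - x1 * f').
  by rewrite Y1E E1 /cub f'E; ring.
apply: le_trans (ler_normB _ _) _; rewrite [`|3 * _ * _|]normrM.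
have e1 := ler_pM (normr_ge0 _) (normr_ge0 _) cE fD.
have e2 : `|4 * p ^+ 2 * f'| <= 4 * p ^+ 2 * (6 * N * d).
  have p2 : 0 <= 4 * p ^+ 2 by rewrite mulr_ge0 ?sqr_ge0.
  by rewrite normrM (ger0_norm p2) ler_wpM2l.
apply: le_trans (lerD e2 e1) _; rewrite le_eqVlt; apply/orP; left; apply/eqP; ring.
Qed.

Lemma ratr_cub (F : numFieldType) (p q x : rat) :
  ratr (cub p q x) = cub (ratr p) (ratr q) (ratr x) :> F.
Proof. by rewrite /cub !rmorphD (rmorphM _ p) (rmorphXn _ 3). Qed.

Section Infinite.
Variables (p q : rat).
Hypothesis no_root : forall x : rat, cub p q x != 0.
Let on_y0 (P : rat * rat) : on_cub p q P -> P.2 != 0.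
Proof. by move=> /eqP E; have := no_root P.1; rewrite -E expf_eq0. Qed.

Lemma curve_infinite (R : realFieldType) (e : R) (P : rat * rat) : on_cub p q P ->
  cub (ratr p) (ratr q) e = 0 -> ratr P.1 < e ->
  forall s : seq (rat * rat), ~ (forall Q, on_cub p q Q -> Q \in s).
Proof.
move=> oP e0 Pe s0 all_s; pose s := undup (filter (on_cub p q) s0).
have sP Q : (Q \in s) = on_cub p q Q.
  rewrite mem_undup mem_filter; case: (boolP (on_cub p q Q)) => //= /all_s ->.
  by [].
have us : uniq s by apply: undup_uniq.
pose neg (Q : rat * rat) := (Q.1, - Q.2).
have negK Q : neg (neg Q) = Q by case: Q => x y; rewrite /neg /= opprK.
have on_neg Q : on_cub p q Q -> on_cub p q (neg Q) by rewrite /on_cub sqrrN.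
have even_s : ~~ odd (size s).
  apply: (involution_even (f := neg) us) => Q; rewrite sP => oQ; split; [by rewrite sP on_neg| |exact: negK].
  apply: contraNneq (on_y0 oQ) => /(congr1 snd) /= H.
  by apply/eqP; lra.
have sN : neg P \in s by rewrite sP on_neg.
have : odd (size s) = ~~ odd (size (rem (neg P) s)).
  by rewrite size_rem //; case: (s) sN => //= *; rewrite negbK.
rewrite (negbTE even_s) => /esym/negbFE; apply/negP.
have P0 := on_y0 oP.
apply: (involution_even (f := fun Q => third P Q (slope p P Q))); first exact: rem_uniq.
move=> Q; rewrite mem_rem_uniq // inE sP => /andP[/eqP QP oQ].
have S := slopeP (isT : (2 : rat) != 0) oP oQ P0 QP.
set l := slope p P Q in S *.
have oT := third_on oP S; have S' := third_slope oP S.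
have TN : third P Q l <> neg P.
  move=> E; case: S' => S1 _; move: S1; rewrite E /= subrr mulr0 subr0 => H.
  by move/eqP: P0; apply; lra.
split.
- by rewrite mem_rem_uniq // inE sP oT andbT; apply/eqP.
(* A fixed point [Q] makes the line from [P] tangent at [Q]. At the root [e] the identity [line_cub]
   then equates minus a square with (e - P.1)(e - Q.1)^2, which is positive because [P] lies to the
   left of [e]. *)
- apply/eqP => TQ; have := congr1 fst TQ; rewrite /third /= => l2.
  have oPR : on_cub (ratr p) (ratr q) (ratr P.1 : R, ratr P.2).
    by rewrite /on_cub /= -rmorphXn /= (eqP oP) ratr_cub.
  have SR : is_slope (ratr p) (ratr P.1 : R, ratr P.2) (ratr Q.1, ratr Q.2) (ratr l).
    case: S => S1 S2; split => /=; first by rewrite S1 rmorphB (rmorphM _ l) rmorphB.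
    by rewrite -rmorphD -rmorphM /= S2 !rmorphD !(rmorphXn _ 2) (rmorphM _ P.1 Q.1).
  have := line_cub e oPR SR; rewrite e0 /third /= -rmorphXn -!rmorphB /= l2 sub0r => E.
  have Qe : e - ratr Q.1 != 0.
    rewrite subr_eq0; apply: contraTneq (no_root Q.1) => eQ; apply/negPn.
    by move: e0; rewrite eQ -ratr_cub => /eqP; rewrite fmorph_eq0.
  have : 0 < (e - ratr P.1) * (e - ratr Q.1) * (e - ratr Q.1).
    by rewrite -mulrA -expr2 mulr_gt0 ?subr_gt0 // exprn_even_gt0.
  by rewrite -E oppr_gt0 ltNge sqr_ge0.
- by rewrite (slope_uniq (isT : (2 : rat) != 0) P0 TN S') (third_third S).
Qed.

Hypothesis inf : forall s : seq (rat * rat), ~ (forall Q, on_cub p q Q -> Q \in s).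

Lemma many_points n : exists s : seq (rat * rat),
  [/\ {in s, forall Q, on_cub p q Q}, uniq (map fst s) & size s = n].
Proof.
elim: n => [|n [s [on_s us sn]]]; first by exists [::].
have /existsNP[Q /not_implyP[oQ Qs]] := @inf (s ++ [seq (Q.1, - Q.2) | Q <- s]).
exists (Q :: s); split; [|rewrite /= us andbT|by rewrite /= sn].
  by move=> T; rewrite inE => /orP[/eqP ->//|/on_s].
apply/negP => /mapP[T Ts QT]; apply: Qs; rewrite mem_cat.
have := on_s _ Ts; case: T Q Ts QT oQ => [x y] [x' y'] Ts /= ->; rewrite /on_cub /= => /eqP <-.
rewrite eqf_sqr => /orP[/eqP <-|/eqP yE]; first by rewrite Ts.
by apply/orP; right; apply/mapP; exists (x, y) => //=; rewrite yE opprK.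
Qed.

Definition disc := 4 * p ^+ 3 + 27 * q ^+ 2.
(** A vanishing discriminant would make -3q / (2p), or 0 when p = 0, a rational root. *)
Lemma disc_neq0 : disc != 0.
Proof.
rewrite /disc; apply/negP => /eqP d0; have [p0|p0] := eqVneq p 0.
  move/eqP: (no_root 0); rewrite /cub p0; apply.
  have /eqP : q ^+ 2 = 0 by move: d0; rewrite p0; lra.
  by rewrite sqrf_eq0 => /eqP ->; ring.
move/eqP: (no_root (- 3 * q / (2 * p))); rewrite /cub; apply.
transitivity (- q * (4 * p ^+ 3 + 27 * q ^+ 2) / (8 * p ^+ 3)); first by field.
by rewrite d0 mulr0 mul0r.
Qed.

Lemma close_points (M e : rat) : 0 < e -> (forall Q, on_cub p q Q -> `|Q.1| <= M) ->
  exists Q T, [/\ on_cub p q Q, on_cub p q T, Q.1 != T.1 & `|Q.1 - T.1| < e].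
Proof.
move=> e0 bd.
pose box (x : rat) := Num.truncn ((x + M) / e).
pose K := (Num.truncn (2 * M / e)).+1.
have [s [on_s us sK]] := many_points K.+1.
have pos Q : on_cub p q Q -> 0 <= (Q.1 + M) / e.
  by move=> /bd; rewrite ler_norml => /andP[H _]; rewrite divr_ge0 ?(ltW e0) //; lra.
have [x [y [xs ys xy bxy]]] : exists x y, [/\ x \in map fst s, y \in map fst s, x != y & box x = box y].
  apply: contrapT => H; have : uniq (map box (map fst s)).
    rewrite map_inj_in_uniq // => x y xs ys bxy; apply/eqP; apply: contrapT => /negP xy.
    by apply: H; exists x, y.
  move/uniq_leq_size => /(_ (iota 0 K)); rewrite size_iota !size_map sK ltnn => W.
  suff: false by []; apply: W => _ /mapP[_ /mapP[Q Qs ->] ->]; rewrite mem_iota /= add0n ltnS.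
  apply: le_truncn; rewrite ler_pM2r ?invr_gt0 //.
  by have := bd _ (on_s _ Qs); rewrite ler_norml => /andP[_ H']; lra.
case/mapP: xs xy bxy => Q Qs ->; case/mapP: ys => T Ts -> QT bQT.
exists Q, T; split; [exact: on_s|exact: on_s|exact: QT|].
have := truncn_itv (pos _ (on_s _ Qs)); have := truncn_itv (pos _ (on_s _ Ts)).
rewrite -/(box _) -/(box Q.1) bQT; set n := box T.1; rewrite -natr1.
rewrite !ler_pdivlMr // !ltr_pdivrMr // => /andP[h1 h2] /andP[h3 h4].
by rewrite ltr_norml; apply/andP; split; lra.
Qed.

(** If all abscissas were at most [M], the chords from one point to a close point and to its
    reflection would both have bounded slopes, and [disc_bound] fails for points closer than
    [|disc| / L]. *)
Lemma curve_unbounded M : exists2 Q, on_cub p q Q & M < Q.1.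
Proof.
apply: contrapT => H.
have ub Q : on_cub p q Q -> Q.1 <= M.
  by move=> oQ; rewrite leNgt; apply/negP => MQ; apply: H; exists Q.
have [N NE] : exists N, N = 1 + `|M| + `|p| + `|q| by eexists.
have N1 : 1 <= N by rewrite NE; have := normr_ge0 M; have := normr_ge0 p; have := normr_ge0 q; lra.
have bd Q : on_cub p q Q -> `|Q.1| <= N.
  move=> oQ; have := ub Q oQ; case: Q oQ => x y; rewrite /on_cub /cub /= => /eqP E xM.
  rewrite ler_norml; apply/andP; split; last by rewrite NE; have := ler_norm M; have := normr_ge0 p; have := normr_ge0 q; lra.
  rewrite leNgt; apply/negP => xN; have := sqr_ge0 y; rewrite E.
  have := ler_norm q; have := ler_norm (- p); rewrite normrN => pp qq M0.
  have xN' : x < - (1 + `|p| + `|q|) by move: xN; rewrite NE; have := normr_ge0 M; lra.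
  have [p0 q0] := (normr_ge0 p, normr_ge0 q).
  move: xN' p0 q0 pp qq M0; move: `|p| `|q| => P Q' xN' p0 q0 pp qq.
  have : x ^+ 3 + p * x + q < 0; last lra.
  nra.
have [L LE] : exists L, L = 24 * p ^+ 2 * N + 3 * (2 * `|p| * N + 3 * `|q|) * (9 * N + 6 * N ^+ 2) + 1 by eexists.
have N0 : 0 <= N by lra.
have L0 : 0 < L.
  have h1 := mulr_ge0 (sqr_ge0 p) N0; have h2 := mulr_ge0 (normr_ge0 p) N0.
  have h3 : 0 <= 9 * N + 6 * N ^+ 2 by have := sqr_ge0 N; lra.
  have h4 : 0 <= 3 * (2 * `|p| * N + 3 * `|q|) by have := normr_ge0 q; lra.
  by have := mulr_ge0 h4 h3; rewrite LE; lra.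
have D0 : 0 < `|disc| by rewrite normr_gt0 disc_neq0.
have [|[x1 y1] [[x2 y2]]] := @close_points N (Num.min 1 (`|disc| / L)) _ bd.
  by rewrite lt_min ltr01 divr_gt0.
case=> o1 o2 /= x12; rewrite lt_min ltr_pdivlMr // => /andP[d1 dL].
have o2' : on_cub p q (x2, - y2) by move: o2; rewrite /on_cub /= sqrrN.
have := third_on o1 (chord_slope o1 o2 x12); have := third_on o1 (chord_slope o1 o2' x12).
move=> /ub /= u1 /ub /= u2.
have [a1 a2] := (bd _ o1, bd _ o2); have MN : M <= N.
  by rewrite NE; have := ler_norm M; have := normr_ge0 p; have := normr_ge0 q; lra.
move/eqP: o1 o2 => /= E1 /eqP /= E2.
have x0 : 0 < `|x1 - x2| < 1 by rewrite normr_gt0 subr_eq0 x12 d1.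
have [b1 b2] : x1 <= N /\ x2 <= N by split; [apply: le_trans a1|apply: le_trans a2]; apply: ler_norm.
have B := disc_bound E1 E2 N0 a1 a2 x0.
move: dL; apply/negP; rewrite -leNgt; apply: le_trans (B _ _) _.
- move: u2; move: (_ ^+ 2) => u; lra.
- move: u1; rewrite opprK; move: (_ ^+ 2) => u; lra.
- rewrite LE [leRHS]mulrC [leRHS]mulrDl lerDl mul1r; exact: normr_ge0.
Qed.
End Infinite.

(** * Small displacements by points of large abscissa *)

Lemma cub_large (F : realFieldType) (p q s K g e : F) : 0 < s -> 0 <= K -> 0 < e ->
  exists X0, forall X Y, X0 <= X -> 0 < Y -> Y ^+ 2 = cub p q X ->
  [/\ 1 <= X, g < X, K * X < 2 * s * Y & K * X + 2 * s * Y < e * (X - g) ^+ 2].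
Proof.
move=> s0 K0 e0; have s20 : 0 < s ^+ 2 by apply: exprn_gt0.
have e20 : 0 < e ^+ 2 by apply: exprn_gt0.
(* One summand per estimate: dominance of X^3 in the cubic, K X < 2 s Y, X - g >= X / 2, and the
   bounds of K X and 2 s Y by e X^2 / 8. *)
exists (2 * (1 + `|p| + `|q|) + K ^+ 2 / s ^+ 2 + 2 * `|g| + 8 * K / e + 8 * (8 * (9 * s ^+ 2)) / e ^+ 2).
move=> X Y XX Y0 E.
have := normr_ge0 p; have := normr_ge0 q; have := normr_ge0 g => g0 q0 p0.
have [u uE] : exists u, u = K ^+ 2 / s ^+ 2 by eexists.
have [v vE] : exists u, u = 8 * K / e by eexists.
have [w wE] : exists u, u = 8 * (8 * (9 * s ^+ 2)) / e ^+ 2 by eexists.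
have u0 : 0 <= u by rewrite uE divr_ge0 ?sqr_ge0.
have v0 : 0 <= v by rewrite vE divr_ge0 ?(ltW e0) // mulr_ge0.
have w0 : 0 <= w by rewrite wE; apply: divr_ge0; [have := ltW s20; lra|exact: ltW].
rewrite -uE -vE -wE in XX.
have X1 : 1 <= X by lra.
have uX : K ^+ 2 < 2 * s ^+ 2 * X.
  have : K ^+ 2 = u * s ^+ 2 by rewrite uE divfK ?gt_eqF.
  have : u * s ^+ 2 < 2 * X * s ^+ 2 by rewrite ltr_pM2r //; lra.
  by lra.
have vX : 8 * K <= X * e.
  have -> : 8 * K = v * e by rewrite vE divfK ?gt_eqF.
  by rewrite ler_pM2r //; lra.
have wX : 8 * (8 * (8 * s ^+ 2)) < X * e ^+ 2.
  have H : 8 * (8 * (9 * s ^+ 2)) = w * e ^+ 2 by rewrite wE divfK ?gt_eqF.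
  have : w * e ^+ 2 <= X * e ^+ 2 by rewrite ler_pM2r //; lra.
  by lra.
have gX : 2 * `|g| <= X by lra.
have pX : 2 * (1 + `|p| + `|q|) <= X by lra.
have X0 : 0 < X by lra.
have X2 : 0 < X ^+ 2 by apply: exprn_gt0.
have X3 : 0 < X ^+ 3 by apply: exprn_gt0.
have pq : `|p * X + q| <= X ^+ 3 / 2.
  apply: le_trans (ler_normD _ _) _; rewrite normrM (gtr0_norm X0).
  have h1 : `|p| * X + `|q| <= (`|p| + `|q|) * X.
    by rewrite mulrDl lerD2l ler_peMr.
  have h2 : (`|p| + `|q|) * X <= X / 2 * X by rewrite ler_pM2r //; lra.
  have h3 : X / 2 * X <= X ^+ 3 / 2.
    by have := ler_wpM2l (ltW X2) X1; rewrite mulr1 -exprSr; lra.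
  by lra.
move: pq; rewrite ler_norml => /andP[pq1 pq2].
have Y1 : X ^+ 3 / 2 <= Y ^+ 2 by rewrite E /cub; lra.
have Y2 : Y ^+ 2 <= 2 * X ^+ 3 by rewrite E /cub; lra.
have gXX : g < X by have := ler_norm g; lra.
have gg : X ^+ 2 / 4 <= (X - g) ^+ 2.
  have : X / 2 <= X - g by have := ler_norm g; lra.
  have X20 : 0 <= X / 2 by lra.
  by move=> H; have := ler_pM X20 X20 H H; rewrite -!expr2 expr_div_n; lra.
have sY : 0 < 2 * s * Y by rewrite !mulr_gt0.
split=> //.
  rewrite -(@ltr_pXn2r _ 2) // ?nnegrE ?mulr_ge0 ?(ltW X0) ?(ltW sY) ?(ltW s0) ?(ltW Y0) //.
  rewrite !exprMn; have := ler_wpM2l (ltW s20) Y1.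
  have : K ^+ 2 * X ^+ 2 < 2 * s ^+ 2 * X * X ^+ 2 by rewrite ltr_pM2r.
  have -> : 2 * s ^+ 2 * X * X ^+ 2 = 2 * (s ^+ 2 * X ^+ 3) by ring.
  by lra.
have h1 : K * X <= e * X ^+ 2 / 8.
  have : 8 * K * X <= X * e * X by rewrite ler_pM2r.
  have -> : X * e * X = e * X ^+ 2 by ring.
  by lra.
have h2 : 2 * s * Y < e * X ^+ 2 / 8.
  have eX : 0 < e * X ^+ 2 / 8 by rewrite divr_gt0 // mulr_gt0.
  rewrite -(@ltr_pXn2r _ 2) // ?nnegrE ?(ltW eX) ?(ltW sY) //.
  rewrite expr_div_n !exprMn.
  have : 8 * (8 * (8 * s ^+ 2)) * X ^+ 3 < X * e ^+ 2 * X ^+ 3 by rewrite ltr_pM2r.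
  have := ler_wpM2l (ltW s20) Y2.
  have -> : X * e ^+ 2 * X ^+ 3 = e ^+ 2 * (X ^+ 2) ^+ 2 by ring.
  by lra.
have := ler_wpM2l (ltW e0) gg.
by lra.
Qed.

(** The third abscissa is g + (A - 2sY) / (X - g)^2 or g + (A + 2sY) / (X - g)^2 with A linear in X,
    while Y grows like X^(3/2). Hence the sign of the displacement is that of the Y term, and its
    size tends to 0. *)
Lemma chord_moves (F : realFieldType) (p q s g e : F) : 0 < s -> s ^+ 2 = cub p q g -> 0 < e ->
  exists X0, forall X Y, X0 <= X -> 0 < Y -> Y ^+ 2 = cub p q X ->
  [/\ g < X, g - e < ((s - Y) / (g - X)) ^+ 2 - g - X < g &
     g < ((s + Y) / (g - X)) ^+ 2 - g - X < g + e].
Proof.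
move=> s0 E e0; pose K := `|p + 3 * g ^+ 2| + `|q + s ^+ 2 - 2 * g ^+ 3|.
have K0 : 0 <= K by rewrite addr_ge0.
have [X0 H] := cub_large p q g s0 K0 e0; exists X0 => X Y XX Y0 EY.
have [X1 gX H1 H2] := H X Y XX Y0 EY.
have d0 : g - X != 0 by rewrite subr_eq0 lt_eqF.
have d1 : X - g != 0 by rewrite subr_eq0 gt_eqF.
have D2 : 0 < (X - g) ^+ 2 by rewrite exprn_gt0 // subr_gt0.
pose A := (p + 3 * g ^+ 2) * X + (q + s ^+ 2 - 2 * g ^+ 3).
have AK : `|A| <= K * X.
  have X0' : 0 <= X by lra.
  apply: le_trans (ler_normD _ _) _; rewrite normrM (ger0_norm X0') /K.
  move: `|p + _| `|q + _ - _| (normr_ge0 (q + s ^+ 2 - 2 * g ^+ 3)) => a b b0.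
  by have := ler_peMr b0 X1; lra.
have shift t : t ^+ 2 = Y ^+ 2 -> ((s + t) / (g - X)) ^+ 2 - g - X = g + (A + 2 * s * t) / (X - g) ^+ 2.
  move=> tE; have tE' : t ^+ 2 = X ^+ 3 + p * X + q by rewrite tE EY.
  rewrite /A (_ : q = t ^+ 2 - X ^+ 3 - p * X); last by rewrite tE'; ring.
  by field; rewrite ?d0 ?d1.
have lin u : (g - e < g + u / (X - g) ^+ 2 < g + e) = (- (e * (X - g) ^+ 2) < u < e * (X - g) ^+ 2).
  by rewrite ltrD2l ltrD2l ltr_pdivrMr // ltr_pdivlMr // mulNr.
have := AK; rewrite ler_norml => /andP[A1 A2].
have P1 := lin (A - 2 * s * Y); have P2 := lin (A + 2 * s * Y).
move: (shift (- Y) (sqrrN Y)) (shift Y erefl); rewrite mulrN => -> ->; split=> //; apply/andP; split.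
- by have /andP[] : g - e < g + (A - 2 * s * Y) / (X - g) ^+ 2 < g + e by rewrite P1; apply/andP; split; lra.
- by rewrite -ltrBrDl subrr pmulr_llt0 ?invr_gt0 //; lra.
- by rewrite ltrDl divr_gt0 //; lra.
- by have /andP[] : g - e < g + (A + 2 * s * Y) / (X - g) ^+ 2 < g + e by rewrite P2; apply/andP; split; lra.
Qed.

From mathcomp Require Import all_classical all_reals all_analysis.
Import numFieldNormedType.Exports.
Local Open Scope classical_set_scope.
Local Open Scope ring_scope.

(* A cubic with nonzero discriminant has only simple real roots. *)
Lemma cub_pos_near (R : realType) (p q u : R) (B : set R) : 4 * p ^+ 3 + 27 * q ^+ 2 != 0 ->
  0 <= cub p q u -> nbhs u B -> exists2 v, 0 < cub p q v & nbhs v B.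
Proof.
move=> disc0; rewrite le_eqVlt => /orP[/eqP fu|fu uB]; last by exists u.
pose g := 3 * u ^+ 2 + p.
have g0 : g != 0.
  apply: contra_neq disc0 => g0; have pE : p = - (3 * u ^+ 2) by rewrite -[RHS](addr0) -g0 /g; ring.
  have qE : q = - (u ^+ 3 + p * u) by rewrite -[RHS](addr0) fu /cub; ring.
  by rewrite qE pE; ring.
move=> uB; have [d /= d0 H] := (nbhs_normP _ _).1 (nbhs_interior uB).
pose h := Num.min (d / 2) (Num.min 1 (`|g| / (2 * (3 * `|u| + 1)))).
have n0 : 0 < 3 * `|u| + 1 by have := normr_ge0 u; lra.
have h0 : 0 < h.
  by rewrite !lt_min ltr01 /= !divr_gt0 ?normr_gt0 // mulr_gt0.
have hd : h < d by apply: le_lt_trans (_ : d / 2 < d); [rewrite ge_min lexx|lra].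
have h1 : h <= 1 by rewrite !ge_min lexx !orbT.
have hg : h * (3 * `|u| + 1) <= `|g| / 2.
  have : h <= `|g| / (2 * (3 * `|u| + 1)) by rewrite !ge_min lexx !orbT.
  by rewrite ler_pdivlMr ?mulr_gt0 //; lra.
have [s s1 sg] : exists2 s : R, `|s| = 1 & s * g = `|g|.
  case: (ltrP 0 g) => gs; [exists 1|exists (-1)]; rewrite ?normrN ?normr1 //.
    by rewrite mul1r gtr0_norm.
  by rewrite mulN1r ler0_norm.
have s2 : s * s = 1 by rewrite -expr2 -real_normK ?num_real // s1 expr1n.
exists (u + s * h).
  have -> : cub p q (u + s * h) = h * (`|g| + h * (3 * u + s * h)).
    rewrite -sg; transitivity (cub p q u + s * h * (g + 3 * u * (s * h) + (s * h) ^+ 2)).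
      by rewrite /cub /g; ring.
    rewrite -fu; transitivity (h * (s * g + (s * s) * h * (3 * u + s * h))); first by ring.
    by rewrite s2 mul1r.
  rewrite mulr_gt0 //; have gn : 0 < `|g| by rewrite normr_gt0.
  have : `|h * (3 * u + s * h)| <= h * (3 * `|u| + 1).
    rewrite normrM (gtr0_norm h0) ler_pM2l // (le_trans (ler_normD _ _)) // !normrM s1 mul1r.
    by rewrite (gtr0_norm h0) ger0_norm // lerD2l.
  rewrite ler_norml => /andP[]; lra.
by apply: H => /=; rewrite opprD addrA subrr sub0r normrN normrM s1 mul1r gtr0_norm.
Qed.

(** * Gaps between rational abscissas *)

Section Gaps.
Variables (R : realType) (p q : rat).
Hypothesis no_root : forall x : rat, cub p q x != 0.
Hypothesis unbounded : forall M, exists2 Q : rat * rat, on_cub p q Q & M < Q.1.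
Let f (x : R) := cub (ratr p) (ratr q) x.
Definition abscissa (x : R) := exists2 Q : rat * rat, on_cub p q Q & x = ratr Q.1.

Lemma abscissa_gt0 x : abscissa x -> 0 < f x.
Proof.
case=> Q oQ ->; rewrite /f -ratr_cub ltr0q lt_neqAle eq_sym no_root /=.
by rewrite -(eqP oQ) sqr_ge0.
Qed.

Lemma big_point (M : R) : exists2 Q : rat * rat, on_cub p q Q & M < ratr Q.1.
Proof.
have [Q oQ QM] := unbounded (Num.bound `|M|)%:R; exists Q => //.
apply: lt_trans (_ : (Num.bound `|M|)%:R < _); last by rewrite -(ratr_nat R) ltr_rat.
by apply: le_lt_trans (ler_norm M) _; apply: archi_boundP.
Qed.

Lemma cub_continuous : continuous f.
Proof.
move=> x; apply: cvgD; last exact: cvg_cst.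
by apply: cvgD; [exact: exprn_continuous|apply: cvgM; [exact: cvg_cst|exact: cvg_id]].
Qed.

Lemma chord_abscissa (A Q : rat * rat) (t : rat) : on_cub p q A -> on_cub p q Q ->
  A.1 != Q.1 -> t = Q.2 \/ t = - Q.2 ->
  abscissa (((Num.sqrt (f (ratr A.1)) + ratr t) / (ratr A.1 - ratr Q.1)) ^+ 2 - ratr A.1 - ratr Q.1).
Proof.
move=> oA oQ AQ tQ.
have sE : Num.sqrt (f (ratr A.1)) = ratr `|A.2| :> R.
  by rewrite /f -ratr_cub -(eqP oA) rmorphXn sqrtr_sqr -ratr_norm.
have oA' : on_cub p q (A.1, `|A.2|) by rewrite /on_cub /= real_normK ?num_real.
have oQ' : on_cub p q (Q.1, - t).
  by move: oQ; rewrite /on_cub /= sqrrN; case: tQ => ->; rewrite ?sqrrN.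
have S := chord_slope oA' oQ' AQ; exists (third (A.1, `|A.2|) (Q.1, - t) ((`|A.2| - - t) / (A.1 - Q.1))).
  exact: third_on oA' S.
by rewrite /third /= opprK sE !rmorphB (rmorphXn _ 2) fmorph_div rmorphD rmorphB.
Qed.

(* The displacements are those given by the sum and the difference with one fixed rational
   point of large abscissa. *)
Lemma displace (g e : R) : 0 < f g -> 0 < e ->
  \forall x \near g, abscissa x ->
    (exists2 y, abscissa y & g - e < y < g) /\ (exists2 y, abscissa y & g < y < g + e).
Proof.
move=> fg e0; pose s := Num.sqrt (f g).
have s0 : 0 < s by rewrite sqrtr_gt0.
have sE : s ^+ 2 = f g by rewrite sqr_sqrtr // ltW.
have [X0 H] := chord_moves s0 sE e0.
have [Q oQ QX] := big_point X0.
have Y0 : 0 < `|ratr Q.2| :> R.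
  rewrite normr_gt0 fmorph_eq0 -sqrf_eq0 (eqP oQ); exact: no_root.
have EY : `|ratr Q.2| ^+ 2 = f (ratr Q.1) :> R.
  by rewrite real_normK ?num_real // /f -ratr_cub -(eqP oQ) rmorphXn.
have [gQ l r] := H _ _ (ltW QX) Y0 EY.
(* For a fixed [Q] the displaced abscissa is continuous in [x], so the strict inequalities at [g]
   persist at the abscissas of rational points near [g]. *)
have ct (t : R) : (fun x => ((Num.sqrt (f x) + t) / (x - ratr Q.1)) ^+ 2 - x - ratr Q.1) @ g -->
    ((s + t) / (g - ratr Q.1)) ^+ 2 - g - ratr Q.1.
  apply: cvgB; last exact: cvg_cst.
  apply: cvgB; last exact: cvg_id.
  apply: (@cvg_comp _ _ _ (fun x => (Num.sqrt (f x) + t) / (x - ratr Q.1)) (fun z => z ^+ 2)); last exact: exprn_continuous.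
  apply: cvgM.
    apply: cvgD; last exact: cvg_cst.
    by apply: (@cvg_comp _ _ _ f Num.sqrt); [exact: cub_continuous|exact: sqrt_continuous].
  apply: cvgV; first by rewrite subr_eq0 lt_eqF.
  by apply: cvgB; [exact: cvg_id|exact: cvg_cst].
have [t tQ tE] : exists2 t, t = Q.2 \/ t = - Q.2 & ratr t = `|ratr Q.2| :> R.
  case: (leP 0 Q.2) => q0; [exists Q.2|exists (- Q.2)]; try by [left|right].
    by rewrite ger0_norm // ler0q.
  by rewrite rmorphN ltr0_norm // ltrq0.
have tQ' : - t = Q.2 \/ - t = - Q.2 by case: tQ => ->; rewrite ?opprK; [right|left].
case/andP: l => l1 l2; case/andP: r => r1 r2.
near=> x => -[A oA xA].
have AQ : A.1 != Q.1.
  apply: contraTneq (_ : x < ratr Q.1) => [AQ|]; first by rewrite xA AQ ltxx.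
  near: x; exact: lt_nbhsl.
split.
- exists (((Num.sqrt (f x) + ratr (- t)) / (x - ratr Q.1)) ^+ 2 - x - ratr Q.1).
    by rewrite xA; apply: chord_abscissa.
  rewrite rmorphN /= tE; apply/andP; split; near: x.
    exact: (cvgr_gt _ (ct _) _ l1).
  exact: (cvgr_lt _ (ct _) _ l2).
- exists (((Num.sqrt (f x) + ratr t) / (x - ratr Q.1)) ^+ 2 - x - ratr Q.1).
    by rewrite xA; apply: chord_abscissa.
  rewrite tE; apply/andP; split; near: x.
    exact: (cvgr_gt _ (ct _) _ r1).
  exact: (cvgr_lt _ (ct _) _ r2).
Unshelve. all: by end_near.
Qed.

Lemma abscissa_limit (g : R) :
  (forall d, 0 < d -> exists2 x, abscissa x & `|g - x| < d) -> 0 <= f g.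
Proof.
move=> H; rewrite leNgt; apply/negP => fg.
have /nbhs_normP[d /= d0 Hd] : \forall x \near g, f x < 0.
  exact: (cvgr_lt _ (@cub_continuous g) _ fg).
have [x xS xg] := H _ d0; have := abscissa_gt0 xS.
by rewrite ltNge ltW //; apply: Hd.
Qed.

(** The root is the infimum of the abscissas beyond the gap. Were the cubic positive there, a small
    displacement to the left of a nearby abscissa would land in the gap or below the infimum. *)
Lemma gap_right (l r A : R) : l < r -> (forall x, abscissa x -> ~ (l < x < r)) ->
  abscissa A -> r <= A -> exists g, [/\ r <= g, g <= A & f g = 0].
Proof.
move=> lr gap SA rA; pose E := [set x | abscissa x /\ r <= x].
have lE : has_lbound E by exists r => x [].
have iE : has_inf E by split=> //; exists A.
exists (inf E).
have rg : r <= inf E by apply: lb_le_inf => [|x []//]; exists A.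
have adh d : 0 < d -> exists2 x, abscissa x & `|inf E - x| < d.
  move=> d0; have [x Ex xd] := inf_adherent d0 iE; exists x; first by case: Ex.
  have := ge_inf lE Ex; rewrite distrC => gx; rewrite ger0_norm ?subr_ge0 //; lra.
split=> //; first exact: ge_inf.
apply/eqP; rewrite eq_le abscissa_limit // andbT leNgt; apply/negP => fg.
have e0 : 0 < inf E - l by lra.
have /nbhs_normP[d /= d0 Hd] := displace fg e0.
have [x xS xg] := adh _ d0; have [[y yS yI] _] := Hd x xg xS; move: yI; rewrite subKr => /andP[ly yg].
have [yr|ry] := ltP y r; first by apply: (gap y yS); rewrite ly.
by move: yg; rewrite ltNge ge_inf.
Qed.

Lemma gap_left (l r A : R) : l < r -> (forall x, abscissa x -> ~ (l < x < r)) ->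
  abscissa A -> A <= l -> exists g, [/\ A <= g, g <= l & f g = 0].
Proof.
move=> lr gap SA Al; pose E := [set x | abscissa x /\ x <= l].
have uE : has_ubound E by exists l => x [].
have sE : has_sup E by split=> //; exists A.
exists (sup E).
have gl : sup E <= l by apply: ge_sup => [|x []//]; exists A.
have adh d : 0 < d -> exists2 x, abscissa x & `|sup E - x| < d.
  move=> d0; have [x Ex xd] := sup_adherent d0 sE; exists x; first by case: Ex.
  have := ub_le_sup uE Ex => gx; rewrite ger0_norm ?subr_ge0 //; lra.
split=> //; first exact: ub_le_sup.
apply/eqP; rewrite eq_le abscissa_limit // andbT leNgt; apply/negP => fg.
have e0 : 0 < r - sup E by lra.
have /nbhs_normP[d /= d0 Hd] := displace fg e0.
have [x xS xg] := adh _ d0; have [_ [y yS yI]] := Hd x xg xS; move: yI; rewrite addrCA subrr addr0 => /andP[gy yr].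
have [ly|yl] := ltP l y; first by apply: (gap y yS); rewrite ly.
by move: gy; rewrite ltNge ub_le_sup.
Qed.

Lemma cub_low (M : R) : exists2 x, x < M & f x < 0.
Proof.
pose N := 1 + `|M| + `|ratr p : R| + `|ratr q : R|.
have h1 := normr_ge0 M; have h2 := normr_ge0 (ratr p : R); have h3 := normr_ge0 (ratr q : R).
exists (- N); first by have := ler_norm (- M); rewrite normrN /N; lra.
have N1 : 1 <= N by rewrite /N; lra.
have Np : `|ratr p| + `|ratr q| <= N - 1 by rewrite /N; lra.
have := ler_norm (- ratr p : R); have := ler_norm (ratr q : R); rewrite normrN /f /cub => q1 p1.
have a1 : - ratr p * N <= `|ratr p| * N by rewrite ler_wpM2r //; lra.
have a2 : ratr q <= `|ratr q| * N by apply: le_trans q1 _; rewrite ler_peMr.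
have a3 : (`|ratr p| + `|ratr q|) * N <= (N - 1) * N by rewrite ler_wpM2r //; lra.
have a4 : 0 < N ^+ 2 * (N - 1) + N by rewrite ltr_wpDl ?mulr_ge0 ?sqr_ge0 //; lra.
have -> : (- N) ^+ 3 = - (N ^+ 2 * (N - 1)) - N ^+ 2 by ring.
lra.
Qed.

Lemma root_below (x : R) : 0 < f x -> exists2 e, e < x & f e = 0.
Proof.
move=> fx; have [y yx fy] := cub_low x.
have [||c] := @IVT R f y x 0 (ltW yx).
- by apply: continuous_subspaceT; exact: cub_continuous.
- by rewrite ge_min le_max (ltW fy) (ltW fx) orbT.
rewrite in_itv /= => /andP[yc cx] fc; exists c => //.
by rewrite lt_neqAle cx andbT; apply: contraTneq fx => <-; rewrite fc ltxx.
Qed.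

Lemma three_roots (a b c x : R) : f a = 0 -> f b = 0 -> f c = 0 -> a < b -> b < c ->
  b < x -> x < c -> f x < 0.
Proof.
rewrite /f /cub => Ea Eb Ec ab bc bx xc.
have h1 : a ^+ 2 + a * b + b ^+ 2 + ratr p = 0.
  by apply: (@mulfI _ (a - b)); [rewrite subr_eq0 lt_eqF|rewrite mulr0 -[RHS](subrr 0) -{1}Ea -Eb; ring].
have h2 : a ^+ 2 + a * c + c ^+ 2 + ratr p = 0.
  by apply: (@mulfI _ (a - c)); [rewrite subr_eq0 lt_eqF //; lra|rewrite mulr0 -[RHS](subrr 0) -{1}Ea -Ec; ring].
have h3 : a + b + c = 0.
  apply: (@mulfI _ (b - c)); first by rewrite subr_eq0 lt_eqF.
  by rewrite mulr0 -[RHS](subrr 0) -{1}h1 -h2; ring.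
have pE : ratr p = - (a ^+ 2 + a * b + b ^+ 2) by rewrite -[RHS](addr0) -h1; ring.
have qE : ratr q = - a ^+ 3 - ratr p * a by rewrite -[RHS](addr0) -Ea; ring.
have cE : c = - a - b by rewrite -[RHS](addr0) -h3; ring.
have -> : x ^+ 3 + ratr p * x + ratr q = (x - a) * (x - b) * (x - c) by rewrite qE pE cE; ring.
by rewrite pmulr_rlt0 ?subr_lt0 // mulr_gt0 ?subr_gt0 //; lra.
Qed.

(** The ends of a gap produce roots of the cubic. A gap left of [A] gives roots a < g < e with [A]
    between the last two, and a gap right of [A] gives a < g < h with a point [t] of the gap between
    the last two; the cubic would be negative where it is positive. *)
Lemma abscissa_dense (A e l r : R) : abscissa A -> f e = 0 -> A < e -> l < r ->
  (forall x, l < x < r -> 0 < f x) -> exists2 x, abscissa x & l < x < r.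
Proof.
move=> SA fe Ae lr pos; apply: contrapT => H.
have gap x : abscissa x -> ~ (l < x < r) by move=> Sx lxr; apply: H; exists x.
have [t lt tr] : exists2 t, l < t & t < r by exists ((l + r) / 2); lra.
have ft : 0 < f t by apply: pos; rewrite lt.
have fA := abscissa_gt0 SA.
have nr x y : 0 < f x -> f y = 0 -> x != y.
  by move=> fx fy; apply: contraTneq fx => ->; rewrite fy ltxx.
have [rA|Ar] := leP r A.
  have [g [rg gA fg]] := gap_right lr gap SA rA.
  have [a at_ fa] := root_below ft.
  have gA' : g < A by rewrite lt_neqAle gA andbT eq_sym nr.
  have ag : a < g by lra.
  by have := three_roots fa fg fe ag (lt_trans gA' Ae) gA' Ae; rewrite ltNge (ltW fA).
have Al : A <= l by rewrite leNgt; apply/negP => lA; apply: (gap A SA); rewrite lA.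
have [g [Ag gl fg]] := gap_left lr gap SA Al.
have [Q oQ Qr] := big_point r.
have [h [rh _ fh]] := gap_right lr gap (ex_intro2 _ _ Q oQ erefl) (ltW Qr).
have [a aA fa] := root_below fA.
have ag : a < g by lra.
have gt : g < t by lra.
have th : t < h by lra.
by have := three_roots fa fg fh ag (lt_trans gt th) gt th; rewrite ltNge (ltW ft).
Qed.
End Gaps.

(** * The curve of 9-periodic points *)

Section Weierstrass.
Variables (F : numFieldType) (a : F).
Definition ck := (a - 1) * (a ^+ 2 - a + 1).
Definition onC (x y : F) := a * (x + 1) * (y + 1) * (x + y + a) - ck * x * y.
(* With s = x + y and m = mof x y, one has x y m = a (s + 1) (s + a); the Weierstrass
   coordinates are U = w_b / 3 - w_c / m and Y = w_c (x - y) / m, and vof U is 1 / m. *)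
Definition w_s := (ck - a ^+ 2) / a.
Definition w_c := 4 * (a - 1) ^+ 4 * (a ^+ 2 - a + 1) / a.
Definition w_b := w_s ^+ 2 + 4 * (2 * w_s + 1 + a).
Definition w_b1 := w_c * (2 * w_s + 4) / a.
Definition w_p := w_b1 - w_b ^+ 2 / 3.
Definition w_q := 2 * w_b ^+ 3 / 27 - w_b * w_b1 / 3 + w_c ^+ 2 / a ^+ 2.
Definition vof U := (w_b / 3 - U) / w_c.
Definition sof U := w_s - 1 / (a * vof U).
Definition xof U Y := (sof U + Y / (w_c * vof U)) / 2.
Definition yof U Y := (sof U - Y / (w_c * vof U)) / 2.

Lemma xof_addy U Y : xof U Y + yof U Y = sof U.
Proof. by rewrite /xof /yof; move: (Y / _) => d; field. Qed.

Hypotheses (a0 : a != 0) (a1 : a - 1 != 0) (a2 : a ^+ 2 - a + 1 != 0).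

Lemma w_c_neq0 : w_c != 0.
Proof. by rewrite /w_c !mulf_neq0 ?invr_neq0 ?pnatr_eq0 ?expf_neq0. Qed.
Lemma w_cE : w_c = 4 * a * (w_s + 1) * (w_s + a).
Proof. by rewrite /w_c /w_s /ck; field. Qed.
(** With V = 1 / m this is V^2 (x - y)^2 = V^2 ((x + y)^2 - 4 x y), where x + y = w_s - 1 / (a V)
    and x y = a V (x + y + 1)(x + y + a). *)
Definition phi V := (w_s * V - 1 / a) ^+ 2
  - 4 * a * V * ((w_s + 1) * V - 1 / a) * ((w_s + a) * V - 1 / a).
Lemma cub_phi V : cub w_p w_q (w_b / 3 - w_c * V) = w_c ^+ 2 * phi V.
Proof.
transitivity (w_c ^+ 2 * (- w_c * V ^+ 3 + w_b * V ^+ 2 - (2 * w_s + 4) / a * V + 1 / a ^+ 2)).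
  by rewrite /cub /w_p /w_q /w_b1; field.
by congr (_ * _); rewrite w_cE /w_b /phi; field.
Qed.
Lemma vofK U : w_b / 3 - w_c * vof U = U.
Proof. by have := w_c_neq0; rewrite /vof => c0; field. Qed.

Lemma onC_prod x y : onC x y = a * (x + y + 1) * (x + y + a) - x * y * (ck - a ^+ 2 - a * (x + y)).
Proof. by rewrite /onC; ring. Qed.

Lemma onC_of U Y : Y ^+ 2 = cub w_p w_q U -> vof U != 0 -> onC (xof U Y) (yof U Y) = 0.
Proof.
rewrite -{1}(vofK U) cub_phi; have c0 := w_c_neq0; rewrite /xof /yof /sof; move: (vof U) => V E V0.
rewrite onC_prod.
have E' : (Y / (w_c * V)) ^+ 2 = phi V / V ^+ 2 by rewrite expr_div_n E; field; rewrite c0 V0.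
have ckE : ck = a * w_s + a ^+ 2 by rewrite /w_s; field.
move: (Y / _) E' => d E'.
have -> : (w_s - 1 / (a * V) + d) / 2 * ((w_s - 1 / (a * V) - d) / 2) = ((w_s - 1 / (a * V)) ^+ 2 - d ^+ 2) / 4 by field; rewrite a0 V0.
have -> : (w_s - 1 / (a * V) + d) / 2 + ((w_s - 1 / (a * V) - d) / 2) = w_s - 1 / (a * V) by field; rewrite a0 V0.
by rewrite E' ckE /phi; field; rewrite a0 V0.
Qed.

Definition mof x y := ck - a ^+ 2 - a * (x + y).
Lemma mof_neq0 x y : onC x y = 0 -> mof x y != 0.
Proof.
rewrite onC_prod -/(mof x y) => E; apply/eqP => m0.
move: E; rewrite m0 mulr0 subr0 => /eqP; rewrite !mulf_eq0 (negbTE a0) /= => /orP[|] /eqP s.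
  have : (a - 1) ^+ 3 = 0.
    transitivity (mof x y + a * (x + y + 1)); first by rewrite /mof /ck; ring.
    by rewrite m0 s; ring.
  by move/eqP; rewrite expf_eq0 (negbTE a1).
have : ck = 0.
  transitivity (mof x y + a * (x + y + a)); first by rewrite /mof /ck; ring.
  by rewrite m0 s; ring.
by move/eqP; rewrite mulf_eq0 (negbTE a1) (negbTE a2).
Qed.

Lemma weierstrass x y : onC x y = 0 -> exists U Y,
  [/\ Y ^+ 2 = cub w_p w_q U, vof U = 1 / mof x y, x = xof U Y & y = yof U Y].
Proof.
move=> E; have m0 := mof_neq0 E; have c0 := w_c_neq0.
exists (w_b / 3 - w_c * (1 / mof x y)), (w_c * (x - y) / mof x y).
have vE : vof (w_b / 3 - w_c * (1 / mof x y)) = 1 / mof x y by rewrite /vof; field; rewrite c0 m0.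
have sE : w_s - 1 / (a * (1 / mof x y)) = x + y by rewrite /w_s /mof; field; rewrite a0 m0.
split.
- rewrite cub_phi; have pE : x * y * mof x y = a * (x + y + 1) * (x + y + a).
    by move: E; rewrite onC_prod -/(mof x y) => /eqP; rewrite subr_eq0 => /eqP ->.
  have d2 : (x - y) ^+ 2 = (x + y) ^+ 2 - 4 * (a * (x + y + 1) * (x + y + a)) / mof x y.
    by rewrite -pE; field.
  rewrite expr_div_n exprMn d2; have {}sE : w_s = x + y + mof x y / a by rewrite /w_s /mof; field.
  by rewrite /phi sE; field; rewrite a0 m0.
- exact: vE.
- by rewrite /xof /sof vE sE; field; rewrite c0 m0.
- by rewrite /yof /sof vE sE; field; rewrite c0 m0.
Qed.

Lemma onC_sym x y : onC x y = onC y x.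
Proof. by rewrite /onC; ring. Qed.
Lemma onC_step x y : x != 0 -> onC x y = 0 -> onC y ((a + y) / x) = 0.
Proof.
move=> x0 E; transitivity (onC x y * (a + y) / x ^+ 2); last by rewrite E !mul0r.
by rewrite /onC /ck; field.
Qed.

Lemma onC_Na x y : onC x y = 0 -> x = - a -> y = 0 \/ y = a ^+ 2 - a.
Proof.
move=> E xE; have /eqP : a * y * (1 - a) * (y - (a ^+ 2 - a)) = 0.
  by rewrite -E xE /onC /ck; ring.
by rewrite !mulf_eq0 (negbTE a0) -opprB oppr_eq0 (negbTE a1) orbF subr_eq0 => /orP[]/eqP; [left|right].
Qed.
Lemma onC_step_Na x y : onC x y = 0 -> x != 0 -> y != 0 -> (a + y) / x = - a -> x = - a.
Proof.
move=> E x0 y0 z.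
have yE : y = - a * (x + 1).
  by transitivity ((a + y) / x * x - a); [field|rewrite z; ring].
have x10 : x + 1 != 0 by apply: contraNneq y0 => x1; rewrite yE x1 mulr0.
have /eqP : a ^+ 2 * (x + 1) * x * (a - 1) * (x + a) = 0.
  by rewrite -E yE /onC /ck; ring.
by rewrite !mulf_eq0 (negbTE x0) (negbTE x10) (negbTE a1) (negbTE a0) /= addr_eq0 => /eqP.
Qed.
Lemma onC_N1 y : onC (-1) y = 0 -> y = 0.
Proof.
move=> E; have /eqP : ck * y = 0 by rewrite -E /onC; ring.
by rewrite /ck !mulf_eq0 (negbTE a1) (negbTE a2) => /eqP.
Qed.
Lemma onC_x0 x y : onC x y = 0 -> x * y = 0 -> x + y = -1 \/ x + y = - a.
Proof.
rewrite onC_prod => E xy; move: E; rewrite xy mul0r subr0 => /eqP.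
by rewrite !mulf_eq0 (negbTE a0) /= !addr_eq0 => /orP[]/eqP; [left|right].
Qed.

(** Chosen to be stable under the recurrence: [y != - a] makes the new term nonzero, and by
    [onC_step_Na] the condition [x != - a] keeps it from being - a. *)
Definition good x y := [/\ onC x y = 0, x != 0, y != 0, x != - a & y != - a].
Lemma good_step x y : good x y -> good y ((a + y) / x).
Proof.
case=> E x0 y0 xa ya; split=> //; first exact: onC_step.
  by rewrite mulf_neq0 ?invr_neq0 // addrC addr_eq0.
by apply: contraNneq xa => z; rewrite (onC_step_Na E x0 y0 z).
Qed.
(** A zero coordinate forces the sum -1 or - a, and a coordinate - a forces the other to be 0 or a^2
    - a. *)
Lemma good_sum x y : onC x y = 0 -> x + y != -1 -> x + y != - a -> x + y != a ^+ 2 - 2 * a -> good x y.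
Proof.
move=> E s1 s2 s3.
have xy : x * y != 0 by apply/eqP => /(onC_x0 E)[/eqP|/eqP]; apply/negP.
have [x0 y0] : x != 0 /\ y != 0 by move: xy; rewrite mulf_eq0 negb_or => /andP.
split=> //; apply/eqP => H.
  case: (onC_Na E H) => y'; first by rewrite y' eqxx in y0.
  by move/eqP: s3; apply; rewrite H y'; ring.
rewrite onC_sym in E; case: (onC_Na E H) => y'; first by rewrite y' eqxx in x0.
by move/eqP: s3; apply; rewrite H y'; ring.
Qed.

End Weierstrass.

(** * Nine-periodic sequences and the curve *)

Section Sequences.
Variables (F : numFieldType) (a : F).
Hypothesis a2 : a ^+ 2 - a + 1 != 0.

Definition num5 (u v : F) := u * (a ^+ 2 * v + a * v ^+ 2 + a * u * v + a * u + a + v).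
Definition den5 (u v : F) := (a + v) * (a * u + a + v).

(* For consecutive terms u, v of a sequence, num5 u v / den5 u v is the fifth term after u and
   num5 v u / den5 v u the fourth before it, so this is the identity behind period 9. *)
Lemma fifth_diff u v : (u - v) * onC a u v * (u + v + a) =
  num5 u v * den5 v u - num5 v u * den5 u v.
Proof. by rewrite /onC /ck /num5 /den5; ring. Qed.

Lemma fifth_term (z0 z1 z2 z3 z4 z5 : F) : z0 != 0 -> z1 != 0 -> z2 != 0 -> z3 != 0 ->
  z0 * z2 = a + z1 -> z1 * z3 = a + z2 -> z2 * z4 = a + z3 -> z3 * z5 = a + z4 ->
  den5 z0 z1 != 0 /\ z5 * den5 z0 z1 = num5 z0 z1.
Proof.
move=> h0 h1 h2 h3 e2 e3 e4 e5.
have d1 : a + z1 = z0 * z2 by rewrite e2.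
have d2 : a * z0 + a + z1 = z0 * z1 * z3.
  by transitivity (z0 * (z1 * z3)); [rewrite e3 mulrDr e2|]; ring.
have D : den5 z0 z1 = z0 ^+ 2 * z1 * (z2 * z3) by rewrite /den5 d1 d2; ring.
split; first by rewrite D !mulf_neq0 // expf_neq0.
have E5 : z5 * (z2 * z3) = a * z2 + a + z3.
  by transitivity (z2 * (z3 * z5)); [ring|rewrite e5 mulrDr e4]; ring.
transitivity (z0 * (z1 * (z0 * z2) * a + a * z0 * z1 + z0 * (z1 * z3))).
  by rewrite D; transitivity (z0 ^+ 2 * z1 * (z5 * (z2 * z3))); [|rewrite E5]; ring.
by rewrite e2 e3 /num5; transitivity (z0 * (z1 * (a + z1) * a + a * z0 * z1 + (z0 * a + z0 * z2))); [|rewrite e2]; ring.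
Qed.

Section Orbit.
Variable x : nat -> F.
Hypothesis Lx : is_lyness a x.
Let x0 n : x n != 0. Proof. by case: (Lx n). Qed.
Let xM n : x n * x n.+2 = a + x n.+1.
Proof. by case: (Lx n) => h ->; rewrite mulrC divfK. Qed.
Let xM' n : x n.+2 * x n = a + x n.+1. Proof. by rewrite mulrC xM. Qed.

(** The recurrence is reversible, so [fifth_term] runs five steps forward from index n + 4 and five
    steps backward from index n + 5, meeting [fifth_diff] in the middle. *)
Lemma shift9 n : (x n.+4 - x n.+4.+1) * onC a (x n.+4) (x n.+4.+1) * (x n.+4 + x n.+4.+1 + a) = 0 <->
  x (n + 9)%N = x n.
Proof.
rewrite !addnS addn0 fifth_diff.
have [d1 e1] := fifth_term (x0 n.+4) (x0 n.+4.+1) (x0 n.+4.+2) (x0 n.+4.+3) (xM _) (xM _) (xM _) (xM _).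
have [d2 e2] := fifth_term (x0 n.+4.+1) (x0 n.+4) (x0 n.+3) (x0 n.+2) (xM' _) (xM' _) (xM' _) (xM' _).
split=> H; last by rewrite -e1 -e2 H; ring.
apply: (mulIf (mulf_neq0 d1 d2)); apply/eqP; rewrite -subr_eq0; apply/eqP.
by rewrite -[RHS]H -e1 -e2; ring.
Qed.

Lemma onC_forward n i : onC a (x n) (x n.+1) = 0 -> onC a (x (n + i)%N) (x (n + i).+1) = 0.
Proof.
move=> E; elim: i => [|i IH]; first by rewrite addn0.
by rewrite addnS; case: (Lx (n + i)) => _ ->; apply: onC_step.
Qed.

Hypothesis per : forall n, x (n + 9)%N = x n.
Let perM n k : x (n + 9 * k)%N = x n.
Proof. by elim: k => [|k IH]; rewrite ?addn0 // mulnS addnCA addnC per. Qed.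

Lemma period3 j : (0 < j < 9)%N -> (forall n, x (n + j)%N = x n) -> forall n, x (n + 3)%N = x n.
Proof.
move=> j9 H n; have HM k : x (n + k * j)%N = x n.
  by elim: k => [|k IH]; rewrite ?addn0 // mulSn addnA addnAC H.
have [k [i kE]] : exists k i, (k * j = 3 + 9 * i)%N.
  case: j j9 {H HM} => [|[|[|[|[|[|[|[|[|j]]]]]]]]] //= _.
  - by exists 3, 0.
  - by exists 6, 1.
  - by exists 1, 0.
  - by exists 3, 1.
  - by exists 6, 3.
  - by exists 2, 1.
  - by exists 3, 2.
  - by exists 6, 5.
by rewrite -(HM k) kE addnA perM.
Qed.

(** If the factor u + v + a vanishes, every third term is obtained by the Moebius map t -> (1 - a) /
    (t + a), whose third iterate fixes the starting term. Unless a^2 - a + 1 = 0 the map does not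
    have order 3, so the term is already fixed and the sequence has period 3. *)
Lemma not_const_onC : ~ (forall n, x (n + 1)%N = x n) -> ~ (forall n, x (n + 3)%N = x n) ->
  onC a (x 0%N) (x 1%N) = 0.
Proof.
move=> n1 n3.
have key n : x n = x n.+1 \/ onC a (x n) (x n.+1) = 0.
  have := (shift9 (n + 5)).2 (per _).
  have -> : (n + 5).+4 = (n + 9)%N by lia.
  have -> : (n + 9).+1 = (n.+1 + 9)%N by lia.
  rewrite !per => /eqP; rewrite !mulf_eq0 => /orP[/orP[|]|] /eqP H; [|by right|].
    by left; apply/eqP; rewrite -subr_eq0 H.
  have E k : x k + x k.+1 + a = 0 -> [/\ x k + a != 0, x k.+3 = (1 - a) / (x k + a) & x k.+3 + x k.+4 + a = 0].
    move=> S; have S1 : x k.+1 = - (x k + a) by rewrite -[LHS](subr0) -S; ring.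
    have h1 : x k + a != 0 by have := x0 k.+1; rewrite S1 oppr_eq0.
    have x2 : x k.+2 = -1.
      by case: (Lx k) => xk ->; rewrite S1; field.
    have x3 : x k.+3 = (1 - a) / (x k + a).
      by case: (Lx k.+1) => xk ->; rewrite x2 S1; field.
    by split=> //; case: (Lx k.+2) => _ ->; rewrite x2 invrN1; ring.
  have [h1 e1 S1] := E _ H; have [h2 e2 S2] := E _ S1; have [h3 e3 S3] := E _ S2.
  have e4 : x n.+4.+4.+1 = x n by rewrite -(per n) !addnS addn0.
  rewrite e4 in e3; have c1 : x n.+3 * (x n + a) = 1 - a by rewrite e1 divfK.
  have c2 : x n.+3.+3 * (x n.+3 + a) = 1 - a by rewrite e2 divfK.
  have c3 : x n * (x n.+3.+3 + a) = 1 - a by rewrite {1}e3 divfK.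
  have t3 : x n.+3 = x n.
    move: c1 c2 c3 h1; move: (x n.+3.+3) (x n.+3) (x n) => v u t c1 c2 c3 h1.
    apply: (mulIf h1); apply: (mulIf a2); apply/eqP; rewrite -subr_eq0; apply/eqP.
    transitivity (((t * (v + a) - (1 - a)) * (u + a) - t * (v * (u + a) - (1 - a))
       ) * - (t + a)
      + (u * (t + a) - (1 - a)) * (a ^+ 2 - a + 1 + a * t - (1 - a))); first by ring.
    by rewrite c1 c2 c3; ring.
  have t4 : x n.+4 = x n.+1.
    by apply: (addrI (x n + a)); rewrite -{1}t3 addrAC S1 -H; ring.
  exfalso; apply: n3 => m.
  have P i : x (n + i).+3 = x (n + i)%N /\ x (n + i).+4 = x (n + i).+1.
    elim: i => [|i [I1 I2]]; first by rewrite addn0.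
    rewrite addnS; split=> //; case: (Lx (n + i).+3) => _ ->; case: (Lx (n + i)) => _ ->.
    by rewrite I1 I2.
  rewrite -(perM (m + 3) n) -(perM m n).
  have -> : (m + 3 + 9 * n = (n + (m + 8 * n)).+3)%N by lia.
  have -> : (m + 9 * n = n + (m + 8 * n))%N by lia.
  by case: (P (m + 8 * n)%N).
have [n [nE]] : exists n, x n <> x n.+1 /\ onC a (x n) (x n.+1) = 0.
  have [//|H] := pselect (exists n, x n <> x n.+1 /\ onC a (x n) (x n.+1) = 0).
  case: n1 => n; rewrite addn1; case: (key n) => // E; apply: contrapT => ne.
  by apply: H; exists n; split=> // e; apply: ne.
move=> /(onC_forward (n := n)) E; have := E (8 * n)%N.
(* The relation is carried forward to a multiple of 9, where the terms are those at 0 and 1. *)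
have -> : (n + 8 * n = 0 + 9 * n)%N by lia.
by rewrite -addSn !perM.
Qed.
End Orbit.
End Sequences.

Lemma sqr_subD1_neq0 (F : realFieldType) (a : F) : a ^+ 2 - a + 1 != 0.
Proof. by rewrite gt_eqF //; have := sqr_ge0 (a - 1 / 2); lra. Qed.

Lemma lyness9_onC (F : realFieldType) (a : F) p :
  lyness_periodic a 9 p -> onC a p.1 p.2 = 0.
Proof.
move=> [x [<- <- Lx [_ per prime]]]; have a2 := sqr_subD1_neq0 a.
by apply: (not_const_onC a2 Lx per); [exact: (prime 1%N)|exact: (prime 3%N)].
Qed.

(** * Rational points of the curve give period nine *)

Section Rational.
Variable a : rat.
Hypotheses (a0 : a != 0) (a1 : a - 1 != 0).
Let a2 := sqr_subD1_neq0 a.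

Lemma onC_diag x : onC a x x <> 0.
Proof.
move=> E; have x0 : x != 0.
  apply/eqP => x0; move/eqP: E; rewrite x0 /onC !mulr0 subr0 !add0r !mulr1.
  by rewrite mulf_eq0 (negbTE a0).
(* A quadratic equation for a, whose discriminant is the sextic of hpoly_sqr. *)
have Q : (1 / x + 1 / a) * a ^+ 2 - ((1 / x + 1 / a) ^+ 3 + 2 * (1 / x + 1 / a) ^+ 2
    + 3 * (1 / x + 1 / a) + 1) * a + (1 / x + 1 / a + 1) ^+ 2 = 0.
  transitivity (- onC a x x / (a * x ^+ 3)); last by rewrite E oppr0 mul0r.
  by rewrite /onC /ck; field; rewrite x0 a0.
move: (1 / x + 1 / a) Q => l Q.
have /hpoly_sqr H : (2 * l * a - (l ^+ 3 + 2 * l ^+ 2 + 3 * l + 1)) ^+ 2 =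
    l ^+ 6 + 4 * l ^+ 5 + 10 * l ^+ 4 + 10 * l ^+ 3 + 5 * l ^+ 2 + 2 * l + 1.
  transitivity (4 * l * (l * a ^+ 2 - (l ^+ 3 + 2 * l ^+ 2 + 3 * l + 1) * a + (l + 1) ^+ 2)
    + (l ^+ 6 + 4 * l ^+ 5 + 10 * l ^+ 4 + 10 * l ^+ 3 + 5 * l ^+ 2 + 2 * l + 1)); first by ring.
  by rewrite Q mulr0 add0r.
move/eqP: a1; apply; case: H => lE; rewrite lE in Q.
  by rewrite -[RHS]oppr0 -Q; ring.
by apply: (mulfI a0); rewrite mulr0 -[RHS]oppr0 -Q; ring.
Qed.

(** A shorter period would give period 3, and the difference of two recurrence relations is then
    (z_n + 1)(z_(n+1) - z_(n+2)) = 0. On the curve -1 is followed by 0, so two consecutive terms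
    agree, against [onC_diag]. *)
Lemma good_periodic x y : good a x y -> lyness_periodic a 9 (x, y).
Proof.
move=> g0; pose orb n := iter n (fun p : rat * rat => (p.2, (a + p.2) / p.1)) (x, y).
have g n : good a (orb n).1 (orb n).2 by elim: n => //= n; apply: good_step.
pose z n := (orb n).1.
have Lz : is_lyness a z by move=> n; case: (g n) => _ h _ _ _; split.
have zC n : onC a (z n) (z n.+1) = 0 by case: (g n).
exists z; split=> //.
have per n : z (n + 9)%N = z n by apply/(shift9 Lz); rewrite zC mulr0 mul0r.
split=> // j j9 /(period3 per j9) p3.
have N1 n : z n != -1.
  apply/eqP => zn; have := zC n; rewrite zn => /(onC_N1 a1 a2) H.
  by case: (Lz n.+1); rewrite H eqxx.
have zM n : z n * z n.+2 = a + z n.+1.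
  by case: (Lz n) => h ->; rewrite mulrC divfK.
have eqS n : z n.+1 = z n.+2.
  have := zM n.+1; have -> : z n.+3 = z n by rewrite -(p3 n) addnC.
  move=> e2; have e1 := zM n; apply/eqP; rewrite -subr_eq0.
  have : (z n + 1) * (z n.+1 - z n.+2) == 0.
    apply/eqP; transitivity ((z n.+1 * z n - (a + z n.+2)) - (z n * z n.+2 - (a + z n.+1))); first by ring.
    by rewrite e1 e2 !subrr.
  by rewrite mulf_eq0 (addr_eq0 (z n)) (negbTE (N1 n)).
by have := zC 1%N; rewrite -eqS; apply: onC_diag.
Qed.

Lemma w_no_root U : cub (w_p a) (w_q a) U != 0.
Proof.
have c0 := w_c_neq0 a0 a1 a2.
apply/eqP => E; have V0 : vof a U != 0.
  apply/eqP => V0; move: E; rewrite -(vofK a0 a1 a2 U) V0 cub_phi // => /eqP.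
  by rewrite mulf_eq0 expf_eq0 (negbTE c0) /phi !mulr0 sub0r mul0r mul0r subr0 sqrf_eq0 oppr_eq0 mulf_eq0 oner_eq0 invr_eq0 (negbTE a0).
have := onC_of a0 a1 a2 (U := U) (Y := 0); rewrite expr0n E => /(_ erefl V0).
by rewrite /xof /yof !mul0r oppr0 !addr0; apply: onC_diag.
Qed.
End Rational.

Section Ratr.
Variables (F : numFieldType) (a : rat).
Lemma ratr_ck : ratr (ck a) = ck (ratr a) :> F.
Proof. by rewrite /ck (rmorphM _ (a - 1)) !rmorphD !rmorphN (rmorphXn _ 2) rmorph1. Qed.
Lemma ratr_w_s : ratr (w_s a) = w_s (ratr a) :> F.
Proof. by rewrite /w_s fmorph_div rmorphD rmorphN (rmorphXn _ 2) /= ratr_ck. Qed.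
Lemma ratr_w_c : ratr (w_c a) = w_c (ratr a) :> F.
Proof.
rewrite /w_c fmorph_div (rmorphM _ (4 * (a - 1) ^+ 4)) (rmorphM _ 4) rmorph_nat (rmorphXn _ 4).
by rewrite !rmorphD !rmorphN (rmorphXn _ 2) rmorph1.
Qed.
Lemma ratr_w_b : ratr (w_b a) = w_b (ratr a) :> F.
Proof.
rewrite /w_b rmorphD (rmorphXn _ 2) (rmorphM _ 4) !rmorphD (rmorphM _ 2) !rmorph_nat rmorph1 /=.
by rewrite ratr_w_s.
Qed.
Lemma ratr_w_b1 : ratr (w_b1 a) = w_b1 (ratr a) :> F.
Proof.
rewrite /w_b1 fmorph_div (rmorphM _ (w_c a)) rmorphD (rmorphM _ 2) !rmorph_nat /=.
by rewrite ratr_w_s ratr_w_c.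
Qed.
Lemma ratr_w_p : ratr (w_p a) = w_p (ratr a) :> F.
Proof.
rewrite /w_p -ratr_w_b -ratr_w_b1; move: (w_b a) (w_b1 a) => b b1.
by rewrite rmorphD rmorphN fmorph_div (rmorphXn _ 2) rmorph_nat.
Qed.
Lemma ratr_w_q : ratr (w_q a) = w_q (ratr a) :> F.
Proof.
rewrite /w_q -ratr_w_b -ratr_w_b1 -ratr_w_c; move: (w_b a) (w_b1 a) (w_c a) => b b1 c.
rewrite !rmorphD rmorphN !fmorph_div (rmorphM _ 2) (rmorphM _ b b1).
by rewrite (rmorphXn _ 3) !(rmorphXn _ 2) !rmorph_nat.
Qed.
Lemma ratr_vof U : ratr (vof a U) = vof (ratr a) (ratr U) :> F.
Proof. by rewrite /vof fmorph_div rmorphD rmorphN fmorph_div rmorph_nat /= ratr_w_b ratr_w_c. Qed.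
Lemma ratr_sof U : ratr (sof a U) = sof (ratr a) (ratr U) :> F.
Proof.
rewrite /sof -ratr_vof -ratr_w_s; move: (w_s a) (vof a U) => s v.
by rewrite rmorphD rmorphN fmorph_div rmorph1 (rmorphM _ a).
Qed.
Lemma ratr_xof U Y : ratr (xof a U Y) = xof (ratr a) (ratr U) (ratr Y) :> F.
Proof.
rewrite /xof -ratr_sof -ratr_vof -ratr_w_c; move: (sof a U) (vof a U) (w_c a) => s v c.
by rewrite fmorph_div rmorphD fmorph_div (rmorphM _ c) rmorph_nat.
Qed.
Lemma ratr_yof U Y : ratr (yof a U Y) = yof (ratr a) (ratr U) (ratr Y) :> F.
Proof.
rewrite /yof -ratr_sof -ratr_vof -ratr_w_c; move: (sof a U) (vof a U) (w_c a) => s v c.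
by rewrite fmorph_div rmorphD rmorphN fmorph_div (rmorphM _ c) rmorph_nat.
Qed.
Lemma ratr_onC x y : ratr (onC a x y) = onC (ratr a) (ratr x) (ratr y) :> F.
Proof.
rewrite /onC rmorphD rmorphN (rmorphM _ (ck a * x)) (rmorphM _ (ck a)) (rmorphM _ (a * (x + 1) * (y + 1))).
by rewrite (rmorphM _ (a * (x + 1))) (rmorphM _ a) !rmorphD rmorph1 /= ratr_ck.
Qed.
End Ratr.

Section Positive.
Variables (a x y : rat).
Hypotheses (a_gt0 : 0 < a) (x0 : 0 < x) (y0 : 0 < y) (E : onC a x y = 0).

Lemma a_neq1 : a - 1 != 0.
Proof.
apply/eqP => a1; move: E; rewrite /onC /ck a1 !mul0r subr0 => /eqP.
by rewrite gt_eqF // !mulr_gt0 // !addr_gt0.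
Qed.
Let a0 : a != 0. Proof. by rewrite gt_eqF. Qed.
Let a1 := a_neq1.
Let a2 := sqr_subD1_neq0 a.

Lemma w_c_gt0 : 0 < w_c a.
Proof.
rewrite /w_c divr_gt0 // mulr_gt0 //; first by rewrite mulr_gt0 // exprn_even_gt0.
by have := sqr_ge0 (a - 1 / 2); lra.
Qed.

Lemma mof_gt0 : 0 < mof a x y.
Proof.
have := E; rewrite onC_prod -/(mof a x y) => /eqP; rewrite subr_eq0 => /eqP H.
by rewrite -(pmulr_rgt0 _ (mulr_gt0 x0 y0)) -H !mulr_gt0 // !addr_gt0.
Qed.

(* The cubic is negative at the abscissa U0 corresponding to x + y = 0. *)
Lemma root_right (R : realType) : exists P (e : R), [/\ on_cub (w_p a) (w_q a) P,
  cub (ratr (w_p a)) (ratr (w_q a)) e = 0 & ratr P.1 < e].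
Proof.
have [U [Y [EU VU _ _]]] := weierstrass a0 a1 a2 E.
pose V0 := 1 / (ck a - a ^+ 2); pose U0 := w_b a / 3 - w_c a * V0.
have m0 := mof_gt0; have c0 := w_c_gt0.
have mM : mof a x y < ck a - a ^+ 2.
  by rewrite /mof gtrBl mulr_gt0 // addr_gt0.
have V00 : 0 < V0 by rewrite /V0 div1r invr_gt0 (lt_trans m0).
have UU0 : U < U0.
  rewrite -(vofK a0 a1 a2 U) VU /U0 ltrD2l ltrN2 ltr_pM2l // /V0 !div1r ltf_pV2 ?posrE //.
  exact: lt_trans m0 mM.
have fU0 : cub (w_p a) (w_q a) U0 < 0.
  rewrite /U0 cub_phi // pmulr_rlt0 ?exprn_gt0 //.
  have -> : phi a V0 = - (4 * a ^+ 2 * V0 ^+ 3).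
    have k0 : ck a - a ^+ 2 != 0 by rewrite gt_eqF // (lt_trans m0).
    by rewrite /phi /w_s /V0; field; rewrite a0 k0.
  have h1 : 0 < a ^+ 2 by apply: exprn_gt0.
  have h2 : 0 < V0 ^+ 3 by apply: exprn_gt0.
  by rewrite oppr_lt0; apply: mulr_gt0 h2; apply: mulr_gt0 h1.
have fb : 0 < cub (w_p a) (w_q a) (w_b a / 3).
  have := cub_phi a0 0; rewrite mulr0 subr0 => ->.
  rewrite /phi !mulr0 !sub0r !mul0r subr0 sqrrN mulr_gt0 ?exprn_gt0 //.
  by rewrite div1r invr_gt0.
have Ub : U0 <= w_b a / 3 by rewrite /U0 gerBl; apply: mulr_ge0; exact: ltW.
have [|||e] := @IVT R (fun x => cub (ratr (w_p a)) (ratr (w_q a)) x) (ratr U0) (ratr (w_b a / 3)) 0.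
- by rewrite ler_rat.
- by apply: continuous_subspaceT; exact: cub_continuous.
- have h1 : cub (ratr (w_p a)) (ratr (w_q a)) (ratr U0) <= 0 :> R by rewrite -ratr_cub lerq0 ltW.
  have h2 : 0 <= cub (ratr (w_p a)) (ratr (w_q a)) (ratr (w_b a / 3)) :> R by rewrite -ratr_cub ler0q ltW.
  by rewrite ge_min le_max h1 h2 orbT.
rewrite in_itv /= => /andP[eU _] e0; exists (U, Y), e; split=> //; first by rewrite /on_cub /= EU.
by apply: lt_le_trans eU; rewrite ltr_rat.
Qed.
End Positive.

(** * Infinitude and density on the curve *)

Section Density.
Variables (R : realType) (a x y : rat).
Hypotheses (a_gt0 : 0 < a) (x0 : 0 < x) (y0 : 0 < y) (E : onC a x y = 0).
Let a0 : a != 0. Proof. by rewrite gt_eqF. Qed.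
Let a1 : a - 1 != 0 := a_neq1 a_gt0 x0 y0 E.
Let a2 := sqr_subD1_neq0 a.
Let no_root := w_no_root a0 a1.
Let f (u : R) := cub (ratr (w_p a)) (ratr (w_q a)) u.

Lemma w_unbounded M : exists2 Q : rat * rat, on_cub (w_p a) (w_q a) Q & M < Q.1.
Proof.
have [P [e [oP e0 Pe]]] := root_right a_gt0 x0 y0 E R.
exact: (curve_unbounded no_root (curve_infinite no_root oP e0 Pe)).
Qed.

Lemma w_dense (l r : R) : l < r -> (forall u, l < u < r -> 0 < f u) ->
  exists2 u, abscissa (w_p a) (w_q a) u & l < u < r.
Proof.
have [P [e [oP e0 Pe]]] := root_right a_gt0 x0 y0 E R.
by apply: (abscissa_dense no_root w_unbounded _ e0 Pe); exists P.
Qed.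

Lemma w_dense_avoid (s : seq rat) (l r : R) : l < r -> (forall u, l < u < r -> 0 < f u) ->
  exists Q, [/\ on_cub (w_p a) (w_q a) Q, l < ratr Q.1 < r & Q.1 \notin s].
Proof.
elim: s l r => [|v s IH] l r lr pos.
  by have [_ [Q oQ ->] H] := w_dense lr pos; exists Q.
have [/andP[lv vr]|vlr] := boolP (l < ratr v < r).
  have [|Q [oQ /andP[lQ Qv] Qs]] := IH l (ratr v) lv.
    by move=> u /andP[lu uv]; apply: pos; rewrite lu (lt_trans uv).
  exists Q; split=> //; first by rewrite lQ (lt_trans Qv).
  by rewrite inE negb_or Qs andbT; apply: contraTneq Qv => ->; rewrite ltxx.
have [Q [oQ lQr Qs]] := IH l r lr pos; exists Q; split=> //.
by rewrite inE negb_or Qs andbT; apply: contraNneq vlr => <-.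
Qed.

Lemma w_dense_nbhs (s : seq rat) (u : R) (B : set R) : 0 < f u -> nbhs u B ->
  exists Q, [/\ on_cub (w_p a) (w_q a) Q, B (ratr Q.1) & Q.1 \notin s].
Proof.
move=> fu uB; have : \forall v \near u, 0 < f v /\ B v.
  near=> v; split; near: v; last exact: uB.
  exact: (cvgr_gt _ (@cub_continuous R (w_p a) (w_q a) u) _ fu).
case/nbhs_normP => d /= d0 H.
have [||Q [oQ /andP[lQ Qr] Qs]] := @w_dense_avoid s (u - d) (u + d).
- by lra.
- move=> v /andP[lv vr]; case: (H v) => //=.
  by rewrite ltr_norml; apply/andP; split; lra.
exists Q; split=> //; case: (H (ratr Q.1)) => //=.
by rewrite ltr_norml; apply/andP; split; lra.
Unshelve. all: by end_near.
Qed.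

Definition u_of_s s := w_b a / 3 - w_c a / (a * (w_s a - s)).
(** The first abscissa has [vof] equal to 0, where [xof] and [yof] divide by zero; the others carry
    the three sums excluded in [good_sum]. *)
Definition bad_us := [:: w_b a / 3; u_of_s (-1); u_of_s (- a); u_of_s (a ^+ 2 - 2 * a)].

Lemma sofP u s : vof a u != 0 -> sof a u = s -> u = u_of_s s.
Proof.
move=> v0 <-; rewrite /u_of_s /sof -{1}(vofK a0 a1 a2 u); congr (_ - _).
move: (w_c a) (w_s a) (vof a u) v0 => c s' v v0.
rewrite (_ : s' - (s' - 1 / (a * v)) = 1 / (a * v)); last by ring.
by field; rewrite v0 a0.
Qed.

Lemma good_of u t : t ^+ 2 = cub (w_p a) (w_q a) u -> u \notin bad_us ->
  vof a u != 0 /\ good a (xof a u t) (yof a u t).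
Proof.
move=> tE; rewrite !inE !negb_or => /and4P[b1 b2 b3 b4].
have v0 : vof a u != 0.
  by apply: contraNneq b1 => v0; rewrite -(vofK a0 a1 a2 u) v0 mulr0 subr0.
split=> //; apply: (good_sum a0 a1 (onC_of a0 a1 a2 tE v0)); rewrite xof_addy.
- by apply: contraNneq b2 => H; rewrite (sofP v0 H).
- by apply: contraNneq b3 => H; rewrite (sofP v0 H).
- by apply: contraNneq b4 => H; rewrite (sofP v0 H).
Qed.

Lemma lyness9_infinite : infinite_set [set p : rat * rat | lyness_periodic a 9 p].
Proof.
move=> /finite_seqP[s sE].
have [P [e [oP e0 Pe]]] := root_right a_gt0 x0 y0 E R.
have fP := abscissa_gt0 no_root (ex_intro2 _ _ P oP erefl : abscissa _ _ (ratr P.1 : R)).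
(* The inverse change of coordinates: it recovers the Weierstrass abscissa, so finitely many
   periodic points would account for finitely many abscissas only. *)
pose g (p : rat * rat) := w_b a / 3 - w_c a / mof a p.1 p.2.
have [Q [oQ _ Qs]] := w_dense_nbhs (bad_us ++ map g s) fP filterT.
move: Qs; rewrite mem_cat negb_or => /andP[Qb Qg].
have [v0 gQ] := good_of (eqP oQ) Qb.
have Qp := good_periodic a0 a1 gQ.
have : (xof a Q.1 Q.2, yof a Q.1 Q.2) \in s.
  by have : [set` s] (xof a Q.1 Q.2, yof a Q.1 Q.2) by rewrite -sE.
move/(map_f g); suff -> : g (xof a Q.1 Q.2, yof a Q.1 Q.2) = Q.1 by move=> Qs; move: Qg; rewrite Qs.
rewrite /g /mof /= xof_addy -[RHS](vofK a0 a1 a2); congr (_ - _).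
have -> : ck a - a ^+ 2 - a * sof a Q.1 = 1 / vof a Q.1.
  rewrite /sof /w_s; move: (ck a) (vof a Q.1) v0 => k v v0; field; by rewrite v0 a0.
move: (w_c a) (vof a Q.1) v0 => c v v0; by field.
Qed.

Lemma disc_ratr : 4 * ratr (w_p a) ^+ 3 + 27 * ratr (w_q a) ^+ 2 != 0 :> R.
Proof.
move: (disc_neq0 no_root); rewrite -(fmorph_eq0 (@ratr R)) /disc; move: (w_p a) (w_q a) => p q.
by rewrite rmorphD (rmorphM _ 4) (rmorphM _ 27) (rmorphXn _ 3) (rmorphXn _ 2) !rmorph_nat.
Qed.

Lemma w_continuous (s : R) u : vof (ratr a) u != 0 ->
  (fun v => (xof (ratr a) v (s * Num.sqrt (f v)), yof (ratr a) v (s * Num.sqrt (f v)))) @ u -->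
  (xof (ratr a) u (s * Num.sqrt (f u)), yof (ratr a) u (s * Num.sqrt (f u))).
Proof.
move=> v0; have aR : ratr a != 0 :> R by rewrite fmorph_eq0.
have cR : w_c (ratr a) != 0 :> R by rewrite -ratr_w_c fmorph_eq0 w_c_neq0.
have cv : vof (ratr a) v @[v --> u] --> (vof (ratr a) u : R).
  by apply: cvgM; [apply: cvgB; [exact: cvg_cst|exact: cvg_id]|exact: cvg_cst].
have cs : sof (ratr a) v @[v --> u] --> (sof (ratr a) u : R).
  apply: cvgB; first exact: cvg_cst; apply: cvgM; first exact: cvg_cst.
  by apply: cvgV; [rewrite mulf_neq0|apply: cvgM; [exact: cvg_cst|exact: cv]].
have cf : Num.sqrt (f v) @[v --> u] --> Num.sqrt (f u).
  by apply: (@cvg_comp _ _ _ f Num.sqrt); [exact: cub_continuous|exact: sqrt_continuous].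
have cd : s * Num.sqrt (f v) / (w_c (ratr a) * vof (ratr a) v) @[v --> u] -->
    s * Num.sqrt (f u) / (w_c (ratr a) * vof (ratr a) u).
  apply: cvgM; first by apply: cvgM; [exact: cvg_cst|exact: cf].
  by apply: cvgV; [rewrite mulf_neq0|apply: cvgM; [exact: cvg_cst|exact: cv]].
have cx : xof (ratr a) v (s * Num.sqrt (f v)) @[v --> u] --> xof (ratr a) u (s * Num.sqrt (f u)).
  by apply: cvgM; [apply: cvgD|exact: cvg_cst].
have cy : yof (ratr a) v (s * Num.sqrt (f v)) @[v --> u] --> yof (ratr a) u (s * Num.sqrt (f u)).
  by apply: cvgM; [apply: cvgB|exact: cvg_cst].
exact: (cvg_pair cx cy).
Qed.

(** On a branch with fixed sign [s] of Y, the real curve is a continuous image of the abscissa.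
    Since the cubic may vanish at [u], the abscissa is moved first to a nearby place where it is
    positive, then to a rational point avoiding [bad_us]. *)
Lemma lyness9_dense : lyness9_curve (ratr a : R) `<=`
  closure [set real_point R p | p in [set p : rat * rat | lyness_periodic a 9 p]].
Proof.
case=> X Y EXY B BXY.
have aR0 : ratr a != 0 :> R by rewrite fmorph_eq0.
have aR1 : ratr a - 1 != 0 :> R by rewrite -(rmorph1 (@ratr R)) -rmorphB fmorph_eq0.
have aR2 := sqr_subD1_neq0 (ratr a : R).
have EC : onC (ratr a) X Y = 0 by rewrite -EXY /onC /ck /=.
have [u [t [tE vE XE YE]]] := weierstrass aR0 aR1 aR2 EC.
have v0 : vof (ratr a) u != 0 by rewrite vE div1r invr_neq0 // mof_neq0.
rewrite -ratr_w_p -ratr_w_q -/(f u) in tE.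
have fu : 0 <= f u by rewrite -tE sqr_ge0.
have [s [s1 st]] : exists s : rat, `|s| = 1 /\ t = ratr s * Num.sqrt (f u).
  rewrite -tE sqrtr_sqr; case: (leP 0 t) => t0; [exists 1|exists (-1)]; rewrite ?normrN normr1; split=> //.
    by rewrite rmorph1 mul1r ger0_norm.
  by rewrite rmorphN rmorph1 mulN1r ltr0_norm // opprK.
have := @w_continuous (ratr s) u v0 B; rewrite -st -XE -YE => /(_ BXY) uB.
have [w fw wB] := cub_pos_near disc_ratr fu uB.
have [Q [oQ QB Qb]] := w_dense_nbhs bad_us fw wB.
have tE' : (s * `|Q.2|) ^+ 2 = cub (w_p a) (w_q a) Q.1.
  by rewrite -(eqP oQ) exprMn real_normK ?num_real // -[s ^+ 2]real_normK ?num_real // s1 expr1n mul1r.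
have [_ g] := good_of tE' Qb.
exists (real_point R (xof a Q.1 (s * `|Q.2|), yof a Q.1 (s * `|Q.2|))); split.
  by exists (xof a Q.1 (s * `|Q.2|), yof a Q.1 (s * `|Q.2|)) => //; exact: good_periodic.
move: QB; rewrite /real_point /= ratr_xof ratr_yof rmorphM /= ratr_norm.
suff -> : Num.sqrt (f (ratr Q.1)) = `|ratr Q.2| by [].
by rewrite /f -ratr_cub -(eqP oQ) (rmorphXn _ 2) sqrtr_sqr.
Qed.
End Density.

Theorem proposition4 (R : realType) (a : rat) (a_gt0 : 0 < a)
  (ex9 : exists x0 x1 : rat,
    [/\ 0 < x0, 0 < x1 & lyness_periodic a 9 (x0, x1)]) :
  infinite_set [set p : rat * rat | lyness_periodic a 9 p] /\
  fills_densely
    [set real_point R p | p in [set p : rat * rat | lyness_periodic a 9 p]]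
    (lyness9_curve (ratr a : R)).
Proof.
case: ex9 => x [y [x0 y0 per]].
have E := lyness9_onC per.
split; first exact: (lyness9_infinite R a_gt0 x0 y0 E).
split; last exact: (lyness9_dense a_gt0 x0 y0 E).
move=> _ [p pp <-]; rewrite /lyness9_curve /real_point /=.
have := ratr_onC R a p.1 p.2; rewrite (lyness9_onC pp) rmorph0 => H.
by rewrite [RHS]H.
Qed.
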